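(* Let $t\in[0,T)$ and $X^t\in H$, with $\bar X^t:=\int_{\mathbb R^n}X^t_x\,dm(x)$. For a control $V(\cdot)\in L^2(t,T;U)$, let $X(\cdot)$ be the solution of $$\frac{d}{ds}X_x(s)=F(s)X_x(s)+\bar F(s)\bar X(s)+G(s)V_x(s)+f(s),\qquad X_x(t)=X^t_x,\quad x\in\mathbb R^n,$$ where $\bar X(s)=\int X_x(s)\,dm(x)$. Consider the payoff $$J_{Xt}(V(\cdot))=\int_t^T\Big[\tfrac12(\mathcal M(s)X(s),X(s))_H+\tfrac12(N(s)V(s),V(s))_U+\alpha(s)\cdot\bar X(s)+\beta(s)\cdot\bar V(s)\Big]ds+\tfrac12(\mathcal M_TX(T),X(T))_H+\alpha_T\cdot\bar X(T),$$ with $\bar V(s)=\int V_x(s)\,dm(x)$. Let $P$ and $\Sigma$ be the (unique, symmetric positive semidefinite) solutions on $[t,T]$ of $$\dot P+PF+F^*P-PGN^{-1}G^*P+M+\bar M=0,\quad P(T)=M_T+\bar M_T,$$ $$\dot \Sigma+\Sigma(F+\bar F)+(F+\bar F)^*\Sigma-\Sigma GN^{-1}G^*\Sigma+M+\bar M+\bar M_S=0,\quad \Sigma(T)=M_T+\bar M_T+\bar M_S(T),$$ set $\Gamma:=\Sigma-P$, and let $\lambda:[t,T]\to\mathbb R^n$ solve $$\dot\lambda+(F^*+\bar F^*-\Sigma GN^{-1}G^* )\lambda+\alpha+\Sigma(f-GN^{-1}\beta)=0,\quad \lambda(T)=\alpha_T.$$ Let $\hat{\bar X}$ and $\hat X_x$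 solve $$\dot{\hat{\bar X}}=(F+\bar F-GN^{-1}G^*\Sigma)\hat{\bar X}-GN^{-1}(G^*\lambda+\beta)+f,\quad \hat{\bar X}(t)=\bar X^t,$$ $$\dot{\hat X}_x=(F-GN^{-1}G^*P)\hat X_x+(\bar F-GN^{-1}G^*\Gamma)\hat{\bar X}-GN^{-1}(G^*\lambda+\beta)+f,\quad \hat X_x(t)=X^t_x.$$ Then the control $$\hat V_x(s)=-N^{-1}(s)G^*(s)\big(P(s)\hat X_x(s)+\Gamma(s)\hat{\bar X}(s)\big)-N^{-1}(s)\big(G^*(s)\lambda(s)+\beta(s)\big)$$ is the unique minimizer of $J_{Xt}$ over $L^2(t,T;U)$, and $$\inf_{V(\cdot)}J_{Xt}(V(\cdot))=\tfrac12\int_{\mathbb R^n}P(t)X^t_x\cdot X^t_x\,dm(x)+\tfrac12\Gamma(t)\bar X^t\cdot\bar X^t+\lambda(t)\cdot\bar X^t+C_t,$$ where $C_t=\int_t^Tf(s)\cdot\lambda(s)\,ds-\tfrac12\int_t^TN^{-1}(s)(G^*(s)\lambda(s)+\beta(s))\cdot(G^*(s)\lambda(s)+\beta(s))\,ds$.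
   Context: Let $m$ be a probability measure on $\mathbb R^n$, $H=L^2_m(\mathbb R^n;\mathbb R^n)$ and $U=L^2_m(\mathbb R^n;\mathbb R^d)$ with $(X,Y)_H=\int X_x\cdot Y_x\,dm(x)$, $(V,W)_U=\int V_x\cdot W_x\,dm(x)$; for $X\in H$, $\bar X=\int X_x\,dm(x)$. Data: $F,\bar F,M,\bar M,S\in L^\infty(0,T;\mathbb R^{n\times n})$ with $M,\bar M$ symmetric; $G\in L^\infty(0,T;\mathbb R^{n\times d})$; $N$ symmetric positive definite with $N,N^{-1}\in L^\infty(0,T;\mathbb R^{d\times d})$; $M_T,\bar M_T$ symmetric $n\times n$ matrices; $f\in L^2(0,T;\mathbb R^n)$, $\alpha\in L^\infty(0,T;\mathbb R^n)$, $\beta\in L^\infty(0,T;\mathbb R^d)$, $\alpha_T\in\mathbb R^n$. Define $\bar M_S(s)=S^*(s)\bar M(s)S(s)-S^*(s)\bar M(s)-\bar M(s)S(s)$ and $\bar M_S(T)=S^*(T)\bar M_TS(T)-S^*(T)\bar M_T-\bar M_TS(T)$. Operators on $H$: $(\mathcal M(s)X)_x=(M(s)+\bar M(s))X_x+\bar M_S(s)\bar X$, $(\mathcal M_TX)_x=(M_T+\bar M_T)X_x+\bar M_S(T)\bar X$. Standing assumption: $M(s)+\bar M(s)$, $M(s)+\bar M(s)+\bar M_S(s)$ (for all $s$), $M_T+\bar M_T$ and $M_T+\bar M_T+\bar M_S(T)$ are positive semidefinite. *)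

(* Defs.v *)
From HB Require Import structures.
From mathcomp Require Import all_boot all_order all_algebra.
From mathcomp Require Import all_classical all_reals all_analysis.
Import Order.TTheory GRing.Theory Num.Theory.
Import numFieldNormedType.Exports.

Set Implicit Arguments.
Unset Strict Implicit.
Unset Printing Implicit Defensive.

Local Open Scope classical_set_scope.
Local Open Scope ring_scope.

Definition Rn (R : realType) (n : nat) : Type :=
  g_sigma_algebraType (@open 'cV[R]_n).

Section Defs.
Variable R : realType.
Local Notation mu := (@lebesgue_measure R).

Definition dotv (k : nat) (u v : 'cV[R]_k) : R := \sum_(i < k) u i 0 * v i 0.
Definition normsq (k : nat) (u : 'cV[R]_k) : R := dotv u u.

Definition symmx (k : nat) (A : 'M[R]_k) : Prop := A^T = A.
Definition psdmx (k : nat) (A : 'M[R]_k) : Prop :=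
  forall u : 'cV[R]_k, 0 <= dotv u (A *m u).
Definition pdmx (k : nat) (A : 'M[R]_k) : Prop :=
  forall u : 'cV[R]_k, u != 0 -> 0 < dotv u (A *m u).

Variable n : nat.
Local Notation X := (Rn R n).

Definition mean (k : nat) (m : probability X R) (Y : X -> 'cV[R]_k) : 'cV[R]_k :=
  \col_i Rintegral m setT (fun x => Y x i 0).

Definition L2m (k : nat) (m : probability X R) (Y : X -> 'cV[R]_k) : Prop :=
  (forall i, measurable_fun setT (fun x => Y x i 0)) /\
  m.-integrable setT (fun x => (normsq (Y x))%:E).

Definition L2inner (k : nat) (m : probability X R) (Y Z : X -> 'cV[R]_k) : R :=
  Rintegral m setT (fun x => dotv (Y x) (Z x)).

Definition calM (m : probability X R) (A B : 'M[R]_n) (Y : X -> 'cV[R]_n) :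
  X -> 'cV[R]_n := fun x => A *m Y x + B *m mean m Y.

Definition mxint (p q : nat) (a b : R) (g : R -> 'M[R]_(p, q)) : 'M[R]_(p, q) :=
  \matrix_(i, j) Rintegral mu `[a, b] (fun r => g r i j).
Definition mxintegrable (p q : nat) (a b : R) (g : R -> 'M[R]_(p, q)) : Prop :=
  forall i j, mu.-integrable `[a, b] (fun r => (g r i j)%:E).

(* y solves y' = g(.) on [a,b] with y(a) = y0 (Caratheodory / integral form);
   g is the right-hand side already evaluated along y. *)
Definition fwd_sol (p q : nat) (a b : R) (y0 : 'M[R]_(p, q))
  (y : R -> 'M[R]_(p, q)) (g : R -> 'M[R]_(p, q)) : Prop :=
  mxintegrable a b g /\ forall s, a <= s <= b -> y s = y0 + mxint a s g.
(* y solves y' + g(.) = 0 on [a,b] with y(b) = yb (integral form) *)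
Definition bwd_sol (p q : nat) (a b : R) (yb : 'M[R]_(p, q))
  (y : R -> 'M[R]_(p, q)) (g : R -> 'M[R]_(p, q)) : Prop :=
  mxintegrable a b g /\ forall s, a <= s <= b -> y s = yb + mxint s b g.

Definition Linf (p q : nat) (T : R) (A : R -> 'M[R]_(p, q)) : Prop :=
  forall i j, measurable_fun `]0, T[ (fun s => A s i j) /\
    exists C : R, {ae mu, forall s, s \in `]0, T[ -> `|A s i j| <= C}.
Definition L2time (k : nat) (T : R) (f : R -> 'cV[R]_k) : Prop :=
  (forall i, measurable_fun `]0, T[ (fun s => f s i 0)) /\
  mu.-integrable `]0, T[ (fun s => (normsq (f s))%:E).

(* admissible controls: V in L^2(t,T;U), U = L^2_m(R^n;R^d), represented by a
   jointly measurable function (s,x) |-> V_x(s) with finite L^2 norm *)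
Definition admissible (d : nat) (m : probability X R) (t T : R)
  (V : R -> X -> 'cV[R]_d) : Prop :=
  (forall i, measurable_fun (`[t, T] `*` setT)
                (fun p : R * X => V p.1 p.2 i 0)) /\
  (\int[mu]_(s in `[t, T]) \int[m]_x (normsq (V s x))%:E < +oo)%E.

Definition is_state (d : nat) (m : probability X R) (t T : R)
  (F Fb : R -> 'M[R]_n) (G : R -> 'M[R]_(n, d)) (f : R -> 'cV[R]_n)
  (Xt : X -> 'cV[R]_n) (V : R -> X -> 'cV[R]_d) (Y : R -> X -> 'cV[R]_n) : Prop :=
  (forall s, t <= s <= T -> L2m m (Y s)) /\
  {ae m, forall x, fwd_sol t T (Xt x) (fun s => Y s x)
     (fun r => F r *m Y r x + Fb r *m mean m (Y r) + G r *m V r x + f r)}.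

(* the payoff J_{Xt}(V) evaluated along the state Y of V *)
Definition payoff (d : nat) (m : probability X R) (t T : R)
  (calMs : R -> (X -> 'cV[R]_n) -> (X -> 'cV[R]_n))
  (calMT : (X -> 'cV[R]_n) -> (X -> 'cV[R]_n))
  (N : R -> 'M[R]_d) (alpha : R -> 'cV[R]_n) (beta : R -> 'cV[R]_d)
  (alphaT : 'cV[R]_n) (V : R -> X -> 'cV[R]_d) (Y : R -> X -> 'cV[R]_n) : R :=
  Rintegral mu `[t, T] (fun s =>
      2^-1 * L2inner m (calMs s (Y s)) (Y s)
    + 2^-1 * L2inner m (fun x => N s *m V s x) (V s)
    + dotv (alpha s) (mean m (Y s)) + dotv (beta s) (mean m (V s)))
  + 2^-1 * L2inner m (calMT (Y T)) (Y T) + dotv alphaT (mean m (Y T)).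

End Defs.

(* Main.v *)
Require Import Defs.
From HB Require Import structures.
From mathcomp Require Import all_boot all_order all_algebra.
From mathcomp Require Import all_classical all_reals all_analysis.
From mathcomp Require Import measurable_realfun ring lra.
Import Order.TTheory GRing.Theory Num.Theory.
Import numFieldNormedType.Exports.
Set Implicit Arguments.
Unset Strict Implicit.
Unset Printing Implicit Defensive.
Local Open Scope classical_set_scope.
Local Open Scope ring_scope.

(** Completion of squares.  Differentiating
    [1/2 E(P Y.Y) + 1/2 (Sigma - P) yb.yb + lambda.yb] along a state [Y] with
    mean [yb], and using the equations of [P], [Sigma] and [lambda], gives
      [J(V) = value + 1/2 \int_t^T E(N w.w)],
    where [w] is the difference between [V] and the feedback control computed
    from [Y]: pointwise in [x] the integrands differ only by terms linear in
    [Y_x - yb] and [V_x - vb], whose mean vanishes.  As [N > 0] this proves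
    minimality; if the integral vanishes then [w = 0] almost everywhere, so [Y]
    solves the closed-loop equation and coincides with [Xh] by uniqueness of
    linear ODEs.  Solutions are only absolutely continuous, so the product rule
    is obtained from Fubini's theorem on a triangle, and Gronwall's lemma gives
    the square-integrable majorant of the paths needed to exchange the
    integrals in time and space. *)

(** * Function classes *)

(** The value function splits: [E(P Y.Y) + (Sigma - P) yb.yb] equals
    [E(P(Y - yb).(Y - yb)) + Sigma yb.yb], so [P] governs the fluctuation around the mean, with
    drift [F], and [Sigma] the mean itself, with drift [F + Fb]. This is why two Riccati equations
    appear. The obstacle is measurability. [is_state] speaks of each time slice and of almost every
    path, but not of joint measurability in time and space, so a state can neither be averaged nor
    put under Fubini as it stands. It is replaced by a regular modification with almost everywhere
    equal slices; the payoff sees only slices. The paths [Xh], given point by point in [x], get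
    their regularity from linearity in the initial value: [Xh] inherits measurability from [Xt], and
    its mean is then identified with [Xhb]. In the uniqueness part the mean has to come first. The
    feedback contains the mean of [Y], and only once averaging has shown that this mean is [Xhb]
    does every single path solve a linear equation with known forcing. *)

Section function_classes.
Context d (T : measurableType d) (R : realType) (mu : {measure set T -> \bar R}).
Implicit Types (E : set T) (g h : T -> R).

(** All integrability conditions are reduced to three scalar classes with the rules [Lbf * L1f] in
    [L1f], [Lbf * L2f] in [L2f] and [L2f * L2f] in [L1f]; on a set of finite measure [Lbf] is
    contained in [L2f], and [L2f] in [L1f]. *)
Definition L1f E g := mu.-integrable E (EFin \o g).
Definition L2f E g := measurable_fun E g /\ L1f E (fun x => g x ^+ 2).
Definition Lbf E g := measurable_fun E g /\
  exists C : R, {ae mu, forall x, E x -> `|g x| <= C}.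

Lemma aeS (P Q : T -> Prop) : (forall x, P x -> Q x) ->
  {ae mu, forall x, P x} -> {ae mu, forall x, Q x}.
Proof. exact: filterS. Qed.

Lemma aeS2 (P Q S : T -> Prop) : (forall x, P x -> Q x -> S x) ->
  {ae mu, forall x, P x} -> {ae mu, forall x, Q x} -> {ae mu, forall x, S x}.
Proof. exact: filterS2. Qed.

Lemma ae_finite (I : finType) (P : I -> T -> Prop) :
  (forall i, {ae mu, forall x, P i x}) -> {ae mu, forall x, forall i, P i x}.
Proof. exact: filter_forall. Qed.

Lemma L1f_measurable E g : L1f E g -> measurable_fun E g.
Proof. by move=> /integrableP[/measurable_EFinP]. Qed.

Lemma L1f_ext E g h : {in E, g =1 h} -> measurable E -> L1f E g -> L1f E h.
Proof.
move=> gh mE; apply: eq_integrable => // x xE /=.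
by rewrite gh.
Qed.

Lemma ae_le_L1f E g h : measurable E -> measurable_fun E g ->
  {ae mu, forall x, E x -> `|g x| <= h x} -> L1f E h -> L1f E g.
Proof.
move=> mE mg gh /integrableP[/measurable_EFinP mh hoo].
apply/integrableP; split; first exact/measurable_EFinP.
apply: le_lt_trans hoo; apply: ae_ge0_le_integral => //.
- by apply/measurable_EFinP; exact: measurableT_comp.
- by apply/measurable_EFinP; exact: measurableT_comp.
- apply: filterS gh => x ghx xE /=; rewrite lee_fin.
  exact: le_trans (ghx xE) (ler_norm _).
Qed.

Lemma le_L1f E g h : measurable E -> measurable_fun E g ->
  (forall x, E x -> `|g x| <= h x) -> L1f E h -> L1f E g.
Proof. by move=> mE mg gh; apply: ae_le_L1f => //; apply: aeW. Qed.

Lemma L1fD E g h : measurable E -> L1f E g -> L1f E h ->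
  L1f E (fun x => g x + h x).
Proof. by move=> mE g1 h1; have := integrableD mE g1 h1. Qed.

Lemma L1fN E g : measurable E -> L1f E g -> L1f E (fun x => - g x).
Proof. by move=> mE g1; have := integrableN g1. Qed.

Lemma L1fB E g h : measurable E -> L1f E g -> L1f E h ->
  L1f E (fun x => g x - h x).
Proof. by move=> mE g1 h1; apply: L1fD => //; apply: L1fN. Qed.

Lemma L1fZ E (k : R) g : measurable E -> L1f E g -> L1f E (fun x => k * g x).
Proof. by move=> mE g1; have := integrableZl mE k g1. Qed.

Lemma L1f_norm E g : L1f E g -> L1f E (fun x => `|g x|).
Proof. by move=> /integrable_norm. Qed.

Lemma L1f_sum E (I : finType) (g : I -> T -> R) : measurable E ->
  (forall i, L1f E (g i)) -> L1f E (fun x => \sum_i g i x).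
Proof.
move=> mE g1; have := @integrable_sum _ _ _ mu E mE _ (index_enum I) xpredT
  (fun i x => (g i x)%:E) (fun i _ => g1 i).
by apply: eq_integrable => // x _ /=; rewrite sumEFin.
Qed.

Lemma L1f_cst E (k : R) : measurable E -> (mu E < +oo)%E -> L1f E (fun=> k).
Proof.
move=> mE Eoo; apply: measurable_bounded_integrable => //.
by exists `|k|; split => //= M kM x _ /=; apply: ltW.
Qed.

Lemma L1fS E (D : set T) g : measurable E -> measurable D -> D `<=` E ->
  L1f E g -> L1f D g.
Proof. by move=> mE mD DE; apply: integrableS. Qed.

Lemma Rintegral_sum E (I : finType) (g : I -> T -> R) : measurable E ->
  (forall i, L1f E (g i)) ->
  Rintegral mu E (fun x => \sum_i g i x) = \sum_i Rintegral mu E (g i).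
Proof.
move=> mE g1; rewrite /Rintegral.
under eq_integral do rewrite -sumEFin.
rewrite integral_sum// sum_fine// => i _.
exact: (integrable_fin_num mE (g1 i)).
Qed.

Lemma RintegralN E g : measurable E -> L1f E g ->
  Rintegral mu E (fun x => - g x) = - Rintegral mu E g.
Proof.
move=> mE g1; rewrite -mulN1r -RintegralZl//.
by apply: eq_Rintegral => x _; rewrite mulN1r.
Qed.

Lemma ae_eq_Rintegral E g h : measurable E ->
  measurable_fun E g -> measurable_fun E h ->
  {ae mu, forall x, E x -> g x = h x} -> Rintegral mu E g = Rintegral mu E h.
Proof.
move=> mE mg mh gh; rewrite /Rintegral; congr fine.
apply: ae_eq_integral => //.
- exact/measurable_EFinP.
- exact/measurable_EFinP.
- by apply: filterS gh => x ghx xE /=; rewrite ghx.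
Qed.

Lemma Rintegral_ge0_eq0 E g : measurable E -> L1f E g ->
  {ae mu, forall x, E x -> 0 <= g x} -> Rintegral mu E g = 0 ->
  {ae mu, forall x, E x -> g x = 0}.
Proof.
move=> mE g1 g0 I0; have mg := L1f_measurable g1.
have I0' : Rintegral mu E (fun x => `|g x|) = 0.
  rewrite -I0; apply: ae_eq_Rintegral => //; first exact: measurableT_comp.
  by apply: aeS g0 => x gx Ex; rewrite ger0_norm ?gx.
have fin := integrable_fin_num mE (L1f_norm g1).
have : (\int[mu]_(x in E) `|(g x)%:E| = 0)%E.
  by have := congr1 EFin I0'; rewrite /Rintegral fineK.
have mEg : measurable_fun E (EFin \o g) by exact/measurable_EFinP.
move=> /(ae_eq_integral_abs mu mE mEg).1; apply: aeS => x Hx /Hx.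
by move=> [].
Qed.

Lemma LbfD E g h : measurable E -> Lbf E g -> Lbf E h ->
  Lbf E (fun x => g x + h x).
Proof.
move=> mE [mg [C gC]] [mh [D hD]]; split; first exact: measurable_funD.
exists (C + D); apply: filterS2 gC hD => x gC hD xE.
exact: le_trans (ler_normD _ _) (lerD (gC xE) (hD xE)).
Qed.

Lemma LbfM E g h : measurable E -> Lbf E g -> Lbf E h ->
  Lbf E (fun x => g x * h x).
Proof.
move=> mE [mg [C gC]] [mh [D hD]]; split; first exact: measurable_funM.
exists (C * D); apply: filterS2 gC hD => x gC hD xE.
by rewrite normrM ler_pM// ?gC ?hD.
Qed.

Lemma Lbf_cst E (k : R) : measurable E -> Lbf E (fun=> k).
Proof.
by move=> mE; split; [exact: measurable_cst|exists `|k|; apply: aeW].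
Qed.

Lemma LbfN E g : measurable E -> Lbf E g -> Lbf E (fun x => - g x).
Proof.
move=> mE [mg [C gC]]; split; first exact: measurableT_comp.
by exists C; apply: filterS gC => x gC xE; rewrite normrN gC.
Qed.

Lemma Lbf_sum E (I : finType) (g : I -> T -> R) : measurable E ->
  (forall i, Lbf E (g i)) -> Lbf E (fun x => \sum_i g i x).
Proof.
move=> mE gb; suff H s : Lbf E (fun x => \sum_(i <- s) g i x) by exact: H.
elim: s => [|i s IH].
  by under eq_fun do rewrite big_nil; exact: Lbf_cst.
by under eq_fun do rewrite big_cons; exact: LbfD.
Qed.

Lemma LbfL1M E g h : measurable E -> Lbf E g -> L1f E h ->
  L1f E (fun x => g x * h x).
Proof.
move=> mE [mg [C gC]] h1.
apply: (@ae_le_L1f _ _ (fun x => C * `|h x|)) => //.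
- by apply: measurable_funM => //; exact: L1f_measurable h1.
- by apply: filterS gC => x gC xE; rewrite normrM ler_wpM2r// gC.
- by apply: L1fZ => //; exact: L1f_norm.
Qed.

Lemma Lbf_L1f E g : measurable E -> (mu E < +oo)%E -> Lbf E g -> L1f E g.
Proof.
move=> mE Eoo gb; apply: (L1f_ext _ mE (LbfL1M mE gb (L1f_cst 1 mE Eoo))).
by move=> x _; rewrite mulr1.
Qed.

(** The majorant [g^2 + h^2] of [|g h|] comes from the nonnegativity of the squares of [g + h] and
    [g - h]. *)
Lemma L2fM E g h : measurable E -> L2f E g -> L2f E h ->
  L1f E (fun x => g x * h x).
Proof.
move=> mE [mg g2] [mh h2].
apply: (@le_L1f _ _ (fun x => g x ^+ 2 + h x ^+ 2)) => //.
- exact: measurable_funM.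
- move=> x xE; rewrite ler_norml.
  have := sqr_ge0 (g x + h x); have := sqr_ge0 (g x - h x).
  have := sqr_ge0 (g x); have := sqr_ge0 (h x).
  by rewrite sqrrB sqrrD => ? ? ? ?; apply/andP; split; lra.
- exact: L1fD.
Qed.

Lemma L2fD E g h : measurable E -> L2f E g -> L2f E h ->
  L2f E (fun x => g x + h x).
Proof.
move=> mE g2 h2; split; first by apply: measurable_funD; [case: g2|case: h2].
apply: (@L1f_ext _ (fun x => (g x ^+ 2 + h x ^+ 2) + 2 * (g x * h x))) => //.
  by move=> x _; rewrite sqrrD; ring.
apply: L1fD => //; first by apply: L1fD => //; [case: g2|case: h2].
by apply: L1fZ => //; apply: L2fM.
Qed.

Lemma LbfL2M E g h : measurable E -> Lbf E g -> L2f E h ->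
  L2f E (fun x => g x * h x).
Proof.
move=> mE gb [mh h2]; split; first by apply: measurable_funM => //; case: gb.
apply: (@L1f_ext _ (fun x => (g x * g x) * (h x ^+ 2))) => //.
  by move=> x _; ring.
by apply: LbfL1M => //; apply: LbfM.
Qed.

Lemma L2fZ E (k : R) g : measurable E -> L2f E g -> L2f E (fun x => k * g x).
Proof. by move=> mE g2; apply: LbfL2M => //; apply: Lbf_cst. Qed.

Lemma Lbf_L2f E g : measurable E -> (mu E < +oo)%E -> Lbf E g -> L2f E g.
Proof.
move=> mE Eoo gb; split; first by case: gb.
apply: Lbf_L1f => //.
by rewrite (_ : (fun _ => _) = (fun x => g x * g x)) //; exact: LbfM.
Qed.

Lemma L2f_L1f E g : measurable E -> (mu E < +oo)%E -> L2f E g -> L1f E g.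
Proof.
move=> mE Eoo g2.
apply: (L1f_ext _ mE (L2fM mE (Lbf_L2f mE Eoo (Lbf_cst 1 mE)) g2)).
by move=> x _; rewrite mul1r.
Qed.

Lemma L2f_sum E (I : finType) (g : I -> T -> R) : measurable E ->
  (mu E < +oo)%E ->
  (forall i, L2f E (g i)) -> L2f E (fun x => \sum_i g i x).
Proof.
move=> mE Eoo gb.
suff H s : L2f E (fun x => \sum_(i <- s) g i x) by exact: H.
elim: s => [|i s IH].
  under eq_fun do rewrite big_nil.
  by apply: Lbf_L2f => //; exact: Lbf_cst.
by under eq_fun do rewrite big_cons; exact: L2fD.
Qed.

Lemma le_L2f E g h : measurable E -> measurable_fun E g ->
  {ae mu, forall x, E x -> `|g x| <= h x} -> L2f E h -> L2f E g.
Proof.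
move=> mE mg gh [mh h2]; split => //; apply: ae_le_L1f h2 => //.
  exact: measurable_funX.
apply: filterS gh => x ghx xE; rewrite normrX.
by apply: lerXn2r; rewrite ?nnegrE ?ghx// (le_trans _ (ghx xE)).
Qed.

Lemma L2f_ext E g h : {in E, g =1 h} -> measurable E -> L2f E g -> L2f E h.
Proof.
move=> gh mE [mg g2]; split; first by apply: eq_measurable_fun mg.
by apply: L1f_ext g2 => // x xE; rewrite gh.
Qed.

Lemma L2f_norm E g : L2f E g -> L2f E (fun x => `|g x|).
Proof.
move=> [mg g2]; split; first exact: measurableT_comp.
by under eq_fun do rewrite real_normK ?num_real//.
Qed.

Lemma LbfS E (D : set T) g : measurable E -> measurable D -> D `<=` E ->
  Lbf E g -> Lbf D g.
Proof.
move=> mE mD DE [mg [C gC]]; split; first exact: measurable_funS mg.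
by exists C; apply: filterS gC => x gC /DE.
Qed.

End function_classes.

(** * Entrywise classes of matrix-valued functions *)

Section matrix_classes.
Context d (T : measurableType d) (R : realType) (mu : {measure set T -> \bar R}).
Context (E : set T).

(** On a time interval with Lebesgue measure, [mxL1] is convertible to [mxintegrable] and [mxI] to
    [mxint], so the lemmas on these classes apply directly to [fwd_sol] and [bwd_sol]. *)
Definition mxL1 p q (A : T -> 'M[R]_(p, q)) :=
  forall i j, L1f mu E (fun x => A x i j).
Definition mxL2 p q (A : T -> 'M[R]_(p, q)) :=
  forall i j, L2f mu E (fun x => A x i j).
Definition mxLb p q (A : T -> 'M[R]_(p, q)) :=
  forall i j, Lbf mu E (fun x => A x i j).
Definition mxI (D : set T) p q (A : T -> 'M[R]_(p, q)) : 'M[R]_(p, q) :=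
  \matrix_(i, j) Rintegral mu D (fun x => A x i j).

Context (mE : measurable E).

Lemma mxL1_ext p q (A B : T -> 'M[R]_(p, q)) :
  (forall x, E x -> A x = B x) -> mxL1 A -> mxL1 B.
Proof.
by move=> AB A1 i j; apply: L1f_ext (A1 i j) => // x /set_mem/AB ->.
Qed.

Lemma mxL1D p q (A B : T -> 'M[R]_(p, q)) :
  mxL1 A -> mxL1 B -> mxL1 (fun x => A x + B x).
Proof.
by move=> A1 B1 i j; under eq_fun do rewrite mxE; exact: L1fD.
Qed.

Lemma mxL1N p q (A : T -> 'M[R]_(p, q)) : mxL1 A -> mxL1 (fun x => - A x).
Proof.
by move=> A1 i j; under eq_fun do rewrite mxE; exact: L1fN.
Qed.

Lemma mxL1B p q (A B : T -> 'M[R]_(p, q)) :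
  mxL1 A -> mxL1 B -> mxL1 (fun x => A x - B x).
Proof. by move=> A1 B1; apply: mxL1D => //; apply: mxL1N. Qed.

Lemma mxL1_tr p q (A : T -> 'M[R]_(p, q)) : mxL1 A -> mxL1 (fun x => (A x)^T).
Proof. by move=> A1 i j; under eq_fun do rewrite mxE. Qed.

Lemma mxLbD p q (A B : T -> 'M[R]_(p, q)) :
  mxLb A -> mxLb B -> mxLb (fun x => A x + B x).
Proof.
by move=> A1 B1 i j; under eq_fun do rewrite mxE; exact: LbfD.
Qed.

Lemma mxLbN p q (A : T -> 'M[R]_(p, q)) : mxLb A -> mxLb (fun x => - A x).
Proof.
by move=> A1 i j; under eq_fun do rewrite mxE; exact: LbfN.
Qed.

Lemma mxLbB p q (A B : T -> 'M[R]_(p, q)) :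
  mxLb A -> mxLb B -> mxLb (fun x => A x - B x).
Proof. by move=> A1 B1; apply: mxLbD => //; apply: mxLbN. Qed.

Lemma mxLb_tr p q (A : T -> 'M[R]_(p, q)) : mxLb A -> mxLb (fun x => (A x)^T).
Proof. by move=> A1 i j; under eq_fun do rewrite mxE. Qed.

Lemma mxLbM p q r (A : T -> 'M[R]_(p, q)) (B : T -> 'M[R]_(q, r)) :
  mxLb A -> mxLb B -> mxLb (fun x => A x *m B x).
Proof.
move=> A1 B1 i j; under eq_fun do rewrite mxE.
by apply: Lbf_sum => // k; exact: LbfM.
Qed.

Lemma mxLb_cst p q (A : 'M[R]_(p, q)) : mxLb (fun=> A).
Proof. by move=> i j; exact: Lbf_cst. Qed.

Lemma mxLbL1M p q r (A : T -> 'M[R]_(p, q)) (B : T -> 'M[R]_(q, r)) :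
  mxLb A -> mxL1 B -> mxL1 (fun x => A x *m B x).
Proof.
move=> A1 B1 i j; under eq_fun do rewrite mxE.
by apply: L1f_sum => // k; exact: LbfL1M.
Qed.

Lemma mxL2D p q (A B : T -> 'M[R]_(p, q)) :
  mxL2 A -> mxL2 B -> mxL2 (fun x => A x + B x).
Proof.
by move=> A1 B1 i j; under eq_fun do rewrite mxE; exact: L2fD.
Qed.

Lemma mxL2N p q (A : T -> 'M[R]_(p, q)) : mxL2 A -> mxL2 (fun x => - A x).
Proof.
move=> A1 i j; under eq_fun do rewrite mxE -mulN1r.
exact: L2fZ.
Qed.

Lemma mxL2B p q (A B : T -> 'M[R]_(p, q)) :
  mxL2 A -> mxL2 B -> mxL2 (fun x => A x - B x).
Proof. by move=> A1 B1; apply: mxL2D => //; apply: mxL2N. Qed.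

Lemma mxL2_ext p q (A B : T -> 'M[R]_(p, q)) :
  (forall x, E x -> A x = B x) -> mxL2 A -> mxL2 B.
Proof.
by move=> AB A1 i j; apply: L2f_ext (A1 i j) => // x /set_mem/AB ->.
Qed.

Lemma dotv_L1 k (u v : T -> 'cV[R]_k) : mxL2 u -> mxL2 v ->
  L1f mu E (fun x => dotv (u x) (v x)).
Proof. by move=> u2 v2; apply: L1f_sum => // i; apply: L2fM. Qed.

Lemma dotv_LbL1 k (u v : T -> 'cV[R]_k) : mxLb u -> mxL1 v ->
  L1f mu E (fun x => dotv (u x) (v x)).
Proof. by move=> u2 v2; apply: L1f_sum => // i; apply: LbfL1M. Qed.

Context (Eoo : (mu E < +oo)%E).

Lemma mxLbL2M p q r (A : T -> 'M[R]_(p, q)) (B : T -> 'M[R]_(q, r)) :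
  mxLb A -> mxL2 B -> mxL2 (fun x => A x *m B x).
Proof.
move=> A1 B1 i j; under eq_fun do rewrite mxE.
by apply: L2f_sum => // k; exact: LbfL2M.
Qed.

Lemma mxLb_L2 p q (A : T -> 'M[R]_(p, q)) : mxLb A -> mxL2 A.
Proof. by move=> A1 i j; exact: Lbf_L2f. Qed.

Lemma mxLb_L1 p q (A : T -> 'M[R]_(p, q)) : mxLb A -> mxL1 A.
Proof. by move=> A1 i j; exact: Lbf_L1f. Qed.

Lemma mxL2_L1 p q (A : T -> 'M[R]_(p, q)) : mxL2 A -> mxL1 A.
Proof. by move=> A1 i j; exact: L2f_L1f. Qed.

End matrix_classes.

(** * Linearity of matrix-valued integrals *)

Section matrix_integral.
Context d (T : measurableType d) (R : realType) (mu : {measure set T -> \bar R}).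
Context (E : set T) (mE : measurable E).

Lemma mxI_ext p q (A B : T -> 'M[R]_(p, q)) :
  (forall x, E x -> A x = B x) -> mxI mu E A = mxI mu E B.
Proof.
move=> AB; apply/matrixP => i j; rewrite !mxE.
by apply: eq_Rintegral => x /set_mem/AB ->.
Qed.

Lemma mxID p q (A B : T -> 'M[R]_(p, q)) : mxL1 mu E A -> mxL1 mu E B ->
  mxI mu E (fun x => A x + B x) = mxI mu E A + mxI mu E B.
Proof.
move=> A1 B1; apply/matrixP => i j; rewrite !mxE -RintegralD//.
- by apply: eq_Rintegral => x _; rewrite mxE.
- exact: A1.
- exact: B1.
Qed.

Lemma mxIN p q (A : T -> 'M[R]_(p, q)) : mxL1 mu E A ->
  mxI mu E (fun x => - A x) = - mxI mu E A.
Proof.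
move=> A1; apply/matrixP => i j; rewrite !mxE -RintegralN//.
by apply: eq_Rintegral => x _; rewrite mxE.
Qed.

Lemma mxIB p q (A B : T -> 'M[R]_(p, q)) : mxL1 mu E A -> mxL1 mu E B ->
  mxI mu E (fun x => A x - B x) = mxI mu E A - mxI mu E B.
Proof. by move=> A1 B1; rewrite mxID ?mxIN//; exact: mxL1N. Qed.

Lemma mxI_tr p q (A : T -> 'M[R]_(p, q)) :
  mxI mu E (fun x => (A x)^T) = (mxI mu E A)^T.
Proof.
apply/matrixP => i j; rewrite !mxE.
by apply: eq_Rintegral => x _; rewrite mxE.
Qed.

Lemma mxI_mull p q r (B : 'M[R]_(r, p)) (A : T -> 'M[R]_(p, q)) :
  mxL1 mu E A -> mxI mu E (fun x => B *m A x) = B *m mxI mu E A.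
Proof.
move=> A1; apply/matrixP => i j; rewrite !mxE.
under eq_Rintegral do rewrite mxE.
rewrite Rintegral_sum// => [|k]; last by apply: L1fZ => //; apply: A1.
by apply: eq_bigr => k _; rewrite mxE RintegralZl//; apply: A1.
Qed.

End matrix_integral.

(** * Fubini's theorem on rectangles *)

Section product_space.
Context d1 d2 (T1 : measurableType d1) (T2 : measurableType d2) (R : realType).
Context (m1 : {sigma_finite_measure set T1 -> \bar R}).
Context (m2 : {sigma_finite_measure set T2 -> \bar R}).
Context (D : set T1) (E : set T2) (mD : measurable D) (mE : measurable E).
Implicit Types (H : T1 * T2 -> R).
Local Notation pm := (m1 \x m2)%E.

Lemma measurable_setXD : measurable (D `*` E).
Proof. exact: measurableX. Qed.
Local Notation mDE := measurable_setXD.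

(** A section of the extension by zero off the rectangle is the extension by zero of a section. This
    transfers Tonelli and Fubini from the whole product to [D] times [E]. *)
Lemma restrict_setXE H x y :
  ((EFin \o H) \_ (D `*` E)) (x, y) =
  if x \in D then ((fun y => (H (x, y))%:E) \_ E) y else 0%E.
Proof.
rewrite /patch; case: ifPn.
  by move=> /set_mem[/= xD yE]; rewrite !mem_set.
move=> /negP xyDE; case: ifPn => // /set_mem xD; case: ifPn => // /set_mem yE.
by exfalso; apply: xyDE; rewrite mem_set.
Qed.

Lemma restrict_setXE2 H x y :
  ((EFin \o H) \_ (D `*` E)) (x, y) =
  if y \in E then ((fun x => (H (x, y))%:E) \_ D) x else 0%E.
Proof.
rewrite restrict_setXE /patch; case: ifPn; case: ifPn => //.
Qed.

Lemma measurable_fun_section1 H x : D x -> measurable_fun (D `*` E) H ->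
  measurable_fun E (fun y => H (x, y)).
Proof.
move=> Dx mH.
apply: (@measurable_comp _ _ _ _ _ _ (D `*` E) H E (pair x)) => //.
- exact: mDE.
- by move=> _ [y Ey <-].
- by apply: measurable_funTS; exact: pair1_measurable.
Qed.

Lemma measurable_fun_section2 H y : E y -> measurable_fun (D `*` E) H ->
  measurable_fun D (fun x => H (x, y)).
Proof.
move=> Ey mH.
apply: (@measurable_comp _ _ _ _ _ _ (D `*` E) H D (pair^~ y)) => //.
- exact: mDE.
- by move=> _ [x Dx <-].
- by apply: measurable_funTS; exact: pair2_measurable.
Qed.

Lemma measurable_fun_fstX (g : T1 -> R) : measurable_fun D g ->
  measurable_fun (D `*` E) (fun z => g z.1).
Proof.
move=> mg; apply: (@measurable_comp _ _ _ _ _ _ D g (D `*` E) fst) => //.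
- by move=> _ [z [Dz _] <-].
- by apply: measurable_funTS; exact: measurable_fst.
Qed.

Lemma measurable_fun_sndX (g : T2 -> R) : measurable_fun E g ->
  measurable_fun (D `*` E) (fun z => g z.2).
Proof.
move=> mg; apply: (@measurable_comp _ _ _ _ _ _ E g (D `*` E) snd) => //.
- by move=> _ [z [_ Ez] <-].
- by apply: measurable_funTS; exact: measurable_snd.
Qed.

Let restr H := (EFin \o H) \_ (D `*` E).

Let restr_meas H : measurable_fun (D `*` E) H -> measurable_fun setT (restr H).
Proof.
move=> mH; apply: (measurable_restrictT (EFin \o H) mDE).1.
exact/measurable_EFinP.
Qed.

Let restr_int H : L1f pm (D `*` E) H -> pm.-integrable setT (restr H).
Proof. by move=> H1; apply/(integrable_mkcond _ mDE).1. Qed.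

Let int_restr1 H x : D x ->
  (\int[m2]_y (restr H (x, y)) = \int[m2]_(y in E) (H (x, y))%:E)%E.
Proof.
move=> Dx; rewrite [RHS]integral_mkcond.
by apply: eq_integral => y _; rewrite /restr restrict_setXE mem_set.
Qed.

Let int_restr2 H y : E y ->
  (\int[m1]_x (restr H (x, y)) = \int[m1]_(x in D) (H (x, y))%:E)%E.
Proof.
move=> Ey; rewrite [RHS]integral_mkcond.
by apply: eq_integral => x _; rewrite /restr restrict_setXE2 mem_set.
Qed.

Lemma L1f_tonelli H : measurable_fun (D `*` E) H ->
  (\int[m1]_(x in D) \int[m2]_(y in E) `|H (x, y)|%:E < +oo)%E ->
  L1f pm (D `*` E) H.
Proof.
move=> mH Hoo; apply/(integrable_mkcond _ mDE).2.
apply/(integrable12ltyP m1 m2 (restr_meas mH)).2.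
apply: le_lt_trans Hoo; rewrite [leRHS]integral_mkcond.
rewrite le_eqVlt; apply/orP; left; apply/eqP.
apply: eq_integral => x _; rewrite /patch; case: ifPn => xD.
  rewrite [RHS]integral_mkcond; apply: eq_integral => y _.
  rewrite /restr restrict_setXE xD /patch.
  by case: ifPn; rewrite //= normr0.
rewrite integral0_eq// => y _.
by rewrite /restr restrict_setXE (negbTE xD) abse0.
Qed.

Lemma L1f_tonelli_lty H : L1f pm (D `*` E) H ->
  (\int[m1]_(x in D) \int[m2]_(y in E) `|H (x, y)|%:E < +oo)%E.
Proof.
move=> H1; have mH := L1f_measurable H1.
apply: le_lt_trans ((integrable12ltyP m1 m2 (restr_meas mH)).1 (restr_int H1)).
rewrite integral_mkcond.
rewrite le_eqVlt; apply/orP; left; apply/eqP.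
apply: eq_integral => x _; rewrite /patch; case: ifPn => xD.
  rewrite [LHS]integral_mkcond; apply: eq_integral => y _.
  rewrite /restr restrict_setXE xD /patch.
  by case: ifPn; rewrite //= normr0.
rewrite [RHS]integral0_eq// => y _.
by rewrite /restr restrict_setXE (negbTE xD) abse0.
Qed.

Lemma L1f_ae_section1 H : L1f pm (D `*` E) H ->
  {ae m1, forall x, D x -> L1f m2 E (fun y => H (x, y))}.
Proof.
move=> /restr_int/ae_integrable1; apply: filterS => x H1 Dx.
apply/(integrable_mkcond _ mE).2; apply: eq_integrable H1 => // y _.
by rewrite /restr restrict_setXE mem_set.
Qed.

Lemma L1f_ae_section2 H : L1f pm (D `*` E) H ->
  {ae m2, forall y, E y -> L1f m1 D (fun x => H (x, y))}.
Proof.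
move=> /restr_int/ae_integrable2; apply: filterS => y H1 Ey.
apply/(integrable_mkcond _ mD).2; apply: eq_integrable H1 => // x _.
by rewrite /restr restrict_setXE2 mem_set.
Qed.

(** An inner integral is an extended real that may be infinite on a null set, where [fine] returns
    0; neither integrability nor the integral notices this. *)
Let L1f_fine d (T : measurableType d) (m : {measure set T -> \bar R}) A
    (F : T -> \bar R) : measurable A -> m.-integrable A F ->
  L1f m A (fine \o F) /\ Rintegral m A (fine \o F) = fine (\int[m]_(x in A) F x)%E.
Proof.
move=> mA F1; have mF := measurable_int _ F1.
have mfF : measurable_fun A (EFin \o (fine \o F)).
  by apply/measurable_EFinP; apply: measurableT_comp => //; exact: fine_measurable.
have aeF := integrable_ae mA F1.
split.
  apply: le_integrable F1 => // x Ax /=.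
  by case: (F x) => [r||]//=; rewrite ?leey// normr0.
congr fine; apply: ae_eq_integral => //.
by apply: filterS aeF => x Fx Ax /=; rewrite fineK// Fx.
Qed.

Lemma L1f_fubini1 H : L1f pm (D `*` E) H ->
  L1f m1 D (fun x => Rintegral m2 E (fun y => H (x, y))) /\
  Rintegral m1 D (fun x => Rintegral m2 E (fun y => H (x, y))) =
  Rintegral pm (D `*` E) H.
Proof.
move=> H1; have rH := restr_int H1.
have F1 := integrableS measurableT mD (@subsetT _ _) (integrable_fubini_F rH).
have [G1 G2] := L1f_fine mD F1.
have FE x : x \in D -> (fine \o fubini_F m2 (restr H)) x =
    Rintegral m2 E (fun y => H (x, y)).
  by move=> /set_mem Dx; rewrite /fubini_F /= int_restr1.
split; first by apply: L1f_ext G1 => // x; exact: FE.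
rewrite -(eq_Rintegral _ FE) G2 /Rintegral; congr fine.
rewrite [RHS]integral_mkcond -(integral12_prod_meas1 rH) integral_mkcond.
apply: eq_integral => x _; rewrite /patch; case: ifPn => // xD.
rewrite /fubini_F integral0_eq// => y _.
by rewrite /restr restrict_setXE (negbTE xD).
Qed.

(** The distance between two controls is stated as an iterated extended-real integral; this form of
    Fubini evaluates it without passing through [fine] inside. *)
Lemma L1f_fubini_ereal H : L1f pm (D `*` E) H ->
  (\int[m1]_(x in D) \int[m2]_(y in E) (H (x, y))%:E)%E =
  (Rintegral pm (D `*` E) H)%:E.
Proof.
move=> H1; have rH := restr_int H1.
rewrite fineK; last exact: (integrable_fin_num mDE H1).
rewrite [RHS]integral_mkcond -(integral12_prod_meas1 rH) [LHS]integral_mkcond.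
apply: eq_integral => x _; rewrite /patch; case: ifPn => xD.
  by rewrite /fubini_F int_restr1//; exact: set_mem.
rewrite /fubini_F integral0_eq// => y _.
by rewrite /restr restrict_setXE (negbTE xD).
Qed.

Let integrable_fubini_snd (f : T1 * T2 -> \bar R) :
  pm.-integrable setT f -> m2.-integrable setT (fubini_G m1 f).
Proof.
move=> f1; have mf := measurable_int _ f1.
apply/integrableP; split; first exact: measurable_fubini_G f1.
apply: le_lt_trans ((integrable21ltyP m1 m2 mf).1 f1).
apply: ge0_le_integral => //.
- by apply: measurableT_comp => //; exact: measurable_fubini_G f1.
- apply: (@measurable_fun_fubini_tonelli_G _ _ _ _ _ m1 (abse \o f)) => [|z].
    exact: measurableT_comp.
  exact: abse_ge0.
- move=> y _; apply: le_abse_integral => //.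
  exact: measurable_fun_pair1.
Qed.

Lemma L1f_fubini2 H : L1f pm (D `*` E) H ->
  L1f m2 E (fun y => Rintegral m1 D (fun x => H (x, y))) /\
  Rintegral m2 E (fun y => Rintegral m1 D (fun x => H (x, y))) =
  Rintegral pm (D `*` E) H.
Proof.
move=> H1; have rH := restr_int H1.
have F1 := integrableS measurableT mE (@subsetT _ _) (integrable_fubini_snd rH).
have [G1 G2] := L1f_fine mE F1.
have FE x : x \in E -> (fine \o fubini_G m1 (restr H)) x =
    Rintegral m1 D (fun y => H (y, x)).
  by move=> /set_mem Dx; rewrite /fubini_G /= int_restr2.
split; first by apply: L1f_ext G1 => // x; exact: FE.
rewrite -(eq_Rintegral _ FE) G2 /Rintegral; congr fine.
rewrite [RHS]integral_mkcond -(integral21_prod_meas1 rH) integral_mkcond.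
apply: eq_integral => x _; rewrite /patch; case: ifPn => // xD.
rewrite /fubini_G integral0_eq// => y _.
by rewrite /restr restrict_setXE2 (negbTE xD).
Qed.

Lemma ae_fst (P : T1 -> Prop) : {ae m1, forall x, P x} ->
  {ae pm, forall z : T1 * T2, P z.1}.
Proof.
move=> [N [mN N0 PN]]; exists (N `*` setT); split.
- exact: measurableX.
- transitivity (m1 N * m2 setT)%E; last by rewrite N0 mul0e.
  exact: product_measure1E.
- by move=> z Pz; split => //; apply: PN.
Qed.

Lemma Lbf_fst g : Lbf m1 D g -> Lbf pm (D `*` E) (fun z => g z.1).
Proof.
move=> [mg [C gC]]; split; first exact: measurable_fun_fstX.
by exists C; apply: filterS (ae_fst gC) => z zC [/zC].
Qed.

Lemma L1f_fst g : (m2 E < +oo)%E -> L1f m1 D g ->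
  L1f pm (D `*` E) (fun z => g z.1).
Proof.
move=> Eoo g1; apply: L1f_tonelli.
  by apply: measurable_fun_fstX; exact: L1f_measurable g1.
under eq_integral do rewrite /= integral_cst//=.
have E_fin : m2 E \is a fin_num by rewrite ge0_fin_numE.
rewrite -(fineK E_fin) integralZr//; last first.
  by have := integrable_norm g1.
rewrite ltey_eq; apply/orP; left; rewrite fin_numM//.
by apply: integrable_fin_num => //; have := integrable_norm g1.
Qed.

Lemma L2f_fst g : (m2 E < +oo)%E -> L2f m1 D g ->
  L2f pm (D `*` E) (fun z => g z.1).
Proof.
move=> Eoo [mg g2]; split; first exact: measurable_fun_fstX.
exact: (L1f_fst Eoo g2).
Qed.

Lemma L1f_snd g : (m1 D < +oo)%E -> L1f m2 E g ->
  L1f pm (D `*` E) (fun z => g z.2).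
Proof.
move=> Doo g1; apply: L1f_tonelli.
  by apply: measurable_fun_sndX; exact: L1f_measurable g1.
rewrite /= integral_cst//=.
have D_fin : m1 D \is a fin_num by rewrite ge0_fin_numE.
rewrite ltey_eq; apply/orP; left; rewrite fin_numM//.
by apply: integrable_fin_num => //; have := integrable_norm g1.
Qed.

Lemma L2f_snd g : (m1 D < +oo)%E -> L2f m2 E g ->
  L2f pm (D `*` E) (fun z => g z.2).
Proof.
move=> Eoo [mg g2]; split; first exact: measurable_fun_sndX.
exact: (L1f_snd Eoo g2).
Qed.

Lemma L2f_ae_section1 H : L2f pm (D `*` E) H ->
  {ae m1, forall x, D x -> L2f m2 E (fun y => H (x, y))}.
Proof.
move=> [mH /L1f_ae_section1]; apply: filterS => x H2 Dx.
by split; [exact: measurable_fun_section1|exact: H2].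
Qed.

Lemma L2f_ae_section2 H : L2f pm (D `*` E) H ->
  {ae m2, forall y, E y -> L2f m1 D (fun x => H (x, y))}.
Proof.
move=> [mH /L1f_ae_section2]; apply: filterS => x H2 Dx.
by split; [exact: measurable_fun_section2|exact: H2].
Qed.

Lemma setX_lty : (m1 D < +oo)%E -> (m2 E < +oo)%E -> (pm (D `*` E) < +oo)%E.
Proof.
move=> Doo Eoo; rewrite (_ : pm (D `*` E) = (m1 D * m2 E)%E); last first.
  exact: product_measure1E.
by rewrite lte_mul_pinfty// ge0_fin_numE.
Qed.

End product_space.

(** * Integration by parts and Gronwall's lemma *)

Section time_interval.
Context (R : realType).
Local Notation mu := (@lebesgue_measure R).
Implicit Types (a b s : R) (g h : R -> R).

Lemma mu_itv_lty a b : (mu (`[a, b] : set R) < +oo)%E.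
Proof. by rewrite lebesgue_measure_itv/=; case: ifPn => _; rewrite ?ltry. Qed.

Lemma mu_itv_gt0 a b : a < b -> 0 < fine (mu (`[a, b] : set R)).
Proof.
by move=> ab; rewrite lebesgue_measure_itv/= lte_fin ab/= subr_gt0.
Qed.

Lemma subset_itvcc a b c e : a <= c -> e <= b ->
  (`[c, e] : set R) `<=` `[a, b].
Proof.
move=> ac eb x /=; rewrite !in_itv/= => /andP[cx xe].
by rewrite (le_trans ac cx) (le_trans xe eb).
Qed.

Lemma L1f_tensor a b g h : L1f mu `[a, b] g -> L1f mu `[a, b] h ->
  L1f (mu \x mu)%E (`[a, b] `*` `[a, b]) (fun z => g z.1 * h z.2).
Proof.
move=> g1 h1; apply: L1f_tonelli => //.
  apply: measurable_funM.
    by apply: measurable_fun_fstX => //; exact: L1f_measurable g1.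
  by apply: measurable_fun_sndX => //; exact: L1f_measurable h1.
have hN : (\int[mu]_(y in `[a, b]) `|h y|%:E)%E \is a fin_num.
  by apply: integrable_fin_num => //; exact: (integrable_norm h1).
under eq_integral => x _.
  under eq_integral do rewrite /= normrM EFinM.
  rewrite integralZl//; last exact: (integrable_norm h1).
  rewrite -(fineK hN).
  over.
rewrite integralZr//; last exact: (integrable_norm g1).
rewrite ltey_eq; apply/orP; left; rewrite fin_numM//.
by apply: integrable_fin_num => //; exact: (integrable_norm g1).
Qed.

Lemma Rintegral_itv_if a b s g : s \in `[a, b] ->
  Rintegral mu `[a, b] (fun u => if u <= s then g u else 0) =
  Rintegral mu `[a, s] g.
Proof.
rewrite in_itv/= => /andP[as_ sb].
rewrite [LHS]Rintegral_mkcond [RHS]Rintegral_mkcond; apply: eq_Rintegral => u _.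
rewrite /patch !mem_setE !in_itv/=.
case: (leP u s) => us; last by rewrite andbF; case: ifP.
by rewrite (le_trans us sb) !andbT.
Qed.

(** When a square is cut along its diagonal, only one triangle contains the diagonal. The other one
    has half-open sections, which differ from [[a, s]] by a single point; integrability of [g] lets
    that point be added. *)
Lemma Rintegral_itv_ifo a b s g : s \in `[a, b] -> L1f mu `[a, b] g ->
  Rintegral mu `[a, b] (fun u => if s <= u then 0 else g u) =
  Rintegral mu `[a, s] g.
Proof.
rewrite in_itv/= => /andP[as_ sb] g1.
rewrite -(@Rintegral_itv_bndo_bndc _ (BLeft a) s); last first.
  apply: L1fS g1 => //.
  move=> x /=; rewrite !in_itv/= => /andP[-> /ltW xs].
  exact: le_trans xs sb.
rewrite [LHS]Rintegral_mkcond [RHS]Rintegral_mkcond; apply: eq_Rintegral => u _.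
rewrite /patch !mem_setE !in_itv/=.
case: (ltP u s) => us; last by rewrite andbF; case: ifP.
by rewrite (le_trans (ltW us) sb) !andbT.
Qed.

(* The square [a, b]^2 is cut along its diagonal, and Fubini is applied to
   g(u) h(r) on each of the two triangles. *)
Lemma Rintegral_mul a b g h : a <= b ->
  L1f mu `[a, b] g -> L1f mu `[a, b] h ->
  [/\ L1f mu `[a, b] (fun s => g s * Rintegral mu `[a, s] h),
      L1f mu `[a, b] (fun s => Rintegral mu `[a, s] g * h s) &
  Rintegral mu `[a, b] g * Rintegral mu `[a, b] h =
  Rintegral mu `[a, b] (fun s => g s * Rintegral mu `[a, s] h) +
  Rintegral mu `[a, b] (fun s => Rintegral mu `[a, s] g * h s)].
Proof.
move=> ab g1 h1; have K1 := L1f_tensor g1 h1.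
set I2 := (`[a, b] `*` `[a, b]) in K1 *.
have mI2 : measurable I2 by apply: measurableX.
pose Kl (z : R * R) := if z.1 <= z.2 then g z.1 * h z.2 else 0.
pose Kr (z : R * R) := if z.1 <= z.2 then 0 else g z.1 * h z.2.
have mle : measurable_fun [set: R * R] (fun z : R * R => z.1 <= z.2).
  by apply: measurable_fun_ler; [exact: measurable_fst|exact: measurable_snd].
have mKl : measurable_fun I2 Kl.
  apply: measurable_fun_if => //; first exact: measurable_funTS.
  by apply: measurable_funS (L1f_measurable K1).
have mKr : measurable_fun I2 Kr.
  apply: measurable_fun_if => //; first exact: measurable_funTS.
  by apply: measurable_funS (L1f_measurable K1).
have Kl1 : L1f (mu \x mu)%E I2 Kl.
  apply: le_L1f (L1f_norm K1) => // z _; rewrite /Kl; case: ifPn => //.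
  by rewrite normr0.
have Kr1 : L1f (mu \x mu)%E I2 Kr.
  apply: le_L1f (L1f_norm K1) => // z _; rewrite /Kr; case: ifPn => //.
  by rewrite normr0.
have sub s : s \in `[a, b]%classic -> (`[a, s] : set R) `<=` `[a, b].
  move=> /set_mem/=; rewrite in_itv/= => /andP[_ sb].
  exact: subset_itvcc.
have gS s : s \in `[a, b]%classic -> L1f mu `[a, s] g.
  by move=> /sub ?; apply: L1fS g1.
have hS s : s \in `[a, b]%classic -> L1f mu `[a, s] h.
  by move=> /sub ?; apply: L1fS h1.
(* [Kl] is integrated first in its first variable and [Kr] first in its second, so that both inner
   integrals run over [[a, s]]. *)
have [lL1 lE] := @L1f_fubini2 _ _ _ _ _ mu mu _ _ (measurable_itv _) (measurable_itv _) _ Kl1.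
have [rL1 rE] := @L1f_fubini1 _ _ _ _ _ mu mu _ _ (measurable_itv _) (measurable_itv _) _ Kr1.
have [_ kE] := @L1f_fubini1 _ _ _ _ _ mu mu _ _ (measurable_itv _) (measurable_itv _) _ K1.
have lr s : s \in `[a, b]%classic -> Rintegral mu `[a, b] (fun x => Kl (x, s)) =
    Rintegral mu `[a, s] g * h s.
  move=> sI; rewrite -RintegralZr//; last exact: gS.
  by rewrite -(@Rintegral_itv_if a b s)//; move: sI; rewrite inE.
have rr s : s \in `[a, b]%classic -> Rintegral mu `[a, b] (fun y => Kr (s, y)) =
    g s * Rintegral mu `[a, s] h.
  move=> sI; rewrite -RintegralZl//; last exact: hS.
  rewrite -(@Rintegral_itv_ifo a b s)//; first by move: sI; rewrite inE.
  exact: L1fZ.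
have {}lE : Rintegral mu `[a, b] (fun s => Rintegral mu `[a, s] g * h s) =
    Rintegral (mu \x mu)%E I2 Kl.
  by rewrite -lE; apply: eq_Rintegral => s sI; rewrite lr.
have {}rE : Rintegral mu `[a, b] (fun s => g s * Rintegral mu `[a, s] h) =
    Rintegral (mu \x mu)%E I2 Kr.
  by rewrite -rE; apply: eq_Rintegral => s sI; rewrite rr.
split.
- exact: L1f_ext rL1.
- exact: L1f_ext lL1.
- transitivity (Rintegral (mu \x mu)%E I2 (fun z => g z.1 * h z.2)).
    rewrite -kE -RintegralZr//.
    by apply: eq_Rintegral => s _; rewrite (@RintegralZl _ _ _ mu _ h (g s)).
  rewrite lE rE addrC -RintegralD//.
  apply: eq_Rintegral => z _; rewrite /Kl /Kr.
  by case: ifPn; rewrite ?addr0 ?add0r.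
Qed.

(** The extreme value theorem is applied to [g] and to [- g]. Through this every solution of an
    equation in integral form is bounded and may serve as a coefficient. *)
Lemma within_continuous_Lbf a b g : a <= b -> {within `[a, b], continuous g} ->
  Lbf mu `[a, b] g.
Proof.
move=> ab cg; split; first exact: subspace_continuous_measurable_fun.
have [c _ cM] := EVT_max ab cg.
have cNg : {within `[a, b], continuous (fun x => - g x)}.
  by apply: within_continuous_comp cg => x _; exact: opp_continuous.
have [e _ eM] := EVT_max ab cNg.
exists (`|g c| + `|g e|); apply: aeW => x xab; rewrite ler_norml.
have := cM _ xab; have := eM _ xab; have := ler_norm (g c).
have := ler_norm (- g e); rewrite normrN; have := normr_ge0 (g c).
by have := normr_ge0 (g e); move=> *; apply/andP; split; lra.
Qed.

Lemma Rintegral_expR a s (c : R) : 0 < c -> a <= s ->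
  Rintegral mu `[a, s] (fun r => expR (c * r)) <= expR (c * s) / c.
Proof.
move=> c0; rewrite le_eqVlt => /predU1P[<-|as_].
  by rewrite set_itv1 Rintegral_set1 divr_ge0 ?expR_ge0 ?ltW.
pose F r := c^-1 * expR (c * r).
have dF (r : R) : is_derive r 1 F (expR (c * r)).
  apply: is_derive_eq.
  by rewrite /GRing.scale/= mulr1 mulrCA mulVf ?gt_eqF// mulr1.
have cF (f : R -> R) : (forall r : R, derivable f r 1) -> continuous f.
  by move=> df r; apply: differentiable_continuous; apply/derivable1_diffP.
have ce : continuous (fun r : R => expR (c * r)).
  by apply: cF => r; apply: ex_derive.
rewrite /Rintegral (@continuous_FTC2 _ _ F)//.
- rewrite /= /F mulrC lerBlDr lerDl mulr_ge0 ?invr_ge0 ?ltW// expR_gt0//.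
- exact: continuous_subspaceT.
- have cFF : continuous F by apply: cF => r; apply: ex_derive.
  split => [x _||].
  + by apply: ex_derive.
  + exact: cvg_at_right_filter (cFF a).
  + exact: cvg_at_left_filter (cFF s).
- by move=> x _; rewrite derive1E; exact: derive_val.
Qed.

(* The constant is obtained from the maximum of u(s) e^(-cs) with c > 2 C. *)
Lemma gronwall a b (C K : R) (u : R -> R) : a <= b -> 0 <= C -> 0 <= K ->
  {within `[a, b], continuous u} ->
  (forall s, a <= s <= b -> 0 <= u s) ->
  (forall s, a <= s <= b -> u s <= K + C * Rintegral mu `[a, s] u) ->
  forall s, a <= s <= b -> u s <= 2 * expR ((2 * C + 1) * (b - a)) * K.
Proof.
move=> ab C0 K0 cu u0 uK s sab; pose c := 2 * C + 1.
have c0 : 0 < c by rewrite /c; lra.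
pose v r := u r * expR (- (c * r)).
have cv : {within `[a, b], continuous v}.
  have ce : {within `[a, b], continuous (fun r => expR (- (c * r)))}.
    apply: continuous_subspaceT => r.
    apply: continuous_comp; last exact: continuous_expR.
    apply: continuousN; exact: mulrl_continuous.
  by move=> x; apply: cvgM; [exact: cu|exact: ce].
have [z zab vmax] := EVT_max ab cv.
have {}zab : a <= z <= b by move: zab; rewrite in_itv.
have uS r : a <= r <= b -> u r <= v z * expR (c * r).
  move=> rab; have := vmax r; rewrite in_itv => /(_ rab).
  rewrite {1}/v -(ler_pM2r (expR_gt0 (c * r))) -mulrA -expRD addNr expR0.
  by rewrite mulr1.
have vz0 : 0 <= v z by rewrite /v mulr_ge0 ?u0 ?expR_ge0.
have az : a <= z by case/andP: zab.
have zb : z <= b by case/andP: zab.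
have IE : Rintegral mu `[a, z] u <= v z * (expR (c * z) / c).
  apply: (@le_trans _ _ (Rintegral mu `[a, z] (fun r => v z * expR (c * r)))).
    have Lb1 (g : R -> R) : {within `[a, b], continuous g} -> L1f mu `[a, z] g.
      move=> cg; apply: Lbf_L1f => //; first exact: mu_itv_lty.
      have := within_continuous_Lbf ab cg; apply: LbfS => //.
      exact: subset_itvcc.
    apply: le_Rintegral => //; first exact: Lb1.
      apply: Lb1; apply: continuous_subspaceT => r.
      apply: cvgM; first exact: cvg_cst.
      by apply: continuous_comp; [exact: mulrl_continuous|exact: continuous_expR].
    move=> r; rewrite /= in_itv/= => /andP[ar rz]; apply: uS.
    by rewrite ar (le_trans rz zb).
  rewrite RintegralZl//; first by rewrite ler_wpM2l// Rintegral_expR.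
  apply: Lbf_L1f => //; first exact: mu_itv_lty.
  apply: within_continuous_Lbf => //; apply: continuous_subspaceT => r.
  by apply: continuous_comp; [exact: mulrl_continuous|exact: continuous_expR].
have uz : u z = v z * expR (c * z).
  by rewrite /v -mulrA -expRD addNr expR0 mulr1.
(* At the maximum point [z] the weight gives [u z <= K + C * (u z / c)]. As [c = 2 C + 1], the last
   term is at most [u z / 2] and is absorbed; this is the factor 2 of the final constant. *)
have vzK : v z * expR (c * z) <= 2 * K.
  set w := v z * expR (c * z).
  have w0 : 0 <= w by rewrite mulr_ge0 ?expR_ge0.
  have : w <= K + C * (w / c).
    rewrite /w -uz (le_trans (uK z zab))// lerD2l ler_wpM2l//.
    by rewrite (le_trans IE)// uz mulrA.
  have : C * (w / c) <= w / 2.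
    rewrite mulrCA ler_wpM2l// ler_pdivrMr// mulrC /c; lra.
  lra.
have [as_ sb] := andP sab.
apply: le_trans (uS s sab) _.
have -> : v z * expR (c * s) = (v z * expR (c * z)) * expR (c * (s - z)).
  by rewrite -mulrA -expRD; congr (_ * expR _); ring.
rewrite [leRHS]mulrAC; apply: ler_pM => //.
- by rewrite -uz u0.
- rewrite ler_expR; apply: ler_wpM2l; first exact: ltW.
  lra.
Qed.

End time_interval.

(** * Linear differential equations in integral form *)

Section caratheodory_solutions.
Context (R : realType).
Local Notation mu := (@lebesgue_measure R).
Implicit Types (a b s : R).

Lemma L1f_subitv a b s g : a <= s <= b -> L1f mu `[a, b] g -> L1f mu `[a, s] g.
Proof.
move=> /andP[as_ sb] g1; apply: L1fS g1 => //.
exact: subset_itvcc.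
Qed.

Lemma within_continuous_primitive a b (y0 : R) (y g : R -> R) : a <= b ->
  L1f mu `[a, b] g ->
  (forall s, a <= s <= b -> y s = y0 + Rintegral mu `[a, s] g) ->
  {within `[a, b], continuous y}.
Proof.
move=> ab g1 yE.
apply: (@subspace_eq_continuous _ _ _ (fun s => y0 + Rintegral mu `[a, s] g)).
  by move=> s /set_mem/=; rewrite in_itv => /= sab; exact: esym (yE _ sab).
have c0 : {within `[a, b], continuous (fun=> y0)}.
  by apply: continuous_subspaceT => x; exact: cvg_cst.
exact: (within_continuousD c0 (parameterized_integral_continuous ab g1)).
Qed.

(** The product rule for absolutely continuous functions. Expanding the product of [y0] plus a
    primitive and [z0] plus a primitive leaves one nonlinear term, the product of the two
    primitives, which [Rintegral_mul] resolves. *)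
Lemma primitive_mul a b (y0 z0 : R) (y z g h : R -> R) : a <= b ->
  L1f mu `[a, b] g -> L1f mu `[a, b] h ->
  (forall s, a <= s <= b -> y s = y0 + Rintegral mu `[a, s] g) ->
  (forall s, a <= s <= b -> z s = z0 + Rintegral mu `[a, s] h) ->
  [/\ L1f mu `[a, b] (fun s => g s * z s), L1f mu `[a, b] (fun s => y s * h s) &
  forall s, a <= s <= b -> y s * z s =
    y0 * z0 + Rintegral mu `[a, s] (fun r => g r * z r + y r * h r)].
Proof.
move=> ab g1 h1 yE zE.
have yb := within_continuous_Lbf ab (within_continuous_primitive ab g1 yE).
have zb := within_continuous_Lbf ab (within_continuous_primitive ab h1 zE).
have gz1 : L1f mu `[a, b] (fun s => g s * z s).
  by apply: L1f_ext (LbfL1M _ zb g1) => // s _; rewrite mulrC.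
have yh1 : L1f mu `[a, b] (fun s => y s * h s) by exact: LbfL1M.
split => // s sab; have [as_ sb] := andP sab.
have gs := L1f_subitv sab g1; have hs := L1f_subitv sab h1.
have [gH Gh E] := Rintegral_mul as_ gs hs.
have rs r : r \in `[a, s]%classic -> a <= r <= b.
  move=> /set_mem/=; rewrite in_itv/= => /andP[-> rs] /=.
  exact: le_trans sb.
rewrite yE// zE//.
have -> : Rintegral mu `[a, s] (fun r => g r * z r + y r * h r) =
  Rintegral mu `[a, s] (fun r => (z0 * g r + y0 * h r) +
    (g r * Rintegral mu `[a, r] h + Rintegral mu `[a, r] g * h r)).
  by apply: eq_Rintegral => r rI; rewrite yE ?zE; [ring|exact: rs..].
rewrite RintegralD//; [|exact: L1fD (L1fZ _ _ _) (L1fZ _ _ _)|exact: L1fD].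
rewrite !RintegralD//; [|exact: L1fZ..].
by rewrite !RintegralZl// -E; ring.
Qed.

Lemma mxL1_subitv a b s p q (g : R -> 'M[R]_(p, q)) : a <= s <= b ->
  mxL1 mu `[a, b] g -> mxL1 mu `[a, s] g.
Proof. by move=> sab g1 i j; apply: L1f_subitv (g1 i j). Qed.

Section calculus.
Context (a b : R) (ab : a <= b).

Lemma fwd_sol_ext p q (y0 : 'M[R]_(p, q)) y y' g g' :
  (forall s, a <= s <= b -> y s = y' s) ->
  (forall s, a <= s <= b -> g s = g' s) ->
  fwd_sol a b y0 y g -> fwd_sol a b y0 y' g'.
Proof.
move=> yy gg [g1 yE]; split.
  apply: (mxL1_ext _ _ g1) => // x /=; rewrite in_itv; exact: gg.
move=> s sab; rewrite -yy// yE//; congr (_ + _).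
apply: (@mxI_ext _ _ _ mu) => x; rewrite /= in_itv/= => /andP[ax xs]; apply: gg.
by rewrite ax (le_trans xs)//; case/andP: sab.
Qed.

Lemma fwd_sol_init p q (y0 : 'M[R]_(p, q)) y g : fwd_sol a b y0 y g -> y a = y0.
Proof.
move=> [_ ->]; last by rewrite lexx.
apply/matrixP => i j; rewrite !mxE set_itv1 Rintegral_set1.
exact: addr0.
Qed.

Lemma fwd_sol_D p q (y0 z0 : 'M[R]_(p, q)) y z g h :
  fwd_sol a b y0 y g -> fwd_sol a b z0 z h ->
  fwd_sol a b (y0 + z0) (fun s => y s + z s) (fun s => g s + h s).
Proof.
move=> [g1 yE] [h1 zE]; split; first exact: (@mxL1D _ _ _ mu).
move=> s sab; rewrite yE// zE// addrACA; congr (_ + _).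
exact: esym (mxID _ (mxL1_subitv sab g1) (mxL1_subitv sab h1)).
Qed.

Lemma fwd_sol_N p q (y0 : 'M[R]_(p, q)) y g :
  fwd_sol a b y0 y g -> fwd_sol a b (- y0) (fun s => - y s) (fun s => - g s).
Proof.
move=> [g1 yE]; split; first exact: (@mxL1N _ _ _ mu).
move=> s sab; rewrite yE// opprD; congr (_ + _).
exact: esym (mxIN _ (mxL1_subitv sab g1)).
Qed.

Lemma fwd_sol_tr p q (y0 : 'M[R]_(p, q)) y g :
  fwd_sol a b y0 y g -> fwd_sol a b y0^T (fun s => (y s)^T) (fun s => (g s)^T).
Proof.
move=> [g1 yE]; split; first exact: (@mxL1_tr _ _ _ mu).
by move=> s sab; rewrite yE// linearD/=; congr (_ + _); exact: esym (mxI_tr _ _ _).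
Qed.

Lemma fwd_sol_entry p q (y0 : 'M[R]_(p, q)) y g i j : fwd_sol a b y0 y g ->
  L1f mu `[a, b] (fun s => g s i j) /\
  forall s, a <= s <= b -> y s i j = y0 i j + Rintegral mu `[a, s] (fun r => g r i j).
Proof. by move=> [g1 yE]; split => [|s sab]; [exact: g1|rewrite yE// !mxE]. Qed.

Lemma fwd_sol_M p q r (y0 : 'M[R]_(p, q)) (z0 : 'M[R]_(q, r)) y z g h :
  fwd_sol a b y0 y g -> fwd_sol a b z0 z h ->
  fwd_sol a b (y0 *m z0) (fun s => y s *m z s) (fun s => g s *m z s + y s *m h s).
Proof.
move=> ys zs.
have E i j k := primitive_mul ab (fwd_sol_entry i k ys).1 (fwd_sol_entry k j zs).1
  (fwd_sol_entry i k ys).2 (fwd_sol_entry k j zs).2.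
have E1 i j k : L1f mu `[a, b] (fun s => g s i k * z s k j + y s i k * h s k j).
  by have [? ? _] := E i j k; apply: L1fD.
split.
  move=> i j; apply: L1f_ext (L1f_sum _ (E1 i j)) => // s _.
  by rewrite !mxE big_split.
move=> s sab; apply/matrixP => i j; rewrite !mxE.
transitivity (\sum_k (y0 i k * z0 k j + Rintegral mu `[a, s]
   (fun r => g r i k * z r k j + y r i k * h r k j))).
  by apply: eq_bigr => k _; have [_ _ ->] := E i j k.
rewrite big_split/=; congr (_ + _).
rewrite -(@Rintegral_sum _ _ _ mu)//; last by move=> k; apply: L1f_subitv (E1 i j k).
by apply: eq_Rintegral => u _; rewrite !mxE big_split.
Qed.

Lemma fwd_sol_cst p q (y0 : 'M[R]_(p, q)) : fwd_sol a b y0 (fun=> y0) (fun=> 0).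
Proof.
have m0 s : mxL1 mu `[a, s] (fun=> 0 : 'M[R]_(p, q)).
  by apply: mxLb_L1 => //; [exact: mu_itv_lty|exact: mxLb_cst].
split => [|s sab]; first exact: m0.
apply/matrixP => i j; rewrite !mxE -[LHS]addr0; congr (_ + _).
by rewrite Rintegral_cst// mul0r.
Qed.

Lemma fwd_sol_Lb p q (y0 : 'M[R]_(p, q)) y g : fwd_sol a b y0 y g ->
  mxLb mu `[a, b] y.
Proof.
move=> ys i j; have [g1 yE] := fwd_sol_entry i j ys.
apply: within_continuous_Lbf => //.
exact: (within_continuous_primitive ab g1 yE).
Qed.

(** Terminal value problems are turned into initial value problems whose initial value is the
    solution's own value at [a], so that a single product rule serves the state and the multipliers
    [P], [Sigma], [lam]. *)
Lemma bwd_fwd_sol p q (yb : 'M[R]_(p, q)) y g : bwd_sol a b yb y g ->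
  fwd_sol a b (y a) y (fun s => - g s) /\ y b = yb.
Proof.
move=> [g1 yE]; split; last first.
  rewrite yE; last by rewrite ab lexx.
  apply/matrixP => i j; rewrite !mxE set_itv1 Rintegral_set1.
  exact: addr0.
split; first exact: (@mxL1N _ _ _ mu).
move=> s sab; rewrite !yE//; last by rewrite lexx.
rewrite -addrA; congr (_ + _); apply/matrixP => i j; rewrite !mxE.
have [as_ sb] := andP sab.
under [X in _ = _ + X]eq_Rintegral do rewrite mxE.
rewrite (@RintegralN _ _ _ mu)//; last exact: L1f_subitv (g1 i j).
apply/eqP; rewrite eq_sym subr_eq; apply/eqP.
(* The difference of the integrals over [[a, b]] and [[a, s]] runs over the interval open at [s];
   the endpoint is added afterwards. *)
have := @Rintegral_itvB R (fun r => g r i j) (BLeft a) (BRight b) s (g1 i j).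
rewrite !bnd_simp => /(_ as_ sb) /eqP; rewrite subr_eq => /eqP ->.
congr (_ + _).
rewrite Rintegral_itv_obnd_cbnd//.
apply: L1fS (g1 i j) => // r; rewrite /= !in_itv/= => /andP[sr ->].
by rewrite (le_trans as_ (ltW sr)).
Qed.

End calculus.

(** The l^1 norm: the equations hold entrywise, and absolute values of entries add up under the
    integral, so the Gronwall inequality is linear in it. *)
Definition norm1 k (u : 'cV[R]_k) : R := \sum_i `|u i 0|.

Lemma norm1_ge0 k (u : 'cV[R]_k) : 0 <= norm1 u.
Proof. exact: sumr_ge0. Qed.

Lemma norm1_eq0 k (u : 'cV[R]_k) : norm1 u <= 0 -> u = 0.
Proof.
move=> u0; apply/matrixP => i j; rewrite (ord1 j) mxE; apply/eqP.
rewrite -normr_eq0; apply/eqP/le_anti; rewrite normr_ge0 andbT.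
apply: le_trans u0; rewrite /norm1 (bigD1 i)//= lerDl.
exact: sumr_ge0.
Qed.

Lemma mxLb_bound p q (E : set R) (A : R -> 'M[R]_(p, q)) : mxLb mu E A ->
  exists2 C : R, 0 <= C & {ae mu, forall s, E s -> forall i j, `|A s i j| <= C}.
Proof.
move=> Ab; pose c i j := proj1_sig (cid (Ab i j).2).
have cP i j : {ae mu, forall s, E s -> `|A s i j| <= c i j}.
  exact: (proj2_sig (cid (Ab i j).2)).
(* The absolute values matter: an essential bound [c i j] may be negative when [E] is a null set. *)
exists (\sum_i \sum_j `|c i j|); first by apply: sumr_ge0 => i _; apply: sumr_ge0.
suff H : {ae mu, forall s, forall k : 'I_p * 'I_q, E s -> `|A s k.1 k.2| <= c k.1 k.2}.
  apply: aeS H => s H Es i j; apply: le_trans (H (i, j) Es) _ => /=.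
  rewrite (bigD1 i)//= (bigD1 j)//= -addrA; apply: ler_wpDr (ler_norm _).
  by rewrite addr_ge0// sumr_ge0// => k _; exact: sumr_ge0.
by apply: ae_finite => k; exact: cP.
Qed.

(** Gronwall applied to [norm1] of the solution. The constant is chosen before the initial value and
    the forcing, hence one constant serves the paths of all [x], which is what a majorant in [x]
    requires. *)
Lemma linear_ode_bound a b k (A : R -> 'M[R]_k) : a <= b -> mxLb mu `[a, b] A ->
  exists2 C : R, 0 <= C & forall y0 y (g : R -> 'cV[R]_k), mxL1 mu `[a, b] g ->
    fwd_sol a b y0 y (fun s => A s *m y s + g s) ->
    forall s, a <= s <= b ->
      norm1 (y s) <= C * (norm1 y0 + Rintegral mu `[a, b] (fun r => norm1 (g r))).
Proof.
move=> ab Ab; have [B B0 AB] := mxLb_bound Ab.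
(* Each of the [k] entries of [A r *m y r] is at most [B * norm1 (y r)] in absolute value. *)
pose C := k%:R * B; have C0 : 0 <= C by rewrite mulr_ge0.
exists (2 * expR ((2 * C + 1) * (b - a))).
  by rewrite mulr_ge0// expR_ge0.
move=> y0 y g g1 ys s sab.
have cy i : {within `[a, b], continuous (fun s => y s i 0)}.
  have [h1 yE] := fwd_sol_entry i 0 ys.
  exact: (within_continuous_primitive ab h1 yE).
have ng1 : L1f mu `[a, b] (fun r => norm1 (g r)).
  by apply: L1f_sum => // i; apply: L1f_norm; exact: g1.
have cu : {within `[a, b], continuous (fun s => norm1 (y s))}.
  suff H e : {within `[a, b], continuous (fun s => \sum_(i <- e) `|y s i 0|)}.
    exact: H.
  elim: e => [|i e IH].
    apply: (@subspace_eq_continuous _ _ _ (fun=> 0)).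
      by move=> x _; rewrite /from_subspace big_nil.
    by apply: continuous_subspaceT => x; exact: cvg_cst.
  have ci : {within `[a, b], continuous (fun s => `|y s i 0|)}.
    by apply: within_continuous_comp (cy i) => x _; exact: norm_continuous.
  apply: (@subspace_eq_continuous _ _ _ _ _ _ (within_continuousD ci IH)).
  by move=> x _; rewrite /from_subspace big_cons.
have u1 : L1f mu `[a, b] (fun r => norm1 (y r)).
  by apply: Lbf_L1f => //; [exact: mu_itv_lty|exact: within_continuous_Lbf].
apply: (gronwall ab C0 _ cu) => //.
- rewrite addr_ge0 ?norm1_ge0// Rintegral_ge0// => r _; exact: norm1_ge0.
- by move=> r _; exact: norm1_ge0.
move=> {sab}s sab; have [as_ sb] := andP sab.
have sI : (`[a, s] : set R) `<=` `[a, b] by exact: subset_itvcc.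
have u1s := L1f_subitv sab u1; have ng1s := L1f_subitv sab ng1.
have h1 i := L1f_subitv sab (fwd_sol_entry i 0 ys).1.
have step1 : norm1 (y s) <= norm1 y0 +
    Rintegral mu `[a, s] (fun r => \sum_i `|(A r *m y r + g r) i 0|).
  rewrite (@Rintegral_sum _ _ _ mu)//; last first.
    by move=> i; apply: L1f_norm; exact: h1.
  rewrite /norm1 -big_split/=; apply: ler_sum => i _.
  have [_ ->//] := fwd_sol_entry i 0 ys.
  apply: le_trans (ler_normD _ _) _; rewrite lerD2l.
  by apply: le_normr_Rintegral => //; exact: h1.
apply: le_trans step1 _; rewrite -addrA lerD2l.
have : Rintegral mu `[a, s] (fun r => norm1 (g r)) <=
       Rintegral mu `[a, b] (fun r => norm1 (g r)).
  have := @Rintegral_itvB R (fun r => norm1 (g r)) (BLeft a) (BRight b) s ng1.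
  rewrite !bnd_simp => /(_ as_ sb) E; rewrite -subr_ge0 E.
  by apply: Rintegral_ge0 => r _; exact: norm1_ge0.
move=> /(lerD (lexx (C * Rintegral mu `[a, s] (fun r => norm1 (y r))))).
rewrite [in X in _ -> X]addrC; apply: le_trans.
rewrite -RintegralZl// -RintegralD//; last exact: L1fZ.
have -> : Rintegral mu `[a, s] (fun r => \sum_i `|(A r *m y r + g r) i 0|) =
  fine (\int[mu]_(r in `[a, s]) (\sum_i `|(A r *m y r + g r) i 0|)%:E)%E by [].
have S1 : L1f mu `[a, s] (fun r => \sum_i `|(A r *m y r + g r) i 0|).
  by apply: L1f_sum => // i; apply: L1f_norm; exact: h1.
have S2 : L1f mu `[a, s] (fun r => C * norm1 (y r) + norm1 (g r)).
  by apply: L1fD => //; exact: L1fZ.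
rewrite /Rintegral fine_le//; [exact: (integrable_fin_num _ S1)|
  exact: (integrable_fin_num _ S2)|].
apply: ae_ge0_le_integral => //.
- by move=> r _; rewrite lee_fin sumr_ge0.
- by apply/measurable_EFinP; exact: L1f_measurable S1.
- by move=> r _; rewrite lee_fin addr_ge0 ?mulr_ge0 ?norm1_ge0.
- by apply/measurable_EFinP; exact: L1f_measurable S2.
apply: aeS AB => r AB /sI rI; rewrite lee_fin.
apply: (@le_trans _ _ (\sum_(i < k) (B * norm1 (y r) + `|g r i 0|))); last first.
  by rewrite big_split/= lerD2r sumr_const card_ord -mulr_natl mulrA.
apply: ler_sum => i _; rewrite !mxE.
apply: le_trans (ler_normD _ _) _; rewrite lerD2r.
apply: le_trans (ler_norm_sum _ _ _) _; rewrite mulr_sumr.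
by apply: ler_sum => j _; rewrite normrM ler_wpM2r// AB.
Qed.

(** The difference of two solutions solves the homogeneous equation from 0, where the bound of
    [linear_ode_bound] is 0. *)
Lemma linear_ode_unique a b k (A : R -> 'M[R]_k) (g : R -> 'cV[R]_k) y0 y z :
  a <= b -> mxLb mu `[a, b] A ->
  fwd_sol a b y0 y (fun s => A s *m y s + g s) ->
  fwd_sol a b y0 z (fun s => A s *m z s + g s) ->
  forall s, a <= s <= b -> y s = z s.
Proof.
move=> ab Ab ys zs s sab.
have := fwd_sol_D ys (fwd_sol_N zs); rewrite subrr => yz.
have [C C0 H] := linear_ode_bound ab Ab.
have : norm1 (y s - z s) <= C * (norm1 (0 : 'cV[R]_k) +
    Rintegral mu `[a, b] (fun=> norm1 (0 : 'cV[R]_k))).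
  apply: (H 0 (fun s => y s - z s) (fun=> 0)) => //.
    by have [] := fwd_sol_cst a b (0 : 'cV[R]_k).
  apply: fwd_sol_ext yz => // r _.
  by rewrite mulmxBr addr0 opprD addrACA subrr addr0.
have n0 : norm1 (0 : 'cV[R]_k) = 0.
  by rewrite /norm1 big1// => i _; rewrite mxE normr0.
rewrite n0 Rintegral_cst// mul0r addr0 mulr0 => /norm1_eq0/eqP.
by rewrite subr_eq0 => /eqP.
Qed.

End caratheodory_solutions.

(** * Joint measurability of continuous paths *)

Section joint_measurability.
Context d (X : measurableType d) (R : realType).
Local Notation mu := (@lebesgue_measure R).

(** Sampling a path at the grid point to the left of [s] gives a finite sum of jointly measurable
    functions, and continuity of the paths makes these sums converge pointwise to [Y]. *)
Lemma measurable_fun_continuous_paths (a b : R) (Y : R -> X -> R) : a < b ->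
  (forall s, a <= s <= b -> measurable_fun setT (Y s)) ->
  (forall x, {within `[a, b], continuous (Y ^~ x)}) ->
  measurable_fun (`[a, b] `*` setT) (fun p : R * X => Y p.1 p.2).
Proof.
move=> ab mY cY.
pose del k : R := (b - a) / k.+1%:R.
have del0 k : 0 < del k by rewrite divr_gt0 ?subr_gt0.
have delk k : del k * k.+1%:R = b - a by rewrite /del mulfVK.
pose act k (j : nat) (s : R) := (del k * j%:R <= s - a) && (s - a < del k * j.+1%:R).
(* The grid has [k.+1] cells, closed on the left and open on the right. The extra index [k.+1] takes
   care of [s = b], which lies in none of them; its sampling point is [b] itself. *)
pose h k (p : R * X) := \sum_(j < k.+2) if act k j p.1 then Y (a + del k * j%:R) p.2 else 0.
pose J k s := Num.trunc ((s - a) / del k).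
have JP k s : s \in `[a, b] -> act k (J k s) s /\ (J k s < k.+2)%N.
  rewrite in_itv/= => /andP[as_ sb].
  have q0 : 0 <= (s - a) / del k by rewrite divr_ge0 ?subr_ge0// ltW.
  have /andP[l1 l2] := Num.Theory.truncn_itv q0.
  have A : act k (J k s) s.
    rewrite /act; apply/andP; split.
      by move: l1; rewrite ler_pdivlMr// mulrC.
    by move: l2; rewrite ltr_pdivrMr// mulrC.
  split => //; move: A => /andP[A _].
  rewrite ltnS -(ler_nat R) -(ler_pM2l (del0 k)) delk.
  by rewrite (le_trans A)// lerD2r.
have actU k i j s : act k i s -> act k j s -> i = j.
  move=> /andP[i1 i2] /andP[j1 j2]; apply/eqP; rewrite eqn_leq.
  rewrite -ltnS -(ltr_nat R) -(ltr_pM2l (del0 k)) (le_lt_trans i1 j2)/=.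
  by rewrite -ltnS -(ltr_nat R) -(ltr_pM2l (del0 k)) (le_lt_trans j1 i2).
have hE k s x : s \in `[a, b] -> h k (s, x) = Y (a + del k * (J k s)%:R) x.
  move=> sI; have [A L] := JP k s sI.
  rewrite /h (bigD1 (Ordinal L))//= A big1 ?addr0// => i iJ.
  case: ifPn => // Ai; exfalso; move/negP: iJ; apply; apply/eqP/val_inj => /=.
  exact: actU Ai A.
apply: (@measurable_fun_cvg _ _ _ _ h).
  move=> k; rewrite /h; apply: (@measurable_sum _ _ _ _ _ _
    (fun (j : 'I_k.+2) (p : R * X) =>
      if act k j p.1 then Y (a + del k * j%:R) p.2 else 0)) => j.
  apply: (@measurable_fun_if _ _ _ _ (fun p : R * X => Y (a + del k * j%:R) p.2) (fun=> 0)) => //.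
  - exact: measurableX.
  - apply: measurable_and.
      apply: measurable_fun_ler => //.
      apply: measurable_funB => //.
      by apply: measurable_funTS; exact: measurable_fst.
    apply: measurable_fun_ltr => //.
    apply: measurable_funB => //.
    by apply: measurable_funTS; exact: measurable_fst.
  - apply: measurable_funTS.
    apply: (@measurableT_comp _ _ _ _ _ _ (Y (a + del k * j%:R)) _ (@snd R X)).
      apply: mY; apply/andP; split; first by rewrite lerDl mulr_ge0// ltW.
      rewrite addrC -lerBrDr -(delk k) ler_pM2l// ler_nat.
      by rewrite -ltnS.
    exact: measurable_snd.
move=> [s x] [/= sI _].
have sab : a <= s <= b by move: sI; rewrite in_itv.
under eq_fun do rewrite hE//.
have piI k : a <= a + del k * (J k s)%:R <= b.
  have [/andP[A _] _] := JP k s sI.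
  apply/andP; split; first by rewrite lerDl mulr_ge0// ltW.
  rewrite addrC -lerBrDr (le_trans A)// lerD2r.
  by case/andP: sab.
have piC : (a + del k * (J k s)%:R) @[k --> \oo] --> s.
  apply/cvgrPdist_lt => e e0.
  near=> k.
  have [/andP[A B] _] := JP k s sI.
  have : `|s - (a + del k * (J k s)%:R)| < del k.
    rewrite opprD addrA ger0_norm ?subr_ge0// ltrBlDl.
    by move: B; rewrite -natr1 mulrDr mulr1.
  move=> /lt_le_trans; apply; apply: ltW.
  rewrite /del ltr_pdivrMr// mulrC -ltr_pdivrMr//.
  near: k; apply: filterS (nbhs_infty_gtr ((b - a) / e)) => k /lt_trans; apply.
  by rewrite ltr_nat.
(* Paths are continuous only relative to [[a, b]], so the sampling points must converge within this
   set; they never leave it. *)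
have piW : (a + del k * (J k s)%:R) @[k --> \oo] --> within `[a, b] (nbhs s).
  move=> A wA; have wA' : \forall k \near \oo,
      `[a, b]%classic (a + del k * (J k s)%:R) -> A (a + del k * (J k s)%:R).
    exact: (piC _ wA).
  have : \forall k \near \oo, A (a + del k * (J k s)%:R).
    by apply: filterS wA' => k; apply; rewrite /= in_itv; exact: piI.
  by [].
have Yw : Y r x @[r --> within `[a, b] (nbhs s)] --> Y s x.
  move=> A nA; have := cY x s A nA.
  by rewrite /= /nbhs/= -nbhs_subspace_in.
exact: (cvg_comp _ _ piW Yw).
Unshelve. all: by end_near. Qed.

(** Cauchy-Schwarz against the constant 1, obtained by integrating the square of [g - c], where [c]
    is the average of [g] over [D]. *)
Lemma Rintegral_sqr_le dT (T : measurableType dT) (m : {measure set T -> \bar R})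
    (D : set T) (g : T -> R) : measurable D -> (m D < +oo)%E ->
  0 < fine (m D) -> L2f m D g ->
  Rintegral m D g ^+ 2 <= fine (m D) * Rintegral m D (fun x => g x ^+ 2).
Proof.
move=> mD Doo p0 g2; have g1 := L2f_L1f mD Doo g2.
set p := fine (m D) in p0 *; set r := Rintegral m D g.
pose c := r / p.
have H : 0 <= Rintegral m D (fun x => g x ^+ 2) - 2 * c * r + c ^+ 2 * p.
  have -> : c ^+ 2 * p = Rintegral m D (fun=> c ^+ 2) by rewrite Rintegral_cst.
  rewrite -RintegralZl// -RintegralB//; [|by case: g2|exact: L1fZ].
  rewrite -RintegralD//; last exact: L1f_cst.
    apply: Rintegral_ge0 => x _.
    by rewrite (_ : _ + _ = (g x - c) ^+ 2) ?sqr_ge0//; ring.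
  by apply: L1fB => //; [case: g2|exact: L1fZ].
have E : p * Rintegral m D (fun x => g x ^+ 2) - r ^+ 2 =
    p * (Rintegral m D (fun x => g x ^+ 2) - 2 * c * r + c ^+ 2 * p).
  by rewrite /c; field; rewrite gt_eqF.
by rewrite -subr_ge0 E pmulr_rge0.
Qed.

End joint_measurability.

(** * Fubini on a time interval times a probability space *)

Section partial_integral.
Context d (X : measurableType d) (R : realType) (m : probability X R).
Context (a b : R) (ab : a < b).
Local Notation mu := (@lebesgue_measure R).
Local Notation pm := (mu \x m)%E.
Local Notation I := (`[a, b]%classic : set R).

Lemma IX_lty : (pm (I `*` setT) < +oo)%E.
Proof.
apply: (@setX_lty _ _ _ _ _ mu m) => //; first exact: mu_itv_lty.
by rewrite -ge0_fin_numE// fin_num_measure.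
Qed.

Lemma mIX : measurable (I `*` setT : set (g_sigma_algebraType R.-ocitv.-measurable * X)%type).
Proof. by apply: measurableX. Qed.

Lemma fubini_time (H : R * X -> R) : L1f pm (I `*` setT) H ->
  L1f m setT (fun x => Rintegral mu I (fun s => H (s, x))) /\
  Rintegral m setT (fun x => Rintegral mu I (fun s => H (s, x))) =
  Rintegral pm (I `*` setT) H.
Proof. exact: L1f_fubini2. Qed.

Lemma fubini_space (H : R * X -> R) : L1f pm (I `*` setT) H ->
  L1f mu I (fun s => Rintegral m setT (fun x => H (s, x))) /\
  Rintegral mu I (fun s => Rintegral m setT (fun x => H (s, x))) =
  Rintegral pm (I `*` setT) H.
Proof. exact: L1f_fubini1. Qed.

Lemma L2f_ae_space (H : R * X -> R) : L2f pm (I `*` setT) H ->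
  {ae m, forall x, L2f mu I (fun s => H (s, x))}.
Proof.
move=> H2; have := @L2f_ae_section2 _ _ _ _ _ mu m I setT _ _ _ H2.
by move=> K; apply: aeS (K _ _) => // x; exact.
Qed.

Lemma L2f_ae_time (H : R * X -> R) : L2f pm (I `*` setT) H ->
  {ae mu, forall s, I s -> L2f m setT (fun x => H (s, x))}.
Proof.
move=> H2; have := @L2f_ae_section1 _ _ _ _ _ mu m I setT _ _ _ H2.
exact.
Qed.

(** Cauchy-Schwarz in time bounds the squared time integral by the time integral of the square,
    which Fubini makes integrable in [x]. This handles the control's share in the majorant of the
    paths. *)
Lemma L2f_Rintegral_itv (H : R * X -> R) : L2f pm (I `*` setT) H ->
  L2f m setT (fun x => Rintegral mu I (fun s => H (s, x))).
Proof.
move=> H2; have mT : (m setT < +oo)%E by rewrite probability_setT ltry.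
have H1 := L2f_L1f mIX IX_lty H2.
have [q1 _] := fubini_time H1.
have [q2 _] := fubini_time H2.2.
have mq := L1f_measurable q1.
split => //; apply: ae_le_L1f (L1fZ (fine (mu I)) measurableT q2) => //.
  exact: measurable_funX.
apply: aeS (L2f_ae_space H2) => x Hx _.
rewrite ger0_norm ?sqr_ge0//; apply: Rintegral_sqr_le => //.
  exact: mu_itv_lty.
exact: mu_itv_gt0.
Qed.

End partial_integral.

(** * From data on the open interval to classes on the closed one *)

Section data.
Context (R : realType).
Local Notation mu := (@lebesgue_measure R).

Lemma lebesgue_measure_set2 (u v : R) : mu ([set u] `|` [set v]) = 0%E.
Proof.
apply: countable_lebesgue_measure0; apply: finite_set_countable.
by rewrite finite_setU.
Qed.

Lemma ae_notin2 (u v : R) : {ae mu, forall s, s <> u /\ s <> v}.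
Proof.
exists ([set u] `|` [set v]); split.
- exact: measurableU.
- exact: lebesgue_measure_set2.
- move=> s /=; apply: contra_notP => /not_orP[su sv]; split.
  + by move=> e; apply: su.
  + by move=> e; apply: sv.
Qed.

(** Applied with the points 0 and [T] where the data live on []0, T[], and with [t] and [T] where
    properties of [N] are available only strictly inside. *)
Lemma ae_lebesgue1 (P Q : R -> Prop) (u v : R) :
  (forall s, P s -> s <> u -> s <> v -> Q s) ->
  {ae mu, forall s, P s} -> {ae mu, forall s, Q s}.
Proof. by move=> PQ aP; apply: aeS2 aP (ae_notin2 u v) => s Ps [su sv]; exact: PQ. Qed.

(** Beyond []0, T[] the interval [[t, T]] contains at most the points 0 and [T], and every function
    is measurable on a singleton. *)
Lemma measurable_fun_itvoocc (t T : R) (g : R -> R) : 0 <= t ->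
  measurable_fun `]0, T[ g -> measurable_fun `[t, T] g.
Proof.
move=> t0 mg.
apply: (@measurable_funS _ _ _ _ (`]0, T[ `|` ([set 0] `|` [set T]))).
- by apply: measurableU => //; apply: measurableU.
- move=> s /=; rewrite !in_itv/= => /andP[ts sT].
  have := le_trans t0 ts; rewrite le_eqVlt => /predU1P[<-|s0]; first by right; left.
  move: sT; rewrite le_eqVlt => /predU1P[->|sT]; first by right; right.
  by left; rewrite s0 sT.
- apply/measurable_funU => //; first exact: measurableU.
  split => //; apply/measurable_funU => //.
  by split; exact: measurable_fun_set1.
Qed.

Lemma itvcc_oo (t T s : R) : 0 <= t -> `[t, T]%classic s -> s <> 0 -> s <> T ->
  s \in `]0, T[.
Proof.
move=> t0; rewrite /= !in_itv/= => /andP[ts sT] s0 sT'.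
rewrite !lt_neqAle sT (le_trans t0 ts) !andbT; apply/andP; split; apply/eqP => //.
by move=> e; apply: s0.
Qed.

Lemma Linf_mxLb p q (t T : R) (A : R -> 'M[R]_(p, q)) : 0 <= t -> Linf T A ->
  mxLb mu `[t, T] A.
Proof.
move=> t0 AT i j; have [mA [C AC]] := AT i j; split.
  exact: measurable_fun_itvoocc mA.
exists C; apply: (@ae_lebesgue1 _ _ 0 T) AC => s AC s0 sT st.
by apply: AC; exact: itvcc_oo st _ _.
Qed.

Lemma L2time_mxL2 k (t T : R) (f : R -> 'cV[R]_k) : 0 <= t -> L2time T f ->
  mxL2 mu `[t, T] f.
Proof.
move=> t0 [mf f2] i j; rewrite (ord1 j).
have mfi := measurable_fun_itvoocc t0 (mf i); split => //.
have mN : measurable ([set 0] `|` [set T] : set (g_sigma_algebraType R.-ocitv.-measurable)).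
  by apply: measurableU; exact: measurable_set1.
apply/(negligible_integrable mN _ _ (lebesgue_measure_set2 0 T)) => //.
  by apply/measurable_EFinP; exact: measurable_funX.
have f2' : L1f mu (`[t, T] `\` ([set 0] `|` [set T])) (fun s => normsq (f s)).
  apply: L1fS f2 => //; first exact: measurableD.
  move=> s [sI /not_orP[s0 sT]]; exact: itvcc_oo sI _ _.
apply: le_L1f f2' => //; first exact: measurableD.
  apply: measurable_funX; apply: measurable_funS mfi => //; exact: subDsetl.
move=> s _; rewrite ger0_norm ?sqr_ge0// /normsq /dotv (bigD1 i)//= -expr2 lerDl.
by apply: sumr_ge0 => k' _; rewrite -expr2 sqr_ge0.
Qed.

End data.

Section space.
Context d (X : measurableType d) (R : realType) (m : {measure set X -> \bar R}).

Lemma sqr_le_normsq k (u : 'cV[R]_k) i : u i 0 ^+ 2 <= normsq u.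
Proof.
rewrite /normsq /dotv (bigD1 i)//= -expr2 lerDl.
by apply: sumr_ge0 => k' _; rewrite -expr2 sqr_ge0.
Qed.

Lemma normsq_ge0 k (u : 'cV[R]_k) : 0 <= normsq u.
Proof. by apply: sumr_ge0 => i _; rewrite -expr2 sqr_ge0. Qed.

Lemma normsq_L1P k (E : set X) (u : X -> 'cV[R]_k) : measurable E ->
  mxL2 m E u <-> (forall i, measurable_fun E (fun x => u x i 0)) /\
                 L1f m E (fun x => normsq (u x)).
Proof.
move=> mE; split => [u2|[mu u1] i j].
  by split => [i|]; [case: (u2 i 0)|exact: dotv_L1].
rewrite (ord1 j); split => //; apply: le_L1f u1 => //.
  exact: measurable_funX.
by move=> x _; rewrite ger0_norm ?sqr_ge0// sqr_le_normsq.
Qed.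

End space.

Section controls.
Context (R : realType) (n : nat) (m : probability (Rn R n) R).
Local Notation mu := (@lebesgue_measure R).
Local Notation pm := (mu \x m)%E.
Local Notation IX t T := (`[t, T] `*` setT : set (R * Rn R n)).

Lemma L2mP k (Y : Rn R n -> 'cV[R]_k) : L2m m Y <-> mxL2 m setT Y.
Proof. by split => [H|H]; apply/(normsq_L1P _ _ measurableT). Qed.

Lemma meanE k (Y : Rn R n -> 'cV[R]_k) : mean m Y = mxI m setT Y.
Proof. by apply/matrixP => i j; rewrite !mxE (ord1 j). Qed.

(** Tonelli identifies the iterated integral in the definition with an integral over the product, so
    controls become elements of a single L^2 space on time times space. *)
Lemma admissibleP k (t T : R) (V : R -> Rn R n -> 'cV[R]_k) :
  admissible m t T V <-> mxL2 pm (IX t T) (fun p => V p.1 p.2).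
Proof.
split => [[mV Voo]|].
  apply: (@normsq_L1P _ _ _ pm _ (IX t T) (fun p => V p.1 p.2) (mIX _ _)).2.
  split; first exact: mV.
  apply: (@L1f_tonelli _ _ _ _ _ mu m) => //.
    rewrite /normsq /dotv.
    apply: measurable_sum => i; apply: measurable_funM; exact: mV.
  by under eq_integral do under eq_integral do rewrite ger0_norm ?normsq_ge0//.
move=> /(@normsq_L1P _ _ _ pm _ (IX t T) (fun p => V p.1 p.2) (mIX _ _)).1.
move=> [mV V1]; split; first exact: mV.
have := @L1f_tonelli_lty _ _ _ _ _ mu m _ _ _ _ _ V1.
move=> /(_ (measurable_itv _) measurableT) /=.
by under eq_integral do under eq_integral do rewrite ger0_norm ?normsq_ge0//.
Qed.

Lemma mean_ae k (Y Z : Rn R n -> 'cV[R]_k) : mxL2 m setT Y -> mxL2 m setT Z ->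
  {ae m, forall x, Y x = Z x} -> mean m Y = mean m Z.
Proof.
move=> Y2 Z2 YZ; apply/matrixP => i j; rewrite !mxE.
apply: ae_eq_Rintegral => //; first exact: (Y2 i 0).1.
  exact: (Z2 i 0).1.
by apply: aeS YZ => x ->.
Qed.

End controls.

(** * Regularity of the controlled state *)

Section joint_lifting.
Context (R : realType) (n : nat) (m : probability (Rn R n) R) (t T : R).
Local Notation mu := (@lebesgue_measure R).
Local Notation pm := (mu \x m)%E.
Local Notation IX := (`[t, T] `*` setT : set (R * Rn R n)).

Lemma mIXn : measurable
  (`[t, T] `*` setT : set (g_sigma_algebraType R.-ocitv.-measurable * Rn R n)%type).
Proof. exact: mIX. Qed.

Lemma m_setT_lty : (m setT < +oo)%E.
Proof. by rewrite -ge0_fin_numE// fin_num_measure. Qed.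

Lemma Rintegral_prob_cst (c : R) : Rintegral m setT (fun=> c) = c.
Proof.
have mT : fine (m setT) = 1.
  by have := @probability_setT _ _ _ m => /= ->.
by rewrite Rintegral_cst// -[RHS]mulr1 -mT.
Qed.

Lemma mxLb_fst p q (A : R -> 'M[R]_(p, q)) : mxLb mu `[t, T] A ->
  mxLb pm IX (fun z => A z.1).
Proof. by move=> A1 i j; apply: (@Lbf_fst _ _ _ _ _ mu m) (A1 i j). Qed.

Lemma mxL2_fst p q (A : R -> 'M[R]_(p, q)) : mxL2 mu `[t, T] A ->
  mxL2 pm IX (fun z => A z.1).
Proof.
move=> A1 i j; apply: (@L2f_fst _ _ _ _ _ mu m) (A1 i j) => //.
exact: m_setT_lty.
Qed.

Lemma mxL1_fst p q (A : R -> 'M[R]_(p, q)) : mxL1 mu `[t, T] A ->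
  mxL1 pm IX (fun z => A z.1).
Proof.
move=> A1 i j; apply: (@L1f_fst _ _ _ _ _ mu m) (A1 i j) => //.
exact: m_setT_lty.
Qed.

Lemma mxL2_snd p q (A : Rn R n -> 'M[R]_(p, q)) : mxL2 m setT A ->
  mxL2 pm IX (fun z => A z.2).
Proof.
move=> A1 i j; apply: (@L2f_snd _ _ _ _ _ mu m) (A1 i j) => //.
exact: mu_itv_lty.
Qed.

Lemma norm1_L2 dT (Z : measurableType dT) (m' : {measure set Z -> \bar R})
    (E : set Z) k (u : Z -> 'cV[R]_k) : measurable E -> (m' E < +oo)%E ->
  mxL2 m' E u -> L2f m' E (fun x => norm1 (u x)).
Proof. by move=> mE Eoo u2; apply: L2f_sum => // i; apply: L2f_norm; exact: u2. Qed.

Lemma norm1D k (u v : 'cV[R]_k) : norm1 (u + v) <= norm1 u + norm1 v.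
Proof.
rewrite /norm1 -big_split/=; apply: ler_sum => i _; rewrite mxE.
exact: ler_normD.
Qed.

Lemma entry_le_norm1 k (u : 'cV[R]_k) i : `|u i 0| <= norm1 u.
Proof. by rewrite /norm1 (bigD1 i)//= lerDl sumr_ge0. Qed.

Lemma mxL2_ae_space k (u : R -> Rn R n -> 'cV[R]_k) :
  mxL2 pm IX (fun p => u p.1 p.2) ->
  {ae m, forall x, mxL2 mu `[t, T] (u ^~ x)}.
Proof.
move=> u2; have : {ae m, forall x, forall i : 'I_k, L2f mu `[t, T] (fun s => u s x i 0)}.
  by apply: ae_finite => i; exact: (L2f_ae_space (u2 i 0)).
by apply: aeS => x ux i j; rewrite (ord1 j); exact: ux.
Qed.

Lemma mxL2_ae_time k (u : R -> Rn R n -> 'cV[R]_k) :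
  mxL2 pm IX (fun p => u p.1 p.2) ->
  {ae mu, forall s, `[t, T]%classic s -> mxL2 m setT (u s)}.
Proof.
move=> u2; have : {ae mu, forall s, forall i : 'I_k,
    `[t, T]%classic s -> L2f m setT (fun x => u s x i 0)}.
  by apply: ae_finite => i; exact: (L2f_ae_time (u2 i 0)).
by apply: aeS => s us sI i j; rewrite (ord1 j); exact: us.
Qed.

Lemma mean_L1 k (u : R -> Rn R n -> 'cV[R]_k) :
  mxL1 pm IX (fun p => u p.1 p.2) -> mxL1 mu `[t, T] (fun s => mean m (u s)).
Proof.
move=> u1 i j; have [H _] := fubini_space (u1 i 0).
by apply: L1f_ext H => // s _; rewrite mxE.
Qed.

End joint_lifting.

Section state.
Context (R : realType) (n d : nat) (m : probability (Rn R n) R) (t T : R).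
Context (tT : t < T).
Local Notation mu := (@lebesgue_measure R).
Local Notation pm := (mu \x m)%E.
Local Notation IX := (`[t, T] `*` setT : set (R * Rn R n)).
Context (F Fb : R -> 'M[R]_n) (G : R -> 'M[R]_(n, d)) (f : R -> 'cV[R]_n).
Context (Xt : Rn R n -> 'cV[R]_n) (V : R -> Rn R n -> 'cV[R]_d).
Context (hF : mxLb mu `[t, T] F) (hFb : mxLb mu `[t, T] Fb)
  (hG : mxLb mu `[t, T] G) (hf : mxL2 mu `[t, T] f).
Context (hXt : mxL2 m setT Xt) (hV : mxL2 pm IX (fun p => V p.1 p.2)).

(** A state for which integrals in time and space may be exchanged: joint square integrability,
    absent from [is_state], and the averaged equation, which makes the mean a solution in its own
    right. *)
Definition regular_state (Y : R -> Rn R n -> 'cV[R]_n) :=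
  [/\ mxL2 pm IX (fun p => Y p.1 p.2),
      forall s, t <= s <= T -> mxL2 m setT (Y s),
      {ae m, forall x, fwd_sol t T (Xt x) (Y ^~ x)
        (fun r => F r *m Y r x + Fb r *m mean m (Y r) + G r *m V r x + f r)} &
      fwd_sol t T (mean m Xt) (fun s => mean m (Y s))
        (fun r => (F r + Fb r) *m mean m (Y r) + G r *m mean m (V r) + f r)].

Let tT' : t <= T. Proof. exact: ltW. Qed.

Let f1 : mxL1 mu `[t, T] f.
Proof. by apply: mxL2_L1 => //; exact: mu_itv_lty. Qed.

(* At a single good x0 the state equation expresses Fb * mean Y as a
   difference of integrable functions. *)
Lemma mean_drift_L1 (Y : R -> Rn R n -> 'cV[R]_n) x0 :
  mxL2 mu `[t, T] (V ^~ x0) ->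
  fwd_sol t T (Xt x0) (Y ^~ x0)
    (fun r => F r *m Y r x0 + Fb r *m mean m (Y r) + G r *m V r x0 + f r) ->
  mxL1 mu `[t, T] (fun r => Fb r *m mean m (Y r)).
Proof.
move=> V0 Y0; have [g1 _] := Y0; have Yb := fwd_sol_Lb tT' Y0.
have FY : mxL1 mu `[t, T] (fun r => F r *m Y r x0).
  apply: mxLb_L1 => //; first exact: mu_itv_lty.
  exact: mxLbM.
have GV : mxL1 mu `[t, T] (fun r => G r *m V r x0).
  apply: mxLbL1M => //; apply: mxL2_L1 => //; exact: mu_itv_lty.
apply: mxL1_ext (mxL1B _ (mxL1B _ (mxL1B _ g1 f1) GV) FY) => // r _.
by rewrite addrK addrK addrC addrA addNr add0r.
Qed.

Lemma drift_joint_L1 (Y : R -> Rn R n -> 'cV[R]_n) (h : R -> 'cV[R]_n) :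
  mxL2 pm IX (fun p => Y p.1 p.2) -> mxL1 mu `[t, T] h ->
  mxL1 pm IX (fun p => F p.1 *m Y p.1 p.2 + h p.1 + G p.1 *m V p.1 p.2 + f p.1).
Proof.
move=> Y2 h1; have mI := @mIXn R n t T; have Ioo := IX_lty m t T.
apply: mxL1D => //; last exact: mxL1_fst.
apply: mxL1D => //; last first.
  by apply: mxL2_L1 => //; apply: mxLbL2M => //; exact: mxLb_fst.
apply: mxL1D => //; last exact: mxL1_fst.
by apply: mxL2_L1 => //; apply: mxLbL2M => //; exact: mxLb_fst.
Qed.

(** The integral equation of almost every path is integrated over [x], and Fubini on [[t, s]] moves
    the average inside. The mean of [F Y + Fb yb] is [(F + Fb) yb], so the averaged equation is
    closed in [yb]. *)
Lemma mean_equation (Y : R -> Rn R n -> 'cV[R]_n) :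
  mxL2 pm IX (fun p => Y p.1 p.2) ->
  (forall s, t <= s <= T -> mxL2 m setT (Y s)) ->
  mxL1 mu `[t, T] (fun r => Fb r *m mean m (Y r)) ->
  {ae m, forall x, fwd_sol t T (Xt x) (Y ^~ x)
        (fun r => F r *m Y r x + Fb r *m mean m (Y r) + G r *m V r x + f r)} ->
  fwd_sol t T (mean m Xt) (fun s => mean m (Y s))
        (fun r => (F r + Fb r) *m mean m (Y r) + G r *m mean m (V r) + f r).
Proof.
move=> Y2 Ys2 h1 YE; have mI := @mIXn R n t T; have Ioo := IX_lty m t T.
have g1 := drift_joint_L1 Y2 h1.
have moo := m_setT_lty m.
have Ym1 : mxL1 mu `[t, T] (fun s => mean m (Y s)).
  by apply: mean_L1; exact: mxL2_L1.
have Vm1 : mxL1 mu `[t, T] (fun s => mean m (V s)).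
  by apply: mean_L1; exact: mxL2_L1.
have r1 : mxL1 mu `[t, T]
    (fun r => (F r + Fb r) *m mean m (Y r) + G r *m mean m (V r) + f r).
  apply: mxL1D => //; apply: mxL1D => //; last exact: mxLbL1M.
  by apply: mxLbL1M => //; exact: mxLbD.
split => // s sab; have [ts sT] := andP sab.
pose g r x := F r *m Y r x + Fb r *m mean m (Y r) + G r *m V r x + f r.
(* Only for almost every time: a control has a square-integrable slice merely at almost every
   [r]. *)
have mean_g : {ae mu, forall r, `[t, s]%classic r -> mean m (g r) =
    (F r + Fb r) *m mean m (Y r) + G r *m mean m (V r) + f r}.
  apply: aeS (mxL2_ae_time hV) => r Vr rI.
  have rI' : t <= r <= T.
    move: rI; rewrite /= in_itv/= => /andP[-> rs]; exact: le_trans sT.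
  have {}Vr : mxL2 m setT (V r) by apply: Vr; rewrite /= in_itv.
  have Yr := Ys2 r rI'.
  have Vr1 := mxL2_L1 measurableT moo Vr; have Yr1 := mxL2_L1 measurableT moo Yr.
  have cL1 (c : 'cV[R]_n) : mxL1 m setT (fun=> c).
    by apply: mxLb_L1 => //; exact: mxLb_cst.
  have AL1 k (A : 'M[R]_(n, k)) (u : Rn R n -> 'cV[R]_k) :
      mxL1 m setT u -> mxL1 m setT (fun x => A *m u x).
    by move=> u1; apply: mxLbL1M => //; exact: mxLb_cst.
  have cI (c : 'cV[R]_n) : mxI m setT (fun=> c) = c.
    apply/matrixP => i j; rewrite !mxE; exact: Rintegral_prob_cst.
  have FY1 := AL1 _ (F r) _ Yr1; have GV1 := AL1 _ (G r) _ Vr1.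
  have S1 := mxL1D measurableT FY1 (cL1 (Fb r *m mean m (Y r))).
  have S2 := mxL1D measurableT S1 GV1.
  rewrite mulmxDl [LHS]meanE (mxID measurableT S2 (cL1 (f r))).
  rewrite (mxID measurableT S1 GV1) (mxID measurableT FY1 (cL1 _)) !cI.
  by rewrite !mxI_mull// -!meanE.
apply/matrixP => i j; rewrite (ord1 j) !mxE.
have gs1 : L1f pm (`[t, s] `*` setT) (fun p => g p.1 p.2 i 0).
  apply: L1fS (g1 i 0) => //; first exact: mIX.
  by move=> [r x] [rI _]; split => //; move: rI; exact: subset_itvcc.
have [tl tE] := fubini_time gs1.
have [sl sE] := fubini_space gs1.
transitivity (Rintegral m setT (fun x => Xt x i 0 +
    Rintegral mu `[t, s] (fun r => g r x i 0))).
  apply: ae_eq_Rintegral => //.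
  - exact: (Ys2 s sab i 0).1.
  - by apply: measurable_funD; [exact: (hXt i 0).1|exact: L1f_measurable tl].
  - by apply: aeS YE => x Yx _; have [_ ->//] := fwd_sol_entry i 0 Yx.
rewrite RintegralD//; last by apply: (mxL2_L1 measurableT moo hXt).
congr (_ + _); rewrite tE -sE; apply: ae_eq_Rintegral => //.
- exact: L1f_measurable sl.
- exact: L1f_measurable (L1f_subitv sab (r1 i 0)).
- by apply: aeS mean_g => r gr rI; have := gr rI; move=> <-; rewrite mxE.
Qed.

End state.

Section regularization.
Context (R : realType) (n d : nat) (m : probability (Rn R n) R) (t T : R).
Context (tT : t < T).
Local Notation mu := (@lebesgue_measure R).
Local Notation pm := (mu \x m)%E.
Local Notation IX := (`[t, T] `*` setT : set (R * Rn R n)).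
Context (F Fb : R -> 'M[R]_n) (G : R -> 'M[R]_(n, d)) (f : R -> 'cV[R]_n).
Context (Xt : Rn R n -> 'cV[R]_n) (V : R -> Rn R n -> 'cV[R]_d).
Context (hF : mxLb mu `[t, T] F) (hFb : mxLb mu `[t, T] Fb)
  (hG : mxLb mu `[t, T] G) (hf : mxL2 mu `[t, T] f).
Context (hXt : mxL2 m setT Xt) (hV : mxL2 pm IX (fun p => V p.1 p.2)).

Let tT' : t <= T. Proof. exact: ltW. Qed.

(* Off a null set N of points the paths are continuous solutions; setting the
   state to 0 on N makes it jointly measurable, and Gronwall dominates
   it by a square-integrable function of x. *)
Lemma state_regularization (Y : R -> Rn R n -> 'cV[R]_n) :
  is_state m t T F Fb G f Xt V Y ->
  exists2 Y', regular_state m t T F Fb G f Xt V Y' &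
    forall s, t <= s <= T -> {ae m, forall x, Y s x = Y' s x}.
Proof.
move=> [Ys2 Yae].
have [N [mN N0 NP]] : {ae m, forall x,
    mxL2 mu `[t, T] (V ^~ x) /\ fwd_sol t T (Xt x) (Y ^~ x)
    (fun r => F r *m Y r x + Fb r *m mean m (Y r) + G r *m V r x + f r)}.
  by apply: aeS2 (mxL2_ae_space hV) Yae => x; split.
have good x : ~ N x -> mxL2 mu `[t, T] (V ^~ x) /\
    fwd_sol t T (Xt x) (Y ^~ x)
    (fun r => F r *m Y r x + Fb r *m mean m (Y r) + G r *m V r x + f r).
  by move=> Nx; apply: contrapT => bad; apply: Nx; exact: NP.
have aeN : {ae m, forall x, ~ N x}.
  by exists N; split => // x /contrapT.
(* A null set of a probability measure has nonempty complement, and one good path is enough to see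
   that the [Fb] term is integrable in time. *)
have [x0 Nx0] : exists x, ~ N x.
  apply/existsNP => NT.
  have : m setT = 0%E by rewrite -N0; congr (m _); apply/seteqP; split.
  have := @probability_setT _ _ _ m => /= -> /eqP.
  by rewrite onee_eq0.
have Y2 s : t <= s <= T -> mxL2 m setT (Y s) by move=> /Ys2/L2mP.
have h1 : mxL1 mu `[t, T] (fun r => Fb r *m mean m (Y r)).
  by have [V0 Y0] := good x0 Nx0; exact: (mean_drift_L1 tT hF hG hf V0 Y0).
pose Y' s x := (\1_(~` N) x : R) *: Y s x.
have Y'E s x : ~ N x -> Y' s x = Y s x.
  by move=> Nx; rewrite /Y' indicE mem_set// scale1r.
have Y'0 s x : N x -> Y' s x = 0.
  by move=> Nx; rewrite /Y' indicE memNset ?scale0r// => /(_ Nx).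
have YY' s : {ae m, forall x, Y s x = Y' s x}.
  by apply: aeS aeN => x /Y'E ->.
have mN1 : measurable_fun setT (\1_(~` N) : Rn R n -> R).
  by apply: measurable_indic; exact: measurableC.
have Y'2 s : t <= s <= T -> mxL2 m setT (Y' s).
  move=> sab i j; rewrite (ord1 j).
  apply: le_L2f (L2f_norm (Y2 s sab i 0)) => //.
    rewrite (_ : (fun x => _) = (\1_(~` N) : Rn R n -> R) \* (fun x => Y s x i 0)).
      by apply: measurable_funM => //; exact: (Y2 s sab i 0).1.
    by apply/funext => x; rewrite /Y' mxE.
  by apply: aeS (YY' s) => x <-.
(* The modification keeps the means, so off [N] its paths solve the state equation with their own
   mean in it. *)
have meanY s : t <= s <= T -> mean m (Y' s) = mean m (Y s).
  move=> sab; apply: mean_ae; [exact: Y'2|exact: Y2|].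
  by apply: aeS (YY' s) => x ->.
have Y'sol x : ~ N x -> fwd_sol t T (Xt x) (Y' ^~ x)
    (fun r => F r *m Y' r x + Fb r *m mean m (Y' r) + G r *m V r x + f r).
  move=> Nx; have [_ Yx] := good x Nx.
  apply: fwd_sol_ext Yx => s sab; first by rewrite Y'E.
  by rewrite Y'E// meanY.
have h1' : mxL1 mu `[t, T] (fun r => Fb r *m mean m (Y' r)).
  by apply: mxL1_ext h1 => // r; rewrite /= in_itv => rI; rewrite meanY.
have [C C0 CP] := linear_ode_bound tT' hF.
have mI := @mIXn R n t T; have Ioo := IX_lty m t T.
have moo := m_setT_lty m.
have Ilty := mu_itv_lty t T.
pose hb := fun r => Fb r *m mean m (Y' r) + f r.
have hb1 : mxL1 mu `[t, T] hb.
  by apply: mxL1D => //; exact: mxL2_L1.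
(* [C * K x] is the Gronwall bound of the path from [x]. Its summands are square-integrable since
   [Xt] is, since constants are on a probability space, and by [L2f_Rintegral_itv]. *)
pose K x := norm1 (Xt x) + Rintegral mu `[t, T] (fun r => norm1 (hb r)) +
  Rintegral mu `[t, T] (fun r => norm1 (G r *m V r x)).
have GV2 : mxL2 pm IX (fun p => G p.1 *m V p.1 p.2).
  by apply: mxLbL2M => //; exact: mxLb_fst.
have K2 : L2f m setT K.
  apply: L2fD => //; first apply: L2fD => //.
  - exact: norm1_L2.
  - by apply: Lbf_L2f => //; exact: Lbf_cst.
  - have := @L2f_Rintegral_itv _ _ _ m t T tT (fun p => norm1 (G p.1 *m V p.1 p.2)).
    by apply; exact: norm1_L2.
have Y'K s x : t <= s <= T -> norm1 (Y' s x) <= `|C * K x|.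
  move=> sab; have [Nx|Nx] := pselect (N x).
    by rewrite Y'0// /norm1 big1 ?normr_ge0// => i _; rewrite mxE normr0.
  have [Vx _] := good x Nx.
  have GVx1 : mxL1 mu `[t, T] (fun r => G r *m V r x).
    by apply: mxLbL1M => //; exact: mxL2_L1.
  apply: le_trans (ler_norm _).
  apply: le_trans (CP (Xt x) (Y' ^~ x) (fun r => hb r + G r *m V r x) _ _ s sab) _.
  - exact: mxL1D.
  - apply: fwd_sol_ext (Y'sol x Nx) => // r _.
    by rewrite /hb !addrA -!addrA; do 2 congr (_ + _); rewrite addrC.
  rewrite ler_wpM2l// /K -addrA lerD2l.
  have n1 (u : R -> 'cV[R]_n) : mxL1 mu `[t, T] u ->
      L1f mu `[t, T] (fun r => norm1 (u r)).
    by move=> u1; apply: L1f_sum => // i; apply: L1f_norm; exact: u1.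
  rewrite -RintegralD//; [|exact: n1..].
  apply: le_Rintegral => //; [|by apply: L1fD => //; exact: n1|].
    by apply: n1; exact: mxL1D.
  by move=> r _; exact: norm1D.
have Y'j : mxL2 pm IX (fun p => Y' p.1 p.2).
  move=> i j; rewrite (ord1 j).
  apply: (@le_L2f _ _ _ _ _ _ (fun p => `|C * K p.2|)) => //.
  - apply: (@measurable_fun_continuous_paths _ (Rn R n) R t T (fun s x => Y' s x i 0)) => //.
      by move=> s sab; exact: (Y'2 s sab i 0).1.
    move=> x; have [Nx|Nx] := pselect (N x).
      apply: (@subspace_eq_continuous _ _ _ (fun=> 0)).
        by move=> s _; rewrite /from_subspace Y'0// mxE.
      by apply: continuous_subspaceT => s; exact: cvg_cst.
    have [g1 yE] := fwd_sol_entry i 0 (Y'sol x Nx).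
    exact: (within_continuous_primitive tT' g1 yE).
  - apply: aeW => -[s x] [/= sI _].
    apply: le_trans (entry_le_norm1 _ _) _; apply: Y'K.
    by move: sI; rewrite in_itv.
  - apply: L2f_norm; apply: L2fZ => //.
    by apply: (@L2f_snd _ _ _ _ _ mu m) => //.
exists Y' => [|s _]; last exact: YY'.
have Y'ae : {ae m, forall x, fwd_sol t T (Xt x) (Y' ^~ x)
    (fun r => F r *m Y' r x + Fb r *m mean m (Y' r) + G r *m V r x + f r)}.
  by apply: aeS aeN => x; exact: Y'sol.
split => //.
exact: (mean_equation hF hFb hG hf hXt hV Y'j Y'2 h1' Y'ae).
Qed.

End regularization.

(** * Completion of squares *)

Section dot_product.
Context (R : realType).

Lemma dotvE k (u v : 'cV[R]_k) : dotv u v = (u^T *m v) 0 0.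
Proof. by rewrite mxE; apply: eq_bigr => i _; rewrite mxE. Qed.

Lemma dotvC k (u v : 'cV[R]_k) : dotv u v = dotv v u.
Proof. by apply: eq_bigr => i _; rewrite mulrC. Qed.

Lemma dotvDr k (u v w : 'cV[R]_k) : dotv u (v + w) = dotv u v + dotv u w.
Proof. by rewrite !dotvE mulmxDr mxE. Qed.

Lemma dotvDl k (u v w : 'cV[R]_k) : dotv (v + w) u = dotv v u + dotv w u.
Proof. by rewrite dotvC dotvDr !(dotvC u). Qed.

Lemma dotvNr k (u v : 'cV[R]_k) : dotv u (- v) = - dotv u v.
Proof. by rewrite !dotvE mulmxN mxE. Qed.

Lemma dotvNl k (u v : 'cV[R]_k) : dotv (- v) u = - dotv v u.
Proof. by rewrite dotvC dotvNr dotvC. Qed.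

Lemma dotv_adj p k (A : 'M[R]_(p, k)) (u : 'cV[R]_k) (v : 'cV[R]_p) :
  dotv (A *m u) v = dotv u (A^T *m v).
Proof. by rewrite !dotvE trmx_mul mulmxA. Qed.

Lemma pdmx_unit k (A : 'M[R]_k) : pdmx A -> A \in unitmx.
Proof.
move=> Apd; rewrite -unitmx_tr -row_free_unit; apply/row_freeP => //.
suff K : kermx A^T = 0.
  have : row_free A^T by rewrite -kermx_eq0 K.
  by move/row_freeP.
apply/row_matrixP => i; rewrite row0; apply/eqP; apply: contraT => Ki.
have KA : A *m (row i (kermx A^T))^T = 0.
  have : row i (kermx A^T) *m A^T = 0.
    by apply/sub_kermxP; exact: row_sub.
  by move/(congr1 trmx); rewrite trmx_mul trmxK trmx0.
have := Apd (row i (kermx A^T))^T; rewrite trmx_eq0 => /(_ Ki).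
by rewrite KA dotvE mulmx0 mxE ltxx.
Qed.

Lemma symmx_inv k (A : 'M[R]_k) : symmx A -> (invmx A)^T = invmx A.
Proof. by move=> As; rewrite trmx_inv As. Qed.

End dot_product.

Section completion_of_squares.
Context (R : realType) (n d : nat).
Context (F Fb M Mb MbS P Sig : 'M[R]_n) (G : 'M[R]_(n, d)) (N : 'M[R]_d).
Context (f lam alpha y yb : 'cV[R]_n) (beta v : 'cV[R]_d).
Context (Psym : symmx P) (Ssym : symmx Sig) (Nsym : symmx N) (Nunit : N \in unitmx).
Local Notation Ni := (invmx N).

(** [dP], [dS] and [dl] are the time derivatives that the backward equations prescribe for [P],
    [Sig] and [lam]. Time is frozen here, so the identity is pure algebra. *)
Let dP := - (P *m F + F^T *m P - P *m G *m Ni *m G^T *m P + M + Mb).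
Let dS := - (Sig *m (F + Fb) + (F + Fb)^T *m Sig
             - Sig *m G *m Ni *m G^T *m Sig + M + Mb + MbS).
Let dl := - ((F^T + Fb^T - Sig *m G *m Ni *m G^T) *m lam
             + alpha + Sig *m (f - G *m Ni *m beta)).
Let p := G^T *m (P *m y).
Let pb := G^T *m (P *m yb).
Let sb := G^T *m (Sig *m yb).
Let l := G^T *m lam.
(** Written with this symmetric form, every term through [G *m Ni *m G^T] pairs two of [p], [pb],
    [sb], [l], [beta]; after bilinear expansion the identity is linear in the resulting scalars. *)
Let B (a b : 'cV[R]_d) := dotv a (Ni *m b).

Let BC a b : B a b = B b a.
Proof. by rewrite /B dotvC dotv_adj symmx_inv. Qed.
Let BDl a b c : B (a + b) c = B a c + B b c. Proof. exact: dotvDl. Qed.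
Let BDr a b c : B c (a + b) = B c a + B c b.
Proof. by rewrite BC BDl !(BC c). Qed.
Let BNl a c : B (- a) c = - B a c. Proof. exact: dotvNl. Qed.
Let BNr a c : B c (- a) = - B c a. Proof. by rewrite BC BNl BC. Qed.

Let Padj u w : dotv (P *m u) w = dotv u (P *m w).
Proof. by rewrite dotv_adj Psym. Qed.
Let Sadj u w : dotv (Sig *m u) w = dotv u (Sig *m w).
Proof. by rewrite dotv_adj Ssym. Qed.
Let Gadj (u : 'cV[R]_d) w : dotv u (G^T *m w) = dotv (G *m u) w.
Proof. by rewrite dotv_adj. Qed.

Let quadP u : dotv u (dP *m u) = - (2 * dotv (P *m u) (F *m u)
  - B (G^T *m (P *m u)) (G^T *m (P *m u)) + dotv (M *m u) u + dotv (Mb *m u) u).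
Proof.
rewrite /dP mulNmx !mulmxDl mulNmx -!mulmxA dotvNr !dotvDr dotvNr.
rewrite -(dotvC (M *m u)) -(dotvC (Mb *m u)).
have -> : dotv u (P *m (F *m u)) = dotv (P *m u) (F *m u) by rewrite Padj.
have -> : dotv u (F^T *m (P *m u)) = dotv (P *m u) (F *m u).
  by rewrite -dotv_adj dotvC.
have -> : dotv u (P *m (G *m (Ni *m (G^T *m (P *m u))))) =
    B (G^T *m (P *m u)) (G^T *m (P *m u)).
  by rewrite /B dotv_adj trmxK Padj.
by ring.
Qed.

Let quadS : dotv yb (dS *m yb) = - (2 * dotv (Sig *m yb) (F *m yb)
  + 2 * dotv (Sig *m yb) (Fb *m yb) - B sb sb
  + dotv (M *m yb) yb + dotv (Mb *m yb) yb + dotv (MbS *m yb) yb).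
Proof.
rewrite /dS mulNmx !mulmxDl mulNmx -!mulmxA dotvNr !dotvDr dotvNr.
rewrite -(dotvC (M *m yb)) -(dotvC (Mb *m yb)) -(dotvC (MbS *m yb)).
have -> : dotv yb (Sig *m ((F + Fb) *m yb)) =
    dotv (Sig *m yb) (F *m yb) + dotv (Sig *m yb) (Fb *m yb).
  by rewrite -Sadj mulmxDl dotvDr.
have -> : dotv yb ((F + Fb)^T *m (Sig *m yb)) =
    dotv (Sig *m yb) (F *m yb) + dotv (Sig *m yb) (Fb *m yb).
  by rewrite -dotv_adj dotvC mulmxDl dotvDr.
have -> : dotv yb (Sig *m (G *m (Ni *m (G^T *m (Sig *m yb))))) = B sb sb.
  by rewrite /B /sb dotv_adj trmxK Sadj.
by ring.
Qed.

Let linl : dotv dl yb = - (dotv lam (F *m yb) + dotv lam (Fb *m yb) - B sb l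
  + dotv alpha yb + dotv f (Sig *m yb) - B sb beta).
Proof.
rewrite /dl dotvNl !dotvDl !mulmxDl mulNmx !dotvDl dotvNl mulmxDr mulmxN.
rewrite !dotvDl dotvNl -!mulmxA.
have SB b : dotv (Sig *m (G *m (Ni *m b))) yb = B sb b.
  by rewrite Sadj dotv_adj dotvC.
rewrite !SB Sadj !dotv_adj !trmxK -/l.
by ring.
Qed.

Let Gam := Sig - P.
Let q0 := G^T *m lam + beta.
Let gx := F *m y + Fb *m yb + G *m v + f.
Let gb := (F + Fb) *m yb + G *m v + f.
Let w := v - (- Ni *m G^T *m (P *m y + Gam *m yb) - Ni *m q0).
Let q := p + sb - pb + l + beta.

(** The feedback is [- Ni *m q]; hence the square in [w] expands into the control cost, the cross
    term [2 v.q] and [B q q]. *)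
Let wE : w = v + Ni *m q.
Proof.
have E : G^T *m (P *m y + Gam *m yb) = p + sb - pb.
  by rewrite /Gam mulmxDr mulmxBl mulmxBr addrA.
rewrite /w !mulNmx -mulmxA E opprD !opprK; congr (v + _).
by rewrite -mulmxDr /q0 -/l /q !addrA.
Qed.

Let quadN : dotv (N *m w) w = dotv (N *m v) v + 2 * dotv v q + B q q.
Proof.
have NNi : N *m (Ni *m q) = q by rewrite (mulmxA N) mulmxV// mul1mx.
rewrite wE mulmxDr NNi dotvDl (dotvDr (N *m v)) (dotvDr q).
rewrite (dotv_adj N v (Ni *m q)) Nsym NNi (dotvC q v) /B.
by ring.
Qed.

(** The left side collects the derivatives of the three value terms and the running cost. Its [gb]
    and its [beta] term contain [v] itself where the true ones contain the mean of [v]: the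
    discrepancy is linear in the deviation of [v] from its mean and is removed on averaging, as is
    the last term, linear in [y - yb]. *)
Lemma completion_of_squares_pointwise :
  2^-1 * (2 * dotv (P *m y) gx + dotv y (dP *m y))
  + 2^-1 * (2 * dotv (Gam *m yb) gb + dotv yb ((dS - dP) *m yb))
  + (dotv dl yb + dotv lam gb)
  + (2^-1 * (dotv ((M + Mb) *m y) y + dotv (MbS *m yb) yb)
     + 2^-1 * dotv (N *m v) v + dotv alpha yb + dotv beta v) =
  2^-1 * dotv (N *m w) w + (dotv f lam - 2^-1 * dotv (Ni *m q0) q0)
  + dotv (P *m (Fb *m yb + f - G *m (Ni *m (G^T *m (Gam *m yb + lam) + beta)))) (y - yb).
Proof.
have -> : dotv (P *m y) gx = dotv (P *m y) (F *m y) + dotv (P *m y) (Fb *m yb)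
    + dotv v p + dotv (P *m y) f.
  by rewrite /gx !dotvDr /p Gadj (dotvC (G *m v)).
have -> : dotv (Gam *m yb) gb = dotv (Sig *m yb) (F *m yb) + dotv (Sig *m yb) (Fb *m yb)
    + dotv v sb + dotv f (Sig *m yb)
    - (dotv (P *m yb) (F *m yb) + dotv (P *m yb) (Fb *m yb)
    + dotv v pb + dotv (P *m yb) f).
  rewrite /Gam /gb mulmxBl dotvDl dotvNl !dotvDr mulmxDl !dotvDr.
  rewrite /sb /pb !Gadj !(dotvC (G *m v)) (dotvC f).
  by ring.
have -> : dotv lam gb = dotv lam (F *m yb) + dotv lam (Fb *m yb) + dotv v l
    + dotv f lam.
  by rewrite /gb mulmxDl !dotvDr /l Gadj !(dotvC (G *m v)) (dotvC f).
have -> : dotv yb ((dS - dP) *m yb) = dotv yb (dS *m yb) - dotv yb (dP *m yb).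
  by rewrite mulmxBl dotvDr dotvNr.
have -> : dotv (Ni *m q0) q0 = B l l + 2 * B l beta + B beta beta.
  rewrite dotvC -[dotv _ _]/(B q0 q0) /q0 -/l !BDl !BDr (BC beta l).
  by ring.
have -> : dotv ((M + Mb) *m y) y = dotv (M *m y) y + dotv (Mb *m y) y.
  by rewrite mulmxDl dotvDl.
have -> : dotv (P *m (Fb *m yb + f - G *m (Ni *m (G^T *m (Gam *m yb + lam) + beta))))
    (y - yb) = dotv (P *m y) (Fb *m yb) + dotv (P *m y) f
    - dotv (P *m yb) (Fb *m yb) - dotv (P *m yb) f
    - B (p - pb) (sb - pb + l + beta).
  have -> : G^T *m (Gam *m yb + lam) + beta = sb - pb + l + beta.
    by rewrite /sb /pb /l /Gam !mulmxDr mulmxBl mulmxBr.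
  set z := sb - pb + l + beta.
  have Gz u : dotv (G *m (Ni *m z)) u = B (G^T *m u) z by rewrite dotv_adj dotvC.
  rewrite Padj mulmxBr dotvDl dotvNl dotvDl !(dotvDr _ (P *m y)) !dotvNr !Gz.
  rewrite -/p -/pb BDl BNl !(dotvC (Fb *m yb)) !(dotvC f).
  by ring.
rewrite !quadP quadS linl quadN -/p -/pb -/sb.
have -> : B q q = B p p + B sb sb + B pb pb + B l l + B beta beta
   + 2 * (B p sb - B p pb + B p l + B p beta - B sb pb + B sb l + B sb beta
          - B pb l - B pb beta + B l beta).
  rewrite /q !(BDl, BDr, BNl, BNr).
  rewrite (BC sb p) (BC pb p) (BC l p) (BC beta p) (BC pb sb) (BC l sb).
  by rewrite (BC beta sb) (BC l pb) (BC beta pb) (BC beta l); ring.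
have -> : B (p - pb) (sb - pb + l + beta) = B p sb - B p pb + B p l + B p beta
   - B sb pb + B pb pb - B pb l - B pb beta.
  by rewrite !(BDl, BDr, BNl, BNr) (BC pb sb); ring.
rewrite /q !dotvDr dotvNr (dotvC beta v).
by lra.
Qed.

End completion_of_squares.

(** * Affine dependence on the initial value *)

Section affine_dependence.
Context (R : realType).
Local Notation mu := (@lebesgue_measure R).

(** Among all finite selections of values of [u], one of maximal rank spans the others, since adding
    a further value cannot raise the rank. The coordinates depend linearly on [u x], so they inherit
    its measurability and integrability. *)
Lemma finite_spanning_family (I : Type) n (u : I -> 'cV[R]_n) :
  exists k (p : 'I_k -> I) (L : 'M[R]_(k, n)),
    forall x, u x = (\matrix_(i, j) u (p j) i 0) *m (L *m u x).
Proof.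
pose good k (B : 'M[R]_(k, n)) := forall i, exists x, row i B = (u x)^T.
pose Q r := asbool (exists k (B : 'M[R]_(k, n)), good k B /\ \rank B = r).
have Q0 : exists r, Q r.
  exists 0%N; apply/asboolP; exists 0%N, (0 : 'M[R]_(0, n)); split; first by case.
  exact: mxrank0.
have Qn r : Q r -> (r <= n)%N.
  by move=> /asboolP[k [B [_ <-]]]; exact: rank_leq_col.
case: (ex_maxnP Q0 Qn) => r /asboolP[k [B [Bgood rB]]] rmax.
have sub x : ((u x)^T <= B)%MS.
  have B'good : good _ (col_mx (u x)^T B).
    move=> i; case: (split_ordP i) => j ->.
      by exists x; rewrite rowKu; apply/rowP => l; rewrite !mxE ord1.
    by have [z zE] := Bgood j; exists z; rewrite rowKd.
  have BB' : (B <= col_mx (u x)^T B)%MS by rewrite -addsmxE addsmxSr.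
  have rr : (\rank (col_mx (u x)^T B) <= \rank B)%N.
    by rewrite rB; apply: rmax; apply/asboolP; exists _, (col_mx (u x)^T B).
  have : (col_mx (u x)^T B <= B)%MS.
    by rewrite -(geq_leqif (mxrank_leqif_sup BB')).
  by rewrite -addsmxE; apply: submx_trans; exact: addsmxSl.
have [p pE] := choice Bgood.
(* Row spaces force a transposition: the selected values are the rows of [B], and the pseudo-inverse
   gives coordinates in them. *)
exists k, p, (pinvmx B)^T => x.
have BE : \matrix_(i, j) u (p j) i 0 = B^T.
  apply/matrixP => i j; rewrite !mxE.
  by have := congr1 (fun v : 'rV[R]_n => v 0 i) (pE j); rewrite !mxE => ->.
by rewrite BE; apply: trmx_inj; rewrite !trmx_mul !trmxK mulmxKpV.
Qed.

Lemma fwd_sol_cols a b p q (y0 : 'M[R]_(p, q)) y g :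
  (forall j, fwd_sol a b (col j y0) (fun s => col j (y s)) (fun s => col j (g s))) ->
  fwd_sol a b y0 y g.
Proof.
move=> H; split.
  move=> i j; have [g1 _] := H j; have := g1 i 0.
  by apply: eq_integrable => // s _; rewrite mxE.
move=> s sab; apply/matrixP => i j; have [_ E] := H j.
have := congr1 (fun v : 'cV[R]_p => v i 0) (E s sab).
rewrite !mxE => ->; congr (_ + _).
by apply: eq_Rintegral => r _; rewrite mxE.
Qed.

(* Uniqueness makes the flow affine in the initial value; no existence theorem
   is needed because finitely many of the given trajectories span the others. *)
Lemma linear_flow_affine (I : Type) (z0 : I) n a b (A : R -> 'M[R]_n)
    (h : R -> 'cV[R]_n) (X0 : I -> 'cV[R]_n) (Z : R -> I -> 'cV[R]_n) :
  a <= b -> mxLb mu `[a, b] A ->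
  (forall x, fwd_sol a b (X0 x) (Z ^~ x) (fun s => A s *m Z s x + h s)) ->
  exists k (Phi0 : 'M[R]_(n, k)) (Phi : R -> 'M[R]_(n, k)) (L : 'M[R]_(k, n)),
  [/\ fwd_sol a b Phi0 Phi (fun s => A s *m Phi s),
      forall x, X0 x - X0 z0 = Phi0 *m (L *m (X0 x - X0 z0)) &
      forall s x, a <= s <= b ->
        Z s x = Z s z0 + Phi s *m (L *m (X0 x - X0 z0))].
Proof.
move=> ab Ab Zs.
have [k [p [L LE]]] := finite_spanning_family (fun x => X0 x - X0 z0).
(* Subtracting the trajectory of the base point [z0] cancels the forcing [h], so the columns solve
   the homogeneous equation. *)
pose Phi0 : 'M[R]_(n, k) := \matrix_(i, j) (X0 (p j) - X0 z0) i 0.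
pose Phi s : 'M[R]_(n, k) := \matrix_(i, j) (Z s (p j) - Z s z0) i 0.
have Phis : fwd_sol a b Phi0 Phi (fun s => A s *m Phi s).
  apply: fwd_sol_cols => j.
  have cE (B : 'I_k -> 'cV[R]_n) : col j (\matrix_(i, j) B j i 0) = B j.
    by apply/colP => i; rewrite !mxE.
  have := fwd_sol_D (Zs (p j)) (fwd_sol_N (Zs z0)).
  rewrite /Phi0 (cE (fun j => X0 (p j) - X0 z0)).
  apply: fwd_sol_ext => s _; first by rewrite /Phi (cE (fun j => Z s (p j) - Z s z0)).
  rewrite colE -mulmxA -colE /Phi (cE (fun j => Z s (p j) - Z s z0)) mulmxBr.
  by rewrite opprD addrACA subrr addr0.
exists k, Phi0, Phi, L; split => // s x sab.
have cst := fwd_sol_cst a b (L *m (X0 x - X0 z0)).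
have := fwd_sol_D (Zs z0) (fwd_sol_M ab Phis cst).
rewrite -LE addrC subrK => Ys.
apply: (@linear_ode_unique R a b n A h (X0 x) (Z ^~ x)
  (fun s => Z s z0 + Phi s *m (L *m (X0 x - X0 z0))) ab Ab (Zs x)) => //.
apply: fwd_sol_ext Ys => // r _.
by rewrite mulmx0 addr0 (mulmxDr (A r)) (mulmxA (A r)) addrAC.
Qed.

End affine_dependence.

(** * Payoff identity and optimality *)

Section product_rules.
Context (R : realType) (a b : R) (ab : a <= b).
Local Notation mu := (@lebesgue_measure R).

(** Needed where a control is known to equal its feedback only for almost every time. *)
Lemma fwd_sol_ae p q (y0 : 'M[R]_(p, q)) y g g' :
  {ae mu, forall s, `[a, b]%classic s -> g s = g' s} -> mxL1 mu `[a, b] g' ->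
  fwd_sol a b y0 y g -> fwd_sol a b y0 y g'.
Proof.
move=> gg g1' [g1 yE]; split => // s sab; rewrite yE//; congr (_ + _).
apply/matrixP => i j; rewrite !mxE; apply: ae_eq_Rintegral => //.
- exact: L1f_measurable (L1f_subitv sab (g1 i j)).
- exact: L1f_measurable (L1f_subitv sab (g1' i j)).
- apply: aeS gg => r gr rI; rewrite gr//.
  by move: rI; apply: subset_itvcc => //; case/andP: sab.
Qed.

Lemma fwd_sol_dotv k (y0 z0 : 'cV[R]_k) y z g h :
  fwd_sol a b y0 y g -> fwd_sol a b z0 z h ->
  L1f mu `[a, b] (fun s => dotv (g s) (z s) + dotv (y s) (h s)) /\
  dotv (y b) (z b) = dotv (y a) (z a) +
    Rintegral mu `[a, b] (fun s => dotv (g s) (z s) + dotv (y s) (h s)).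
Proof.
move=> ys zs.
have [g1 gE] := fwd_sol_entry 0 0 (fwd_sol_M ab (fwd_sol_tr ys) zs).
have E s : ((g s)^T *m z s + (y s)^T *m h s) 0 0 = dotv (g s) (z s) + dotv (y s) (h s).
  by rewrite mxE !dotvE.
split; first by apply: L1f_ext g1 => // s _; rewrite E.
rewrite (dotvE (y b)) gE; last by rewrite lexx andbT.
rewrite (fwd_sol_init ab ys) (fwd_sol_init ab zs) -dotvE; congr (_ + _).
by apply: eq_Rintegral => s _; rewrite E.
Qed.

Lemma fwd_sol_quad k (y0 : 'cV[R]_k) y g P0 P dP :
  fwd_sol a b y0 y g -> fwd_sol a b P0 P dP ->
  (forall s, a <= s <= b -> symmx (P s)) ->
  L1f mu `[a, b] (fun s => 2 * dotv (P s *m y s) (g s) + dotv (y s) (dP s *m y s)) /\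
  dotv (P b *m y b) (y b) = dotv (P a *m y a) (y a) +
    Rintegral mu `[a, b] (fun s => 2 * dotv (P s *m y s) (g s) + dotv (y s) (dP s *m y s)).
Proof.
move=> ys Ps Psym.
have [g1 gE] := fwd_sol_dotv (fwd_sol_M ab Ps ys) ys.
have E s : a <= s <= b -> dotv (dP s *m y s + P s *m g s) (y s) +
    dotv (P s *m y s) (g s) =
    2 * dotv (P s *m y s) (g s) + dotv (y s) (dP s *m y s).
  move=> sab; rewrite dotvDl (dotv_adj (P s) (g s)) Psym// (dotvC (g s)).
  by rewrite (dotvC (dP s *m y s)); ring.
split.
  by apply: L1f_ext g1 => // s /set_mem/=; rewrite in_itv => /E.
rewrite gE; congr (_ + _).
by apply: eq_Rintegral => s /set_mem/=; rewrite in_itv => /E.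
Qed.

End product_rules.

Section expectations.
Context (R : realType) (n : nat) (m : probability (Rn R n) R).

Lemma Rintegral_dotv k (c : 'cV[R]_k) (u : Rn R n -> 'cV[R]_k) :
  mxL1 m setT u -> Rintegral m setT (fun x => dotv c (u x)) = dotv c (mean m u).
Proof.
move=> u1; rewrite /dotv Rintegral_sum// => [|i]; last first.
  by apply: L1fZ => //; exact: u1.
by apply: eq_bigr => i _; rewrite mxE RintegralZl//; exact: u1.
Qed.

(** The vector [B *m mean m Y] does not depend on [x], so pairing it with [Y] only sees the mean. *)
Lemma L2inner_calM (A B : 'M[R]_n) (Y : Rn R n -> 'cV[R]_n) : mxL2 m setT Y ->
  L2inner m (calM m A B Y) Y =
  Rintegral m setT (fun x => dotv (A *m Y x) (Y x)) + dotv (B *m mean m Y) (mean m Y).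
Proof.
move=> Y2; have moo := m_setT_lty m.
rewrite /L2inner /calM; under eq_Rintegral do rewrite dotvDl.
rewrite RintegralD//.
- by congr (_ + _); apply: Rintegral_dotv; exact: mxL2_L1.
- by apply: dotv_L1 => //; apply: mxLbL2M => //; exact: mxLb_cst.
- by apply: dotv_LbL1 => //; [exact: mxLb_cst|exact: mxL2_L1].
Qed.

End expectations.

(** * The feedback law and the value of the control problem *)

Section linear_quadratic_control.
Context (R : realType) (n d : nat) (m : probability (Rn R n) R) (t T : R).
Context (tT : t < T).
Local Notation mu := (@lebesgue_measure R).
Local Notation pm := (mu \x m)%E.
Local Notation IX := (`[t, T] `*` setT : set (R * Rn R n)).
Context (F Fb M Mb MbS : R -> 'M[R]_n) (G : R -> 'M[R]_(n, d)) (N : R -> 'M[R]_d).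
Context (f alpha : R -> 'cV[R]_n) (beta : R -> 'cV[R]_d).
Context (MT MbST : 'M[R]_n) (alphaT : 'cV[R]_n).
Context (hF : mxLb mu `[t, T] F) (hFb : mxLb mu `[t, T] Fb)
  (hM : mxLb mu `[t, T] M) (hMb : mxLb mu `[t, T] Mb) (hMbS : mxLb mu `[t, T] MbS)
  (hG : mxLb mu `[t, T] G) (hN : mxLb mu `[t, T] N)
  (hNi : mxLb mu `[t, T] (fun s => invmx (N s))) (hf : mxL2 mu `[t, T] f)
  (halpha : mxLb mu `[t, T] alpha) (hbeta : mxLb mu `[t, T] beta).
Context (hNsym : forall s, t < s < T -> symmx (N s))
  (hNpd : forall s, t < s < T -> pdmx (N s)).
Context (P Sig : R -> 'M[R]_n) (lam : R -> 'cV[R]_n).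
Local Notation Ni s := (invmx (N s)).
Context (hP : fwd_sol t T (P t) P (fun r => - (P r *m F r + (F r)^T *m P r
     - P r *m G r *m Ni r *m (G r)^T *m P r + M r + Mb r))) (PT : P T = MT).
Context (hS : fwd_sol t T (Sig t) Sig (fun r => - (Sig r *m (F r + Fb r)
     + (F r + Fb r)^T *m Sig r - Sig r *m G r *m Ni r *m (G r)^T *m Sig r
     + M r + Mb r + MbS r))) (ST : Sig T = MT + MbST).
Context (hlam : fwd_sol t T (lam t) lam (fun r => -
     (((F r)^T + (Fb r)^T - Sig r *m G r *m Ni r *m (G r)^T) *m lam r
     + alpha r + Sig r *m (f r - G r *m Ni r *m beta r)))) (lamT : lam T = alphaT).
Context (Psym : forall s, t <= s <= T -> symmx (P s))
  (Ssym : forall s, t <= s <= T -> symmx (Sig s)).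
Context (Xt : Rn R n -> 'cV[R]_n) (hXt : mxL2 m setT Xt).

(** State and mean are separate arguments: the law is evaluated both along an arbitrary state with
    its own mean and along [Xh] with [Xhb]. *)
Definition feedback (y yb : 'cV[R]_n) (s : R) : 'cV[R]_d :=
  - Ni s *m (G s)^T *m (P s *m y + (Sig s - P s) *m yb)
  - Ni s *m ((G s)^T *m lam s + beta s).

Let tT' : t <= T. Proof. exact: ltW. Qed.
Let Pb : mxLb mu `[t, T] P. Proof. exact: (fwd_sol_Lb tT' hP). Qed.
Let Sb : mxLb mu `[t, T] Sig. Proof. exact: (fwd_sol_Lb tT' hS). Qed.
Let lb : mxLb mu `[t, T] lam. Proof. exact: (fwd_sol_Lb tT' hlam). Qed.
Let mI := @mIXn R n t T.
Let Ioo := IX_lty m t T.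
Let moo := m_setT_lty m.
Let Ilty := mu_itv_lty t T.
Let mTT : measurable (`[t, T] : set (g_sigma_algebraType R.-ocitv.-measurable)).
Proof. by []. Qed.

Let liftM p q (A : R -> 'M[R]_(p, q)) (u : R -> Rn R n -> 'cV[R]_q) :
  mxLb mu `[t, T] A -> mxL2 pm IX (fun z => u z.1 z.2) ->
  mxL2 pm IX (fun z => A z.1 *m u z.1 z.2).
Proof. by move=> Ab u2; apply: mxLbL2M => //; exact: mxLb_fst. Qed.

Let liftc q (u : R -> 'cV[R]_q) : mxLb mu `[t, T] u ->
  mxL2 pm IX (fun z => u z.1).
Proof. by move=> ub; apply: mxLb_L2 => //; exact: mxLb_fst. Qed.

Lemma feedback_L2 (u : R -> Rn R n -> 'cV[R]_n) (ub : R -> 'cV[R]_n) :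
  mxL2 pm IX (fun z => u z.1 z.2) -> mxLb mu `[t, T] ub ->
  mxL2 pm IX (fun z => feedback (u z.1 z.2) (ub z.1) z.1).
Proof.
move=> u2 ubb.
have Gt : mxLb mu `[t, T] (fun s => (G s)^T) by exact: mxLb_tr.
have c1 : mxLb mu `[t, T] (fun s => Ni s *m ((G s)^T *m lam s + beta s)).
  by apply: mxLbM => //; apply: mxLbD => //; exact: mxLbM.
have c2 : mxLb mu `[t, T] (fun s => - Ni s *m (G s)^T).
  by apply: mxLbM => //; exact: mxLbN.
have c3 : mxLb mu `[t, T] (fun s => (Sig s - P s) *m ub s).
  by apply: mxLbM => //; exact: mxLbB.
apply: mxL2B => //; last exact: (liftc c1).
apply: (liftM c2 (u := fun s x => P s *m u s x + (Sig s - P s) *m ub s)).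
by apply: mxL2D => //; [exact: liftM|exact: (liftc c3)].
Qed.

Let Gam s := Sig s - P s.
Let q0 s := (G s)^T *m lam s + beta s.
(** The control is compared with the feedback along its own state [Y], not with the candidate [Vh];
    the two comparisons agree only once [Y] is known to be [Xh]. *)
Let dev (V : R -> Rn R n -> 'cV[R]_d) (Y : R -> Rn R n -> 'cV[R]_n) s x :=
  V s x - feedback (Y s x) (mean m (Y s)) s.
Let devcost V Y s :=
  Rintegral m setT (fun x => dotv (N s *m dev V Y s x) (dev V Y s x)).
Let value := 2^-1 * Rintegral m setT (fun x => dotv (P t *m Xt x) (Xt x))
     + 2^-1 * dotv (Gam t *m mean m Xt) (mean m Xt)
     + dotv (lam t) (mean m Xt) + (Rintegral mu `[t, T] (fun s => dotv (f s) (lam s))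
     - 2^-1 * Rintegral mu `[t, T] (fun s => dotv (Ni s *m q0 s) (q0 s))).

(** * The payoff identity along a regular state *)

Section payoff_identity.
Context (V : R -> Rn R n -> 'cV[R]_d) (hV : mxL2 pm IX (fun p => V p.1 p.2)).
Context (Y : R -> Rn R n -> 'cV[R]_n) (hY : regular_state m t T F Fb G f Xt V Y).

Let w s x := V s x - feedback (Y s x) (mean m (Y s)) s.
Let yb s := mean m (Y s).
Let vb s := mean m (V s).
Let Y2 : mxL2 pm IX (fun p => Y p.1 p.2). Proof. by case: hY. Qed.
Let Ys2 s : t <= s <= T -> mxL2 m setT (Y s). Proof. by case: hY => ? H _ _; exact: H. Qed.
Let ybs : fwd_sol t T (mean m Xt) yb
  (fun r => (F r + Fb r) *m yb r + G r *m vb r + f r).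
Proof. by case: hY. Qed.
Let ybb : mxLb mu `[t, T] yb. Proof. exact: (fwd_sol_Lb tT' ybs). Qed.

Lemma deviation_L2 : mxL2 pm IX (fun z => dev V Y z.1 z.2).
Proof. by apply: mxL2B => //; exact: (feedback_L2 Y2 ybb). Qed.

Let dP r := - (P r *m F r + (F r)^T *m P r
     - P r *m G r *m Ni r *m (G r)^T *m P r + M r + Mb r).
Let dS r := - (Sig r *m (F r + Fb r)
     + (F r + Fb r)^T *m Sig r - Sig r *m G r *m Ni r *m (G r)^T *m Sig r
     + M r + Mb r + MbS r).
Let dl r := - (((F r)^T + (Fb r)^T - Sig r *m G r *m Ni r *m (G r)^T) *m lam r
     + alpha r + Sig r *m (f r - G r *m Ni r *m beta r)).
Let gx s x := F s *m Y s x + Fb s *m yb s + G s *m V s x + f s.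
Let gb s := (F s + Fb s) *m yb s + G s *m vb s + f s.

Let dPb : mxLb mu `[t, T] dP.
Proof.
have Gt : mxLb mu `[t, T] (fun s => (G s)^T) by exact: mxLb_tr.
have Ft : mxLb mu `[t, T] (fun s => (F s)^T) by exact: mxLb_tr.
apply: mxLbN => //; apply: mxLbD => //; apply: mxLbD => //; apply: mxLbB => //.
  by apply: mxLbD => //; exact: mxLbM.
by do 4![apply: mxLbM => //].
Qed.

Let gx2 : mxL2 pm IX (fun z => gx z.1 z.2).
Proof.
apply: mxL2D => //; last exact: mxL2_fst.
apply: mxL2D => //; last exact: liftM.
apply: mxL2D => //; first exact: liftM.
exact: (liftc (mxLbM _ hFb ybb)).
Qed.

(** The time derivative of half the quadratic form of [P] along the path from [x]. *)
Let A s x := 2^-1 * (2 * dotv (P s *m Y s x) (gx s x) + dotv (Y s x) (dP s *m Y s x)).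

Let A1 : L1f pm IX (fun z => A z.1 z.2).
Proof.
apply: L1fZ => //; apply: L1fD => //; first apply: L1fZ => //.
  by apply: dotv_L1 => //; exact: liftM.
by apply: dotv_L1 => //; exact: liftM.
Qed.

Let EPX (s : R) := Rintegral m setT (fun x => dotv (P s *m Y s x) (Y s x)).

Let EPX1 s : t <= s <= T -> L1f m setT (fun x => dotv (P s *m Y s x) (Y s x)).
Proof.
move=> sab; apply: dotv_L1 => //; last exact: Ys2.
by apply: mxLbL2M => //; [exact: mxLb_cst|exact: Ys2].
Qed.

(** The product rule holds path by path for almost every [x]; integrating over [x] and exchanging
    the integrals by joint integrability of [A] gives its averaged form. *)
Let IA : 2^-1 * EPX T =
  2^-1 * Rintegral m setT (fun x => dotv (P t *m Xt x) (Xt x))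
  + Rintegral mu `[t, T] (fun s => Rintegral m setT (A s)).
Proof.
have [a1 aE] := fubini_time A1.
have [b1 bE] := fubini_space A1.
have PX1 : L1f m setT (fun x => dotv (P t *m Xt x) (Xt x)).
  by apply: dotv_L1 => //; apply: mxLbL2M => //; exact: mxLb_cst.
have TI : t <= T <= T by rewrite tT' lexx.
rewrite bE -aE -(RintegralZl _ measurableT PX1) -(RintegralZl _ measurableT (EPX1 TI)).
rewrite -(RintegralD measurableT (L1fZ _ measurableT PX1) a1).
apply: ae_eq_Rintegral => //.
- exact: L1f_measurable (L1fZ 2^-1 measurableT (EPX1 TI)).
- exact: L1f_measurable (L1fD measurableT (L1fZ 2^-1 measurableT PX1) a1).
have [_ _ Yae _] := hY.
apply: aeS Yae => x Yx _.
have [c1 cE] := fwd_sol_quad tT' Yx hP Psym.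
rewrite cE (fwd_sol_init tT' Yx) mulrDr; congr (_ + _).
by rewrite -RintegralZl.
Qed.

(** [D2] and [D3] are the derivatives of the two value terms in the mean, with weights [Gam] and
    [lam]. *)
Let D2 s := 2^-1 * (2 * dotv (Gam s *m yb s) (gb s) + dotv (yb s) ((dS s - dP s) *m yb s)).
Let D3 s := dotv (dl s) (yb s) + dotv (lam s) (gb s).

Let I2 : L1f mu `[t, T] D2 /\ 2^-1 * dotv (Gam T *m yb T) (yb T) =
  2^-1 * dotv (Gam t *m mean m Xt) (mean m Xt) + Rintegral mu `[t, T] D2.
Proof.
have hGam := fwd_sol_D hS (fwd_sol_N hP).
have Gsym s : t <= s <= T -> symmx (Sig s - P s).
  by move=> sab; rewrite /symmx linearB/= Ssym// Psym.
have [c1 cE] := fwd_sol_quad tT' ybs hGam Gsym.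
split; first exact: L1fZ.
by rewrite cE (fwd_sol_init tT' ybs) mulrDr; congr (_ + _); rewrite -RintegralZl.
Qed.

Let I3 : L1f mu `[t, T] D3 /\ dotv (lam T) (yb T) =
  dotv (lam t) (mean m Xt) + Rintegral mu `[t, T] D3.
Proof.
have [c1 cE] := fwd_sol_dotv tT' hlam ybs.
by split => //; rewrite cE (fwd_sol_init tT' ybs).
Qed.

Let rc s := 2^-1 * L2inner m (calM m (M s + Mb s) (MbS s) (Y s)) (Y s)
    + 2^-1 * L2inner m (fun x => N s *m V s x) (V s)
    + dotv (alpha s) (mean m (Y s)) + dotv (beta s) (mean m (V s)).

Let rc1 : L1f mu `[t, T] rc.
Proof.
have vb1 : mxL1 mu `[t, T] vb by apply: mean_L1; exact: mxL2_L1.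
apply: L1fD => //; last exact: dotv_LbL1.
apply: L1fD => //; last by apply: dotv_LbL1 => //; exact: mxLb_L1.
apply: L1fD => //; apply: L1fZ => //.
- have := @fubini_space _ _ _ m t T
    (fun z => dotv (calM m (M z.1 + Mb z.1) (MbS z.1) (Y z.1) z.2) (Y z.1 z.2)).
  case => //; apply: dotv_L1 => //.
  apply: mxL2D => //; last exact: (liftc (mxLbM _ hMbS ybb)).
  by apply: (@liftM _ _ (fun s => M s + Mb s)) => //; exact: mxLbD.
- have := @fubini_space _ _ _ m t T
    (fun z => dotv (N z.1 *m V z.1 z.2) (V z.1 z.2)).
  by case => //; apply: dotv_L1 => //; exact: liftM.
Qed.

Let W s := Rintegral m setT (fun x => dotv (N s *m w s x) (w s x)).

Lemma deviation_cost_L1 : L1f mu `[t, T] (devcost V Y).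
Proof.
have := @fubini_space _ _ _ m t T (fun z => dotv (N z.1 *m w z.1 z.2) (w z.1 z.2)).
case => //; apply: dotv_L1 => //; last exact: deviation_L2.
by apply: liftM => //; exact: deviation_L2.
Qed.

Let flam1 : L1f mu `[t, T] (fun s => dotv (f s) (lam s)).
Proof.
have H : L1f mu `[t, T] (fun s => dotv (lam s) (f s)).
  by apply: dotv_LbL1 => //; exact: mxL2_L1.
by apply: L1f_ext H => // s _; rewrite dotvC.
Qed.

Let q01 : L1f mu `[t, T] (fun s => dotv (Ni s *m q0 s) (q0 s)).
Proof.
have q0b : mxLb mu `[t, T] q0.
  by apply: mxLbD => //; apply: mxLbM => //; exact: mxLb_tr.
by apply: dotv_LbL1 => //; [exact: mxLbM|exact: mxLb_L1].
Qed.

(** The pointwise identity averaged over [x]: the terms linear in [Y s x - yb s] and [V s x - vb s]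
    have mean zero. The endpoints are discarded because [N] is known to be invertible only inside,
    and so are times at which a slice of [V] is not square-integrable. *)
Let balance : {ae mu, forall s, `[t, T]%classic s ->
  Rintegral m setT (A s) + D2 s + D3 s + rc s =
  2^-1 * W s + (dotv (f s) (lam s) - 2^-1 * dotv (Ni s *m q0 s) (q0 s))}.
Proof.
have w2 : mxL2 pm IX (fun z => w z.1 z.2) := deviation_L2.
have aeVw : {ae mu, forall s, `[t, T]%classic s ->
    mxL2 m setT (V s) /\ mxL2 m setT (w s)}.
  apply: aeS2 (mxL2_ae_time hV) (mxL2_ae_time w2) => s Vs ws sI.
  by split; [exact: Vs|exact: ws].
apply: (@ae_lebesgue1 _ _ _ t T) aeVw => s Vw st sT sI.
have [Vs2 ws2] := Vw sI.
have sab : t <= s <= T by move: sI; rewrite /= in_itv.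
have sab' : t < s < T.
  case/andP: sab => ts sT'; rewrite !lt_neqAle ts sT' !andbT.
  by apply/andP; split; apply/eqP => // e; apply: st.
have Y2s := Ys2 sab.
have Y1s := mxL2_L1 measurableT moo Y2s.
have V1s := mxL2_L1 measurableT moo Vs2.
have cL2 k (c : 'cV[R]_k) : mxL2 m setT (fun=> c).
  by apply: mxLb_L2 => //; exact: mxLb_cst.
have AL2 p k (B : 'M[R]_(p, k)) (u : Rn R n -> 'cV[R]_k) :
    mxL2 m setT u -> mxL2 m setT (fun x => B *m u x).
  by move=> u1; apply: mxLbL2M => //; exact: mxLb_cst.
(* [c] multiplies the fluctuation of the state; [c'] multiplies that of the control and repairs the
   use of [V s x] in place of [vb s] in the pointwise identity. *)
pose c := P s *m (Fb s *m yb s + f s -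
  G s *m (Ni s *m ((G s)^T *m (Gam s *m yb s + lam s) + beta s))).
pose c' := (G s)^T *m (Gam s *m yb s + lam s) + beta s.
(* [K] gathers all terms that do not depend on [x], so that it integrates to itself. *)
pose K := (dotv (f s) (lam s) - 2^-1 * dotv (Ni s *m q0 s) (q0 s)) - D2 s - D3 s
  - 2^-1 * dotv (MbS s *m yb s) (yb s) - dotv (alpha s) (yb s) - dotv (beta s) (vb s).
have pw x : A s x + 2^-1 * dotv ((M s + Mb s) *m Y s x) (Y s x)
    + 2^-1 * dotv (N s *m V s x) (V s x) =
    K + 2^-1 * dotv (N s *m w s x) (w s x) + (dotv c (Y s x) - dotv c (yb s))
    - (dotv c' (V s x) - dotv c' (vb s)).
  have := @completion_of_squares_pointwise R n d (F s) (Fb s) (M s) (Mb s) (MbS s)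
    (P s) (Sig s) (G s) (N s) (f s) (lam s) (alpha s) (Y s x) (yb s) (beta s) (V s x)
    (Psym sab) (Ssym sab) (hNsym sab') (pdmx_unit (hNpd sab')).
  rewrite -/(dP s) -/(dS s) -/(dl s) -/(Gam s) -/(q0 s) -/(gx s x) -/(w s x) -/c.
  rewrite (dotvDr c (Y s x)) dotvNr.
  have gbE : (F s + Fb s) *m yb s + G s *m V s x + f s = gb s + G s *m (V s x - vb s).
    rewrite /gb mulmxBr [G s *m V s x - _]addrC addrA.
    by rewrite (addrAC _ (f s)) addrK addrAC.
  rewrite gbE !(dotvDr _ (gb s)).
  have -> : dotv c' (V s x) - dotv c' (vb s) =
     dotv (Gam s *m yb s) (G s *m (V s x - vb s)) +
     dotv (lam s) (G s *m (V s x - vb s)) + dotv (beta s) (V s x) - dotv (beta s) (vb s).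
    rewrite /c' !dotvDl !(dotv_adj (G s)^T) !trmxK !mulmxBr !dotvDl !dotvDr !dotvNr.
    by lra.
  rewrite /A /K /D2 /D3 /q0 /gx => E; lra.
have L1a : L1f m setT (A s).
  apply: L1fZ => //; apply: L1fD => //; first apply: L1fZ => //.
    apply: dotv_L1 => //; first exact: AL2.
    apply: mxL2D => //; apply: mxL2D => //; last exact: AL2.
    by apply: mxL2D => //; exact: AL2.
  by apply: dotv_L1 => //; exact: AL2.
have L1b : L1f m setT (fun x => dotv ((M s + Mb s) *m Y s x) (Y s x)).
  by apply: dotv_L1 => //; exact: AL2.
have L1c : L1f m setT (fun x => dotv (N s *m V s x) (V s x)).
  by apply: dotv_L1 => //; exact: AL2.
have L1w : L1f m setT (fun x => dotv (N s *m w s x) (w s x)).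
  by apply: dotv_L1 => //; exact: AL2.
have L1y : L1f m setT (fun x => dotv c (Y s x)) by apply: dotv_L1.
have L1v : L1f m setT (fun x => dotv c' (V s x)) by apply: dotv_L1.
have L1k (k : R) : L1f m setT (fun=> k) by apply: L1f_cst.
have : Rintegral m setT (fun x => A s x + 2^-1 * dotv ((M s + Mb s) *m Y s x) (Y s x)
    + 2^-1 * dotv (N s *m V s x) (V s x)) =
  Rintegral m setT (fun x => K + 2^-1 * dotv (N s *m w s x) (w s x)
    + (dotv c (Y s x) - dotv c (yb s)) - (dotv c' (V s x) - dotv c' (vb s))).
  by apply: eq_Rintegral => x _; exact: pw.
have b1 := L1fZ (2^-1) measurableT L1b.
have c1 := L1fZ (2^-1) measurableT L1c.
have w1 := L1fZ (2^-1) measurableT L1w.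
have y1 := L1fB measurableT L1y (L1k (dotv c (yb s))).
have v1 := L1fB measurableT L1v (L1k (dotv c' (vb s))).
have kw1 := L1fD measurableT (L1k K) w1.
rewrite (RintegralD measurableT (L1fD measurableT L1a b1) c1).
rewrite (RintegralD measurableT L1a b1).
rewrite (RintegralB measurableT (L1fD measurableT kw1 y1) v1).
rewrite (RintegralD measurableT kw1 y1) (RintegralD measurableT (L1k K) w1).
rewrite (RintegralB measurableT L1y (L1k _)) (RintegralB measurableT L1v (L1k _)).
rewrite (RintegralZl _ measurableT L1b) (RintegralZl _ measurableT L1c).
rewrite (RintegralZl _ measurableT L1w) !Rintegral_prob_cst !Rintegral_dotv//.
rewrite -/(yb s) -/(vb s) -/(W s) !subrr addr0 subr0.
rewrite /rc L2inner_calM// /L2inner /K -/(yb s) -/(vb s) => E.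
by lra.
Qed.

(** Integrating [balance] in time and adding the three product rules, the boundary terms at [T] are
    exactly the terminal costs, and those at [t] together with the [f], [lam] and [q0] integrals
    form [value]. *)
Lemma payoff_identity :
  payoff m t T (fun s => calM m (M s + Mb s) (MbS s)) (calM m MT MbST)
    N alpha beta alphaT V Y = value + 2^-1 * Rintegral mu `[t, T] (devcost V Y).
Proof.
rewrite -[devcost V Y]/W.
have W1 : L1f mu `[t, T] W := deviation_cost_L1.
have [a1 _] := fubini_space A1.
have [d2 E2] := I2; have [d3 E3] := I3.
have TI : t <= T <= T by rewrite tT' lexx.
have fq1 := L1fB mTT flam1 (L1fZ 2^-1 mTT q01).
have s1 := L1fD mTT a1 d2; have s2 := L1fD mTT s1 d3; have s3 := L1fD mTT s2 rc1.
have w1 := L1fZ 2^-1 mTT W1.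
have : Rintegral mu `[t, T] (fun s => Rintegral m setT (A s) + D2 s + D3 s + rc s) =
    Rintegral mu `[t, T] (fun s => 2^-1 * W s +
      (dotv (f s) (lam s) - 2^-1 * dotv (Ni s *m q0 s) (q0 s))).
  apply: ae_eq_Rintegral => //; first exact: L1f_measurable s3.
  exact: L1f_measurable (L1fD mTT w1 fq1).
rewrite (RintegralD mTT s2 rc1) (RintegralD mTT s1 d3) (RintegralD mTT a1 d2).
rewrite (RintegralD mTT w1 fq1) (RintegralB mTT flam1 (L1fZ 2^-1 mTT q01)).
rewrite (RintegralZl _ mTT W1) (RintegralZl _ mTT q01) => E.
rewrite /payoff L2inner_calM; last exact: Ys2.
have MbSTE : MbST = Gam T by rewrite /Gam ST PT addrC addKr.
rewrite -/rc -lamT -PT MbSTE -/(EPX T) -/(yb T) /value.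
move: E IA E2 E3; rewrite -/(Rintegral mu `[t, T] rc) /=.
set x1 := Rintegral mu _ (fun s => Rintegral m setT (A s)).
by lra.
Qed.

End payoff_identity.

(** The payoff sees the state only through means and inner products of its slices, so a state may be
    replaced by its regular modification. *)
Lemma payoff_ae V Y Y' : (forall s, t <= s <= T -> mxL2 m setT (Y s)) ->
  (forall s, t <= s <= T -> mxL2 m setT (Y' s)) ->
  (forall s, t <= s <= T -> {ae m, forall x, Y s x = Y' s x}) ->
  payoff m t T (fun s => calM m (M s + Mb s) (MbS s)) (calM m MT MbST)
    N alpha beta alphaT V Y =
  payoff m t T (fun s => calM m (M s + Mb s) (MbS s)) (calM m MT MbST)
    N alpha beta alphaT V Y'.
Proof.
move=> Y2 Y2' YY'.
have mE s : t <= s <= T -> mean m (Y s) = mean m (Y' s).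
  by move=> sab; apply: mean_ae; [exact: Y2|exact: Y2'|exact: YY'].
have LE A B s : t <= s <= T -> L2inner m (calM m A B (Y s)) (Y s) =
    L2inner m (calM m A B (Y' s)) (Y' s).
  have AL1 (Z : Rn R n -> 'cV[R]_n) : mxL2 m setT Z ->
      L1f m setT (fun x => dotv (A *m Z x) (Z x)).
    by move=> Z2; apply: dotv_L1 => //; apply: mxLbL2M => //; exact: mxLb_cst.
  move=> sab; rewrite !L2inner_calM; [|exact: Y2'|exact: Y2].
  rewrite mE//; congr (_ + _); apply: ae_eq_Rintegral => //.
  - exact: L1f_measurable (AL1 _ (Y2 s sab)).
  - exact: L1f_measurable (AL1 _ (Y2' s sab)).
  - by apply: aeS (YY' s sab) => x ->.
have TI : t <= T <= T by rewrite tT' lexx.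
have addE (u v w z : R) : u = v -> u + w + z = v + w + z by move=> ->.
rewrite /payoff (LE MT MbST T TI) (mE T TI); apply: addE.
apply: eq_Rintegral => s /set_mem/=; rewrite in_itv => sab.
by rewrite (LE _ _ s sab) (mE s sab).
Qed.

Lemma devcost_ge0 V Y s : t < s < T -> 0 <= devcost V Y s.
Proof.
move=> sab; apply: Rintegral_ge0 => x _.
have [->|w0] := eqVneq (dev V Y s x) 0; first by rewrite mulmx0 dotvE trmx0 mul0mx mxE.
by rewrite dotvC; apply: ltW; exact: hNpd.
Qed.

Let ae_inner (Q Q' : R -> Prop) : (forall s, t < s < T -> Q s -> Q' s) ->
  {ae mu, forall s, `[t, T]%classic s -> Q s} ->
  {ae mu, forall s, `[t, T]%classic s -> Q' s}.
Proof.
move=> QQ; apply: (@ae_lebesgue1 _ _ _ t T) => s H st sT sI.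
apply: QQ (H sI); move: sI; rewrite /= in_itv/= => /andP[ts sT'].
rewrite !lt_neqAle ts sT' !andbT.
by apply/andP; split; apply/eqP => // e; apply: st.
Qed.

Let ae_true : {ae mu, forall s, `[t, T]%classic s -> True}.
Proof. exact: aeW. Qed.

Lemma Rintegral_devcost_ge0 V Y : mxL2 pm IX (fun p => V p.1 p.2) ->
  regular_state m t T F Fb G f Xt V Y -> 0 <= Rintegral mu `[t, T] (devcost V Y).
Proof.
move=> V2 hY; have W1 := deviation_cost_L1 V2 hY.
rewrite (@ae_eq_Rintegral _ _ _ mu _ _ (fun s => `|devcost V Y s|)) //.
- by apply: Rintegral_ge0.
- exact: L1f_measurable W1.
- exact: L1f_measurable (L1f_norm W1).
- by apply: ae_inner ae_true => s sab _; rewrite ger0_norm// devcost_ge0.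
Qed.

(** A nonnegative integrand with zero integral vanishes almost everywhere, used first in time and
    then in space; positive definiteness of [N] turns zero cost into zero deviation. *)
Lemma devcost_eq0 V Y : mxL2 pm IX (fun p => V p.1 p.2) ->
  regular_state m t T F Fb G f Xt V Y -> Rintegral mu `[t, T] (devcost V Y) = 0 ->
  {ae mu, forall s, `[t, T]%classic s -> {ae m, forall x, dev V Y s x = 0}}.
Proof.
move=> V2 hY W0; have W1 := deviation_cost_L1 V2 hY.
have Wae : {ae mu, forall s, `[t, T]%classic s -> devcost V Y s = 0}.
  apply: Rintegral_ge0_eq0 => //.
  by apply: ae_inner ae_true => s sab _; exact: devcost_ge0.
have Wae2 : {ae mu, forall s, `[t, T]%classic s ->
    devcost V Y s = 0 /\ mxL2 m setT (dev V Y s)}.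
  apply: aeS2 Wae (mxL2_ae_time (deviation_L2 V2 hY)) => s a b sI.
  by split; [exact: a|exact: b].
apply: ae_inner Wae2 => s sab [Ws ws2].
have ws1 : L1f m setT (fun x => dotv (N s *m dev V Y s x) (dev V Y s x)).
  by apply: dotv_L1 => //; apply: mxLbL2M => //; exact: mxLb_cst.
have pos x : 0 <= dotv (N s *m dev V Y s x) (dev V Y s x).
  have [->|w0] := eqVneq (dev V Y s x) 0; first by rewrite mulmx0 dotvE trmx0 mul0mx mxE.
  by rewrite dotvC; apply: ltW; exact: hNpd.
have := Rintegral_ge0_eq0 measurableT ws1 (aeW _ (fun x _ => pos x)) Ws.
apply: aeS => x /(_ I) wx; apply/eqP; apply: contraT => w0.
by have := hNpd sab w0; rewrite dotvC wx ltxx.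
Qed.

(** Exchanges the two almost-everywhere quantifiers: by Fubini the integral of [normsq] vanishes in
    either order. Paths need the statement at fixed [x], whereas the cost yields it at fixed [s]. *)
Lemma ae_time_space (u : R -> Rn R n -> 'cV[R]_d) :
  mxL2 pm IX (fun p => u p.1 p.2) ->
  {ae mu, forall s, `[t, T]%classic s -> {ae m, forall x, u s x = 0}} ->
  Rintegral pm IX (fun z => normsq (u z.1 z.2)) = 0 /\
  {ae m, forall x, {ae mu, forall s, `[t, T]%classic s -> u s x = 0}}.
Proof.
move=> u2 u0.
have n1 : L1f pm IX (fun z => normsq (u z.1 z.2)) by apply: dotv_L1.
have n0 k : normsq (0 : 'cV[R]_k) = 0 by rewrite /normsq dotvE mulmx0 mxE.
have [s1 sE] := fubini_space n1; have [t1 tE] := fubini_time n1.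
have I0 : Rintegral pm IX (fun z => normsq (u z.1 z.2)) = 0.
  rewrite -sE -[RHS](mul0r (fine (mu `[t, T]))) -(Rintegral_cst mu mTT 0).
  apply: ae_eq_Rintegral => //; first exact: L1f_measurable s1.
  apply: aeS2 u0 (mxL2_ae_time u2) => s us us2 sI.
  rewrite -[RHS](Rintegral_prob_cst m 0).
  apply: ae_eq_Rintegral => //.
    by apply: (L1f_measurable (mu := m)); apply: dotv_L1 => //; exact: us2.
  by apply: aeS (us sI) => x -> _; rewrite n0.
split => //.
have pos x : 0 <= Rintegral mu `[t, T] (fun s => normsq (u s x)).
  by apply: Rintegral_ge0 => s _; exact: normsq_ge0.
have tae := Rintegral_ge0_eq0 measurableT t1 (aeW _ (fun x _ => pos x)) (etrans tE I0).
apply: aeS2 tae (mxL2_ae_space u2) => x /(_ I) nx ux2.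
have nx1 : L1f mu `[t, T] (fun s => normsq (u s x)) by apply: dotv_L1.
have nx0 : {ae mu, forall s, `[t, T]%classic s -> 0 <= normsq (u s x)}.
  by apply: aeW => s _; exact: normsq_ge0.
have := Rintegral_ge0_eq0 mTT nx1 nx0 nx.
apply: aeS => s us sI; apply/matrixP => i j; rewrite (ord1 j) mxE; apply/eqP.
rewrite -sqrf_eq0; apply/eqP/le_anti; rewrite sqr_ge0 andbT.
by rewrite -(us sI) sqr_le_normsq.
Qed.

(** * The closed loop and its regularity *)

Context (Xhb : R -> 'cV[R]_n) (Xh : R -> Rn R n -> 'cV[R]_n).
Context (hXhb : fwd_sol t T (mean m Xt) Xhb (fun r =>
     (F r + Fb r - G r *m Ni r *m (G r)^T *m Sig r) *m Xhb r
     - G r *m Ni r *m ((G r)^T *m lam r + beta r) + f r)).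
Context (hXh : forall x, fwd_sol t T (Xt x) (fun s => Xh s x) (fun r =>
     (F r - G r *m Ni r *m (G r)^T *m P r) *m Xh r x
     + (Fb r - G r *m Ni r *m (G r)^T *m Gam r) *m Xhb r
     - G r *m Ni r *m ((G r)^T *m lam r + beta r) + f r)).

(** The closed-loop drift is [Acl] applied to the path plus [hcl], which depends on the mean alone;
    with the mean fixed, all paths solve one linear equation. *)
Let Acl r := F r - G r *m Ni r *m (G r)^T *m P r.
Let hcl r (yb : 'cV[R]_n) := (Fb r - G r *m Ni r *m (G r)^T *m Gam r) *m yb
     - G r *m Ni r *m ((G r)^T *m lam r + beta r) + f r.
Let Vh s x := feedback (Xh s x) (Xhb s) s.

Let closed_loopE r y yb : F r *m y + Fb r *m yb + G r *m feedback y yb r + f r =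
  Acl r *m y + hcl r yb.
Proof.
have zm (x1 x2 a b c e : 'cV[R]_n) :
    x1 + x2 + (- (a + b) - c) + e = (x1 - a) + (x2 - b - c + e).
  by apply/matrixP => i j; rewrite !mxE; ring.
pose K := G r *m Ni r *m (G r)^T.
have -> : G r *m feedback y yb r = - (K *m P r *m y + K *m Gam r *m yb)
    - G r *m Ni r *m ((G r)^T *m lam r + beta r).
  rewrite /feedback mulmxBr !mulNmx mulmxN; congr (- _ - _); last by rewrite mulmxA.
  by rewrite mulmxA (mulmxA (G r) (Ni r)) mulmxDr !mulmxA.
by rewrite /Acl /hcl !mulmxBl -/K; exact: zm.
Qed.

(** Because [Sig = P + Gam], the curve [Xhb] solves the very equation of the paths [Xh], only from
    the initial value [mean m Xt]. *)
Let closed_loop_meanE r yb : (F r + Fb r - G r *m Ni r *m (G r)^T *m Sig r) *m yb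
     - G r *m Ni r *m ((G r)^T *m lam r + beta r) + f r = Acl r *m yb + hcl r yb.
Proof.
have zm (x1 x2 a b c e : 'cV[R]_n) :
    x1 + x2 - a - c + e = (x1 - b) + (x2 - (a - b) - c + e).
  by apply/matrixP => i j; rewrite !mxE; ring.
rewrite /Acl /hcl /Gam !mulmxBl mulmxDl mulmxBr mulmxBl.
exact: zm.
Qed.

Let Aclb : mxLb mu `[t, T] Acl.
Proof.
have Gt : mxLb mu `[t, T] (fun s => (G s)^T) by exact: mxLb_tr.
by apply: mxLbB => //; do 3![apply: mxLbM => //].
Qed.

Let Xhs x : fwd_sol t T (Xt x) (Xh ^~ x) (fun r => Acl r *m Xh r x + hcl r (Xhb r)).
Proof. by apply: fwd_sol_ext (hXh x) => // s _; rewrite /hcl !addrA. Qed.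

Let Xhbs : fwd_sol t T (mean m Xt) Xhb (fun r => Acl r *m Xhb r + hcl r (Xhb r)).
Proof. by apply: fwd_sol_ext hXhb => // s _; rewrite closed_loop_meanE. Qed.

(** The affine formula for the flow writes [Xh s x] as a function of time plus a matrix of time
    applied to coordinates that are affine in [Xt x]. Square integrability follows, and the mean
    solves the equation of [Xhb], so uniqueness identifies the two. *)
Lemma optimal_state_regularity : [/\ mxL2 pm IX (fun z => Xh z.1 z.2),
  forall s, t <= s <= T -> mxL2 m setT (Xh s) &
  forall s, t <= s <= T -> mean m (Xh s) = Xhb s].
Proof.
have [k [Phi0 [Phi [L [Phis Phi0E XE]]]]] :=
  linear_flow_affine (0 : 'cV[R]_n) tT' Aclb Xhs.
set z0 : Rn R n := 0 in Phi0E XE.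
pose c x := L *m (Xt x - Xt z0).
have c2 : mxL2 m setT c.
  apply: mxLbL2M => //; first exact: mxLb_cst.
  by apply: mxL2B => //; apply: mxLb_L2 => //; exact: mxLb_cst.
have Xz := fwd_sol_Lb tT' (Xhs z0).
have Phib := fwd_sol_Lb tT' Phis.
have X2 s : t <= s <= T -> mxL2 m setT (Xh s).
  move=> sab; apply: (@mxL2_ext _ _ _ m _ _ _ _ (fun x => Xh s z0 + Phi s *m c x)) => //.
    by move=> x _; rewrite [Xh s x]XE.
  apply: mxL2D => //; first by apply: mxLb_L2 => //; exact: mxLb_cst.
  by apply: mxLbL2M => //; exact: mxLb_cst.
have meanX s : t <= s <= T -> mean m (Xh s) = Xh s z0 + Phi s *m mean m c.
  move=> sab; rewrite !meanE.
  rewrite (@mxI_ext _ _ _ m setT _ _ _ (fun x => Xh s z0 + Phi s *m c x)); last first.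
    by move=> x _; rewrite [Xh s x]XE.
  have c1 := mxL2_L1 measurableT moo c2.
  have k1 : mxL1 m setT (fun=> Xh s z0) by apply: mxLb_L1 => //; exact: mxLb_cst.
  have k2 : mxL1 m setT (fun x => Phi s *m c x).
    by apply: mxLbL1M => //; exact: mxLb_cst.
  rewrite mxID// mxI_mull//; congr (_ + _).
  by apply/matrixP => i j; rewrite mxE Rintegral_prob_cst.
split => //.
  apply: (@mxL2_ext _ _ _ pm IX mI _ _ (fun z => Xh z.1 z0 + Phi z.1 *m c z.2)).
    by move=> [s x] [/= sI _]; rewrite [Xh s x]XE//; move: sI; rewrite in_itv.
  apply: mxL2D => //; first exact: (liftc Xz).
  by apply: mxLbL2M => //; [exact: mxLb_fst|exact: mxL2_snd].
(* [Phi0] rebuilds [Xt x - Xt z0] from its coordinates [c x]; averaging this fixes the initial value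
   of the mean. *)
have Phic : Phi0 *m mean m c = mean m Xt - Xt z0.
  have c1 := mxL2_L1 measurableT moo c2.
  have x1 := mxL2_L1 measurableT moo hXt.
  have k1 : mxL1 m setT (fun=> Xt z0) by apply: mxLb_L1 => //; exact: mxLb_cst.
  rewrite !meanE -mxI_mull// -(@mxI_ext _ _ _ m setT _ _ (fun x => Xt x - Xt z0)).
    rewrite mxIB//; congr (_ - _).
    by apply/matrixP => i j; rewrite mxE Rintegral_prob_cst.
  by move=> x _; rewrite [LHS]Phi0E.
move=> s sab; rewrite meanX//.
have := fwd_sol_D (Xhs z0) (fwd_sol_M tT' Phis (fwd_sol_cst t T (mean m c))).
rewrite Phic addrC subrK => Ms.
apply: (@linear_ode_unique R t T n Acl (fun r => hcl r (Xhb r)) (mean m Xt)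
  (fun s => Xh s z0 + Phi s *m mean m c) Xhb tT' Aclb) => //.
apply: fwd_sol_ext Ms => // r _.
by rewrite mulmx0 addr0 (mulmxDr (Acl r)) (mulmxA (Acl r)) addrAC.
Qed.

Let X2 : mxL2 pm IX (fun z => Xh z.1 z.2).
Proof. by case: optimal_state_regularity. Qed.
Let Xs2 s : t <= s <= T -> mxL2 m setT (Xh s).
Proof. by case: optimal_state_regularity => _ H _; exact: H. Qed.
Let meanXh s : t <= s <= T -> mean m (Xh s) = Xhb s.
Proof. by case: optimal_state_regularity => _ _; exact. Qed.
Let Xhbb : mxLb mu `[t, T] Xhb. Proof. exact: (fwd_sol_Lb tT' Xhbs). Qed.
Let f1 : mxL1 mu `[t, T] f. Proof. exact: mxL2_L1. Qed.

Lemma optimal_control_L2 : mxL2 pm IX (fun z => Vh z.1 z.2).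
Proof. exact: (feedback_L2 X2 Xhbb). Qed.

Lemma optimal_is_state : is_state m t T F Fb G f Xt Vh Xh.
Proof.
split => [s sab|]; first by apply/L2mP; exact: Xs2.
apply: aeW => x; apply: fwd_sol_ext (Xhs x) => // s sab.
by rewrite -closed_loopE meanXh.
Qed.

Local Notation J := (payoff m t T (fun s => calM m (M s + Mb s) (MbS s))
  (calM m MT MbST) N alpha beta alphaT).

Lemma state_payoff V Y : mxL2 pm IX (fun p => V p.1 p.2) ->
  is_state m t T F Fb G f Xt V Y ->
  exists Y', [/\ regular_state m t T F Fb G f Xt V Y',
    forall s, t <= s <= T -> {ae m, forall x, Y s x = Y' s x} &
    J V Y = value + 2^-1 * Rintegral mu `[t, T] (devcost V Y')].
Proof.
move=> V2 Yst; have [Y' hY' YY'] := state_regularization tT hF hFb hG hf hXt V2 Yst.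
exists Y'; split => //; rewrite -(payoff_identity V2 hY').
apply: payoff_ae => // s sab; first by have [H _] := Yst; exact/L2mP/H.
by have [_ H _ _] := hY'; exact: H.
Qed.

(** The identity is applied to a regular modification of [Xh]. At each time its mean is still [Xhb]
    and it equals [Xh] for almost every [x], so [Vh] is its own feedback and the deviation cost
    vanishes. *)
Lemma optimal_payoff : J Vh Xh = value.
Proof.
have [Y' [hY' XY' ->]] := state_payoff optimal_control_L2 optimal_is_state.
have [_ Ys2 _ _] := hY'.
suff -> : Rintegral mu `[t, T] (devcost Vh Y') = 0 by rewrite mulr0 addr0.
have d1 := deviation_cost_L1 optimal_control_L2 hY'.
rewrite -[RHS](mul0r (fine (mu `[t, T]))) -(Rintegral_cst mu mTT 0).
apply: ae_eq_Rintegral => //; first exact: L1f_measurable d1.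
apply: aeS (mxL2_ae_time (deviation_L2 optimal_control_L2 hY')) => s ds sI.
have sab : t <= s <= T by move: sI; rewrite /= in_itv.
have mY' : mean m (Y' s) = Xhb s.
  rewrite -meanXh//; apply: mean_ae; [exact: Ys2|exact: Xs2|].
  by apply: aeS (XY' s sab) => x ->.
have ds2 := ds sI.
have dN : mxL2 m setT (fun x => N s *m dev Vh Y' s x).
  by apply: mxLbL2M => //; exact: mxLb_cst.
rewrite /devcost -[RHS](Rintegral_prob_cst m 0); apply: ae_eq_Rintegral => //.
  exact: L1f_measurable (dotv_L1 measurableT dN ds2).
apply: aeS (XY' s sab) => x Xx _.
by rewrite /dev /Vh Xx mY' subrr mulmx0 dotvE mulmx0 mxE.
Qed.

Lemma optimal_value_le V Y : mxL2 pm IX (fun p => V p.1 p.2) ->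
  is_state m t T F Fb G f Xt V Y -> value <= J V Y.
Proof.
move=> V2 Yst; have [Y' [hY' _ ->]] := state_payoff V2 Yst.
by rewrite lerDl mulr_ge0// Rintegral_devcost_ge0.
Qed.

(** The law is affine in the state, so it commutes with averaging under a probability measure. *)
Let mean_feedback (Z : Rn R n -> 'cV[R]_n) yb s : mxL2 m setT Z ->
  mean m (fun x => feedback (Z x) yb s) = feedback (mean m Z) yb s.
Proof.
move=> Z2; pose A1 := - Ni s *m (G s)^T *m P s.
have E y : feedback y yb s = A1 *m y + feedback 0 yb s.
  rewrite /feedback mulmx0 add0r /A1 -[in RHS]mulmxA addrA.
  by rewrite -mulmxDr.
have Z1 := mxL2_L1 measurableT moo Z2.
have k1 : mxL1 m setT (fun=> feedback 0 yb s).
  by apply: mxLb_L1 => //; exact: mxLb_cst.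
have AZ : mxL1 m setT (fun x => A1 *m Z x) by apply: mxLbL1M => //; exact: mxLb_cst.
rewrite [RHS]E !meanE.
rewrite (@mxI_ext _ _ _ m setT _ _ _ (fun x => A1 *m Z x + feedback 0 yb s)).
  rewrite mxID// mxI_mull//; congr (_ + _).
  by apply/matrixP => i j; rewrite mxE Rintegral_prob_cst.
by move=> x _; rewrite E.
Qed.

Let hclL1 : mxL1 mu `[t, T] (fun r => hcl r (Xhb r)).
Proof.
have Gt : mxLb mu `[t, T] (fun s => (G s)^T) by exact: mxLb_tr.
have GN : mxLb mu `[t, T] (fun s => G s *m Ni s) by exact: mxLbM.
have Gamb : mxLb mu `[t, T] Gam by exact: mxLbB.
have GNG : mxLb mu `[t, T] (fun s => G s *m Ni s *m (G s)^T *m Gam s).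
  by apply: mxLbM => //; exact: mxLbM.
have q0b : mxLb mu `[t, T] q0 by apply: mxLbD => //; exact: mxLbM.
apply: mxL1D => //; apply: mxLb_L1 => //; apply: mxLbB => //; last exact: mxLbM.
by apply: mxLbM => //; exact: mxLbB.
Qed.

(** * Uniqueness of the minimizer *)

Section uniqueness.
Context (V : R -> Rn R n -> 'cV[R]_d) (V2 : mxL2 pm IX (fun p => V p.1 p.2)).
Context (Y : R -> Rn R n -> 'cV[R]_n) (hY : regular_state m t T F Fb G f Xt V Y).
Context (W0 : Rintegral mu `[t, T] (devcost V Y) = 0).

Let dev0 := devcost_eq0 V2 hY W0.
Let yb s := mean m (Y s).
Let Ys2 s : t <= s <= T -> mxL2 m setT (Y s). Proof. by case: hY => ? H _ _; exact: H. Qed.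
Let Y2 : mxL2 pm IX (fun p => Y p.1 p.2). Proof. by case: hY. Qed.
Let ybs : fwd_sol t T (mean m Xt) yb
  (fun r => (F r + Fb r) *m yb r + G r *m mean m (V r) + f r).
Proof. by case: hY. Qed.
Let ybb : mxLb mu `[t, T] yb. Proof. exact: (fwd_sol_Lb tT' ybs). Qed.

(** With zero deviation the mean of [V] is the feedback at [yb], which turns the averaged state
    equation into the closed linear equation of [Xhb]. *)
Lemma optimal_mean s : t <= s <= T -> yb s = Xhb s.
Proof.
pose Bcl r := F r + Fb r - G r *m Ni r *m (G r)^T *m Sig r.
pose e r := - (G r *m Ni r *m ((G r)^T *m lam r + beta r)) + f r.
have Gt : mxLb mu `[t, T] (fun s => (G s)^T) by exact: mxLb_tr.
have GN : mxLb mu `[t, T] (fun s => G s *m Ni s) by exact: mxLbM.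
have GNG : mxLb mu `[t, T] (fun s => G s *m Ni s *m (G s)^T *m Sig s).
  by apply: mxLbM => //; exact: mxLbM.
have Bclb : mxLb mu `[t, T] Bcl by apply: mxLbB => //; exact: mxLbD.
have e1 : mxL1 mu `[t, T] e.
  apply: mxL1D => //; apply: mxLb_L1 => //; apply: mxLbN => //; apply: mxLbM => //.
  by apply: mxLbD => //; exact: mxLbM.
move: s; apply: (@linear_ode_unique R t T n Bcl e (mean m Xt) yb Xhb tT' Bclb);
  last by apply: fwd_sol_ext hXhb => // s _; rewrite /e addrA.
apply: fwd_sol_ae ybs; last first.
  by apply: mxL1D => //; apply: mxLb_L1 => //; exact: mxLbM.
have ae2 : {ae mu, forall s, `[t, T]%classic s -> mxL2 m setT (V s) /\
    mxL2 m setT (fun x => feedback (Y s x) (yb s) s)}.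
  have fb := @mxL2_ae_time R n m t T d (fun s x => feedback (Y s x) (yb s) s)
    (feedback_L2 Y2 ybb).
  apply: aeS2 (mxL2_ae_time V2) fb => s a b sI.
  by split; [exact: a|exact: b].
apply: aeS2 ae2 dev0 => s ae2s devs sI.
have sab : t <= s <= T by move: sI; rewrite /= in_itv.
have [Vs fs] := ae2s sI.
have -> : mean m (V s) = feedback (yb s) (yb s) s.
  rewrite -mean_feedback; last exact: Ys2.
  apply: mean_ae => //; apply: aeS (devs sI) => x /eqP.
  by rewrite subr_eq0 => /eqP.
by rewrite mulmxDl closed_loopE -closed_loop_meanE /e addrA.
Qed.

(** For almost every [x] the control is the feedback at almost every time. The mean inside it being
    known, path and [Xh] solve the same linear equation from [Xt x]. *)
Lemma optimal_paths : {ae m, forall x, forall s, t <= s <= T -> Y s x = Xh s x}.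
Proof.
have [_ devx] := ae_time_space (deviation_L2 V2 hY) dev0.
have [_ _ Yae _] := hY.
apply: aeS2 devx Yae => x devx Yx s sab.
have Yxb := fwd_sol_Lb tT' Yx.
apply: (@linear_ode_unique R t T n Acl (fun r => hcl r (Xhb r)) (Xt x)
  (Y ^~ x) (Xh ^~ x) tT' Aclb) => //.
apply: fwd_sol_ae Yx; last first.
  by apply: mxL1D => //; apply: mxLb_L1 => //; exact: mxLbM.
apply: aeS devx => r dr rI.
have rab : t <= r <= T by move: rI; rewrite /= in_itv.
have /eqP := dr rI; rewrite subr_eq0 => /eqP ->.
by rewrite -/(yb r) closed_loopE optimal_mean.
Qed.

(** Once [Y] and its mean are [Xh] and [Xhb], the vanishing deviation from the feedback along [Y] is
    the difference [V - Vh]. *)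
Lemma optimal_control_unique :
  (\int[mu]_(s in `[t, T]) \int[m]_x (normsq (V s x - Vh s x))%:E = 0)%E.
Proof.
pose D s x := V s x - Vh s x.
have D2 : mxL2 pm IX (fun z => D z.1 z.2).
  by apply: mxL2B => //; exact: optimal_control_L2.
have D0 : {ae mu, forall s, `[t, T]%classic s -> {ae m, forall x, D s x = 0}}.
  apply: aeS dev0 => s ds sI.
  have sab : t <= s <= T by move: sI; rewrite /= in_itv.
  apply: aeS2 (ds sI) optimal_paths => x dx px.
  by rewrite -dx /D /dev /Vh px// -/(yb s) optimal_mean.
have [I0 _] := ae_time_space D2 D0.
have n1 : L1f pm IX (fun z => normsq (D z.1 z.2)) by apply: dotv_L1.
have := @L1f_fubini_ereal _ _ _ _ _ mu m `[t, T]%classic setT mTT measurableT _ n1.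
by rewrite I0.
Qed.

End uniqueness.

Lemma optimal_unique V Y : mxL2 pm IX (fun p => V p.1 p.2) ->
  is_state m t T F Fb G f Xt V Y -> J V Y = value ->
  (\int[mu]_(s in `[t, T]) \int[m]_x (normsq (V s x - Vh s x))%:E = 0)%E.
Proof.
move=> V2 Yst; have [Y' [hY' _ ->]] := state_payoff V2 Yst => E.
apply: (optimal_control_unique V2 hY').
by move: E; set I0 := Rintegral _ _ _; lra.
Qed.

End linear_quadratic_control.

Theorem theorem2p1 (R : realType) (n d : nat) (m : probability (Rn R n) R)
  (T t : R)
  (F Fb M Mb S : R -> 'M[R]_n) (G : R -> 'M[R]_(n, d)) (N : R -> 'M[R]_d)
  (MT MbT : 'M[R]_n) (f alpha : R -> 'cV[R]_n) (beta : R -> 'cV[R]_d)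
  (alphaT : 'cV[R]_n)
  (* data *)
  (hF : Linf T F) (hFb : Linf T Fb) (hM : Linf T M) (hMb : Linf T Mb)
  (hS : Linf T S) (hG : Linf T G) (hN : Linf T N)
  (hNinv : Linf T (fun s => invmx (N s)))
  (hMsym : forall s, s \in `]0, T[ -> symmx (M s))
  (hMbsym : forall s, s \in `]0, T[ -> symmx (Mb s))
  (hNsym : forall s, s \in `]0, T[ -> symmx (N s))
  (hNpd : forall s, s \in `]0, T[ -> pdmx (N s))
  (hMTsym : symmx MT) (hMbTsym : symmx MbT)
  (hf : L2time T f) (halpha : Linf T alpha) (hbeta : Linf T beta) :
  let MbS := fun s => (S s)^T *m Mb s *m S s - (S s)^T *m Mb s - Mb s *m S s in
  let MbST := (S T)^T *m MbT *m S T - (S T)^T *m MbT - MbT *m S T in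
  (* standing assumption *)
  (forall s, s \in `]0, T[ -> psdmx (M s + Mb s)) ->
  (forall s, s \in `]0, T[ -> psdmx (M s + Mb s + MbS s)) ->
  psdmx (MT + MbT) -> psdmx (MT + MbT + MbST) ->
  forall (Xt : Rn R n -> 'cV[R]_n)
    (P Sigma : R -> 'M[R]_n) (lam Xhb : R -> 'cV[R]_n)
    (Xh : R -> Rn R n -> 'cV[R]_n),
  0 <= t < T ->
  L2m m Xt ->
  (* Riccati equations for P and Sigma on [t,T] *)
  bwd_sol t T (MT + MbT) P (fun r =>
     P r *m F r + (F r)^T *m P r
     - P r *m G r *m invmx (N r) *m (G r)^T *m P r + M r + Mb r) ->
  (forall s, t <= s <= T -> symmx (P s) /\ psdmx (P s)) ->
  bwd_sol t T (MT + MbT + MbST) Sigma (fun r =>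
     Sigma r *m (F r + Fb r) + (F r + Fb r)^T *m Sigma r
     - Sigma r *m G r *m invmx (N r) *m (G r)^T *m Sigma r
     + M r + Mb r + MbS r) ->
  (forall s, t <= s <= T -> symmx (Sigma s) /\ psdmx (Sigma s)) ->
  let Gam := fun s => Sigma s - P s in
  (* lambda *)
  bwd_sol t T alphaT lam (fun r =>
     ((F r)^T + (Fb r)^T - Sigma r *m G r *m invmx (N r) *m (G r)^T) *m lam r
     + alpha r + Sigma r *m (f r - G r *m invmx (N r) *m beta r)) ->
  (* \hat{\bar X} *)
  fwd_sol t T (mean m Xt) Xhb (fun r =>
     (F r + Fb r - G r *m invmx (N r) *m (G r)^T *m Sigma r) *m Xhb r
     - G r *m invmx (N r) *m ((G r)^T *m lam r + beta r) + f r) ->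
  (* \hat X_x, for every x *)
  (forall x, fwd_sol t T (Xt x) (fun s => Xh s x) (fun r =>
     (F r - G r *m invmx (N r) *m (G r)^T *m P r) *m Xh r x
     + (Fb r - G r *m invmx (N r) *m (G r)^T *m Gam r) *m Xhb r
     - G r *m invmx (N r) *m ((G r)^T *m lam r + beta r) + f r)) ->
  let Vh := fun s x =>
     - invmx (N s) *m (G s)^T *m (P s *m Xh s x + Gam s *m Xhb s)
     - invmx (N s) *m ((G s)^T *m lam s + beta s) in
  let J := payoff m t T
     (fun s => calM m (M s + Mb s) (MbS s)) (calM m (MT + MbT) MbST)
     N alpha beta alphaT in
  let Ct := Rintegral (@lebesgue_measure R) `[t, T] (fun s => dotv (f s) (lam s))
     - 2^-1 * Rintegral (@lebesgue_measure R) `[t, T] (fun s =>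
         dotv (invmx (N s) *m ((G s)^T *m lam s + beta s))
              ((G s)^T *m lam s + beta s)) in
  let value := 2^-1 * Rintegral m setT (fun x => dotv (P t *m Xt x) (Xt x))
     + 2^-1 * dotv (Gam t *m mean m Xt) (mean m Xt)
     + dotv (lam t) (mean m Xt) + Ct in
  [/\ (* Vh is an admissible control, attaining the value *)
      admissible m t T Vh,
      exists Y, is_state m t T F Fb G f Xt Vh Y /\ J Vh Y = value,
      (* value is a lower bound of J over all admissible controls *)
      forall V Y, admissible m t T V -> is_state m t T F Fb G f Xt V Y ->
        value <= J V Y
    & (* uniqueness of the minimizer in L^2(t,T;U) *)
      forall V Y, admissible m t T V -> is_state m t T F Fb G f Xt V Y ->
        J V Y = value ->
        (\int[@lebesgue_measure R]_(s in `[t, T])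
            \int[m]_x (normsq (V s x - Vh s x))%:E = 0)%E].
Proof.
move=> MbS MbST _ _ _ _ Xt P Sigma lam Xhb Xh /andP[t0 tT] /L2mP hXt.
move=> hP hPs hSig hSs Gam hlam hXhb hXh Vh J Ct value.
have tT' := ltW tT.
have hF' := Linf_mxLb t0 hF; have hFb' := Linf_mxLb t0 hFb.
have hM' := Linf_mxLb t0 hM; have hMb' := Linf_mxLb t0 hMb.
have hS' := Linf_mxLb t0 hS; have hG' := Linf_mxLb t0 hG.
have hN' := Linf_mxLb t0 hN; have hNi' := Linf_mxLb t0 hNinv.
have hf' := L2time_mxL2 t0 hf.
have ha' := Linf_mxLb t0 halpha; have hb' := Linf_mxLb t0 hbeta.
have hMbS' : mxLb (@lebesgue_measure R) `[t, T] MbS.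
  have hSt := mxLb_tr hS'.
  apply: mxLbB => //; last exact: mxLbM.
  apply: mxLbB => //; last exact: mxLbM.
  by apply: mxLbM => //; exact: mxLbM.
(* As [t] may be 0, only the interior of [[t, T]] is certain to lie where the properties of [N] are
   assumed. *)
have sI s : t < s < T -> s \in `]0, T[.
  by move=> /andP[ts sT]; rewrite in_itv/= (le_lt_trans t0 ts).
have hNs s (sab : t < s < T) := hNsym s (sI s sab).
have hNp s (sab : t < s < T) := hNpd s (sI s sab).
have [P1 PT] := bwd_fwd_sol tT' hP.
have [S1 ST] := bwd_fwd_sol tT' hSig.
have [l1 lT] := bwd_fwd_sol tT' hlam.
have Psym s (sab : t <= s <= T) := (hPs s sab).1.
have Ssym s (sab : t <= s <= T) := (hSs s sab).1.
have Vh2 := optimal_control_L2 tT hF' hG' hNi' hb' P1 S1 l1 hXt hXhb hXh.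
split.
- by apply/admissibleP; exact: Vh2.
- exists Xh; split; first exact: (optimal_is_state tT hF' hG' hNi' P1 hXt hXhb hXh).
  exact: (optimal_payoff tT hF' hFb' hM' hMb' hMbS' hG' hN' hNi' hf' ha' hb' hNs hNp
    P1 PT S1 ST l1 lT Psym Ssym hXt hXhb hXh).
- move=> V Y /admissibleP V2 Yst.
  exact: (optimal_value_le tT hF' hFb' hM' hMb' hMbS' hG' hN' hNi' hf' ha' hb' hNs hNp
    P1 PT S1 ST l1 lT Psym Ssym hXt V2 Yst).
- move=> V Y /admissibleP V2 Yst E.
  exact: (optimal_unique tT hF' hFb' hM' hMb' hMbS' hG' hN' hNi' hf' ha' hb' hNs hNp
    P1 PT S1 ST l1 lT Psym Ssym hXt hXhb hXh V2 Yst E).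
Qed.
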